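(* Let $q$ be a prime power and $\ell$ a prime not dividing $q$, and let $n_q$ be the multiplicative order of $q$ modulo $\ell$. Assume $n_q>1$. Let $g\ge 0$ be an integer with $2g+2\ell-2\not\equiv 0\pmod{(\ell-1)n_q}$. Then $\mathcal{H}_{g,\ell}=\emptyset$.
   Context: $\mathcal{H}_{g,\ell}$ denotes the set of $\ell$-cyclic covers $\varphi\colon C\to\mathbb{P}^1_{\mathbb{F}_q}$, up to isomorphism of covers, where $C$ is a smooth projective geometrically connected curve over $\mathbb{F}_q$ of genus $g$ and the function field extension $\mathbb{F}_q(C)/\mathbb{F}_q(\mathbb{P}^1_{\mathbb{F}_q})$ is Galois with group isomorphic to $\mathbb{Z}/\ell\mathbb{Z}$. Equivalently, it is the set of Galois extensions $L/\mathbb{F}_q(X)$ (inside a fixed algebraic closure) with group $\mathbb{Z}/\ell\mathbb{Z}$, with $L\cap\overline{\mathbb{F}}_q=\mathbb{F}_q$ and with $L$ of genus $g$. *)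

(* Defs.v *)
From HB Require Import structures.
From mathcomp Require Import all_boot all_order all_algebra all_fingroup.
From mathcomp Require Import all_solvable all_field.
From mathcomp Require Import boolp classical_sets functions cardinality fsbigop.
From mathcomp Require Import constructive_ereal.

Set Implicit Arguments.
Unset Strict Implicit.
Unset Printing Implicit Defensive.

Import Order.TTheory GRing.Theory Num.Theory.
Local Open Scope ring_scope.

(* The order of q in (Z/n)^*; meaningful for n > 1 and q prime to n (if q is  *)
(* not a unit modulo n, insubd falls back on the neutral element).            *)
Definition mult_order (n q : nat) : nat :=
  #[insubd (1%g : {unit 'Z_n}) (q%:R : 'Z_n)]%g.

Section FunctionField.
Variables (F : fieldType) (L : fieldExtType {fraction {poly F}}).

Definition cst : F -> L :=
  in_alg L \o (@tofrac {poly F}) \o (@polyC F).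

(* n is the F-dimension of V / W, for F-subspaces W <= V of L: there are n    *)
(* vectors of V whose classes modulo W form a basis of V / W.                 *)
Definition is_qdim (V W : set L) (n : nat) : Prop :=
  exists b : 'I_n -> L,
    [/\ forall i, V (b i),
        forall x, V x -> exists c : 'I_n -> F, W (x - \sum_i cst (c i) * b i)
      & forall c : 'I_n -> F, W (\sum_i cst (c i) * b i) ->
          forall i, c i = 0].

(* The junk value 0 is taken when V / W is infinite-dimensional.              *)
Definition qdim (V W : set L) : nat := xget 0%N [set n | is_qdim V W n].

(* Places are represented by their normalized discrete valuations, with       *)
(* values in Z extended by v(0) = +oo.                                        *)
Record place := Place {
  val_at :> L -> \bar int;
  val_at_eqy : forall x, val_at x = +oo%E <-> x = 0;
  val_atM : forall x y, val_at (x * y) = (val_at x + val_at y)%E;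
  val_atD : forall x y,
    (Order.min (val_at x) (val_at y) <= val_at (x + y))%E;
  val_at_norm : exists t, val_at t = 1%:E;
  val_at_cst : forall c : F, c != 0 -> val_at (cst c) = 0%E
}.

HB.instance Definition _ := gen_eqMixin place.
HB.instance Definition _ := gen_choiceMixin place.

Definition val_ring (P : place) : set L := [set x | (0%E <= P x)%E].
Definition val_ideal (P : place) : set L := [set x | (0%E < P x)%E].

Definition place_deg (P : place) : nat := qdim (val_ring P) (val_ideal P).

Record divisor := Divisor {
  div_mult :> place -> int;
  div_fin : finite_set [set P | div_mult P != 0]
}.

Definition div_deg (D : divisor) : int :=
  \sum_(P \in [set: place]) D P * (place_deg P)%:Z.

Definition RR_space (D : divisor) : set L :=
  [set x | forall P : place, ((- D P)%:E <= P x)%E].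

Definition RR_dim (D : divisor) : nat := qdim (RR_space D) [set 0].

(* The genus of L / F is the maximum of deg D - l(D) + 1 over all divisors D. *)
Definition has_genus (g : nat) : Prop :=
  (forall D : divisor, div_deg D - (RR_dim D)%:Z + 1 <= g%:Z) /\
  (exists D : divisor, div_deg D - (RR_dim D)%:Z + 1 = g%:Z).

Definition full_constant_field : Prop :=
  forall x : L, algebraicOver cst x -> exists c : F, x = cst c.

End FunctionField.

(* Membership in H_{g,ell}, through function fields of covers. Every finite   *)
(* Galois extension is a splitting field, so taking L in splittingFieldType   *)
(* (needed for 'Gal) loses no extension.                                      *)
Definition in_H (F : finFieldType) (ell g : nat)
    (L : splittingFieldType {fraction {poly F}}) : Prop :=
  [/\ galois 1 {:L},
      'Gal({:L} / 1) \isog Zp ell,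
      full_constant_field L
    & has_genus L g].

(* Main.v *)
Require Import Defs.
From HB Require Import structures.
From mathcomp Require Import all_boot all_order all_algebra all_fingroup.
From mathcomp Require Import all_solvable all_field.
From mathcomp Require Import boolp classical_sets functions cardinality fsbigop.
From mathcomp Require Import constructive_ereal zify ring.

(** Write e_P for the ramification indices over F(X). Riemann-Hurwitz says that
2 g - 2 + 2 ell is the sum of the (e_P - 1) deg P. At a ramified place P the
index e_P is ell, and G acts on the q^(deg P) elements of P / P^2; as ell is
prime to q, a nonzero fixed point could be averaged into an element of F(X) of
valuation 1 at P, so 0 is the only fixed point and q^(deg P) = 1 modulo ell,
i.e. n_q divides deg P.

For Riemann-Hurwitz, let (X)oo be the pole divisor of X and Diff the sum of the
(e_P - 1) P. The functions without finite poles have a basis w_i over F[X], with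
w_i in L(m_i (X)oo), which is reduced at infinity, so that L(M (X)oo) has
dimension the sum of the M + 1 - m_i. By tameness L(Diff + M (X)oo) is dual to
it for the trace form, and the dual basis gives the dimension as the sum of the
M + 1 + m_i. The two dimensions add up to 2 ell (M + 1), while the definition of
the genus gives l(D + M (X)oo) = deg D + M deg (X)oo + 1 - g for large M. *)

(** Only the axioms of a normalized valuation are given for places, and the genus is only Riemann's
    maximum, so the supply of places and their symmetry have to be constructed. Places above a
    polynomial and above infinity come from Chevalley's extension argument: a subring of [L] maximal
    among those avoiding a suitable inverse is a valuation ring, and it is discrete because the
    n!-th power of every element of [L] has, up to a unit, a value taken on F(X). That the places
    above one prime of F(X) are conjugate under G follows from approximation and minimal
    polynomials; this makes supports finite and lets integrality at one place be tested through the
    trace. Primality of ell gives a dichotomy at each place: either it is unramified and absent from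
    Diff, or its decomposition group is all of G. Adding M (X)oo serves two purposes: it brings the
    divisors into the range where the inequality defining the genus is an equality, and it makes
    every M + 1 - m_i a genuine count of coefficients. Finally 2 g - 2 + 2 ell is a sum of terms
    (ell - 1) deg P with n_q dividing deg P, hence a multiple of (ell - 1) n_q, which the congruence
    hypothesis forbids. *)

Module CyclicCover.
Set Implicit Arguments.
Unset Strict Implicit.
Import Order.TTheory GRing.Theory Num.Theory.
Local Open Scope ring_scope.

(** * Valuations and weak approximation *)

Section Places.
Variables (F : fieldType) (L : fieldExtType {fraction {poly F}}).
Implicit Types (P Q : place L) (x y : L) (k j : int).

Local Notation scal := (@Defs.cst F L).
(* pord P 0 is a junk value; val_ge P k x also covers x = 0. *)
Definition val_ge P k x : bool := (k%:E <= P x)%E.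
Definition pord P x : int := fine (P x).

HB.instance Definition _ := GRing.RMorphism.copy scal
  (in_alg L \o @tofrac {poly F} \o @polyC F).

Lemma place1 P : P 1 = 0%E.
Proof. by have := @val_at_cst _ _ P 1 (oner_neq0 _); rewrite rmorph1. Qed.

Lemma place0 P : P 0 = +oo%E.
Proof. exact/val_at_eqy. Qed.

Lemma pordE P x : x != 0 -> P x = (pord P x)%:E.
Proof.
move=> x0; rewrite /pord; case E: (P x) => [k| |] //.
  by move/val_at_eqy: E x0 => ->; rewrite eqxx.
have := place1 P; rewrite -(mulfV x0) val_atM E.
by case: (P x^-1).
Qed.

Lemma val_geE P k x : x != 0 -> val_ge P k x = (k <= pord P x).
Proof. by move=> x0; rewrite /val_ge pordE // lee_fin. Qed.

Lemma val_ge0 P k : val_ge P k 0.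
Proof. by rewrite /val_ge place0 leey. Qed.

Lemma pordM P x y : x != 0 -> y != 0 -> pord P (x * y) = pord P x + pord P y.
Proof. by move=> x0 y0; rewrite /pord val_atM !pordE. Qed.

Lemma pord1 P : pord P 1 = 0.
Proof. by rewrite /pord place1. Qed.

Lemma pordV P x : x != 0 -> pord P x^-1 = - pord P x.
Proof.
by move=> x0; have := pordM P (invr_neq0 x0) x0; rewrite mulVf // pord1; lia.
Qed.

Lemma pordX P x n : x != 0 -> pord P (x ^+ n) = n%:Z * pord P x.
Proof.
move=> x0; elim: n => [|n IH]; first by rewrite expr0 pord1 mul0r.
by rewrite exprS pordM ?expf_neq0 // IH; lia.
Qed.

Lemma pord_cst P (c : F) : c != 0 -> pord P (scal c) = 0.
Proof. by move=> c0; rewrite /pord val_at_cst. Qed.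

Lemma val_ge_cst P (c : F) : val_ge P 0 (scal c).
Proof.
have [->|c0] := eqVneq c 0; first by rewrite rmorph0 val_ge0.
by rewrite val_geE ?fmorph_eq0 // pord_cst.
Qed.

Lemma val_ge_le P k j x : j <= k -> val_ge P k x -> val_ge P j x.
Proof. by move=> jk; apply: le_trans; rewrite lee_fin. Qed.

Lemma val_geD P k x y : val_ge P k x -> val_ge P k y -> val_ge P k (x + y).
Proof.
move=> kx ky; apply: le_trans (val_atD P x y).
by rewrite le_min; apply/andP.
Qed.

Lemma val_geM P k j x y : val_ge P k x -> val_ge P j y -> val_ge P (k + j) (x * y).
Proof.
have [->|x0] := eqVneq x 0; first by rewrite mul0r !val_ge0.
have [->|y0] := eqVneq y 0; first by rewrite mulr0 !val_ge0.
by rewrite !val_geE ?mulf_neq0 // pordM // => *; apply: lerD.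
Qed.

Lemma val_ge_cstM P k (c : F) x : val_ge P k x -> val_ge P k (scal c * x).
Proof. by move=> kx; rewrite -(add0r k) val_geM ?val_ge_cst. Qed.

Lemma val_geN P k x : val_ge P k (- x) = val_ge P k x.
Proof.
have H y : val_ge P k y -> val_ge P k (- y).
  by move=> ky; rewrite -mulN1r -(rmorphN1 scal) val_ge_cstM.
by apply/idP/idP => /H //; rewrite opprK.
Qed.

Lemma val_geB P k x y : val_ge P k x -> val_ge P k y -> val_ge P k (x - y).
Proof. by move=> kx ky; rewrite val_geD ?val_geN. Qed.

Lemma val_ge_sum P k (I : Type) (r : seq I) (p : pred I) (f : I -> L) :
  (forall i, p i -> val_ge P k (f i)) -> val_ge P k (\sum_(i <- r | p i) f i).
Proof. by move=> H; elim/big_ind: _ => //; [exact: val_ge0 | move=> *; exact: val_geD]. Qed.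

Lemma val_ge_prod P (I : Type) (r : seq I) (p : pred I) (f : I -> L) :
  (forall i, p i -> val_ge P 0 (f i)) -> val_ge P 0 (\prod_(i <- r | p i) f i).
Proof.
move=> H; elim/big_ind: _ => //; first by rewrite val_geE ?oner_eq0 // pord1.
by move=> x y ? ?; rewrite -(addr0 0) val_geM.
Qed.

Lemma val_ge_pord P x : val_ge P (pord P x) x.
Proof. by have [->|x0] := eqVneq x 0; rewrite ?val_ge0 // val_geE. Qed.

Lemma pord_dom P x y : x != 0 -> val_ge P (pord P x + 1) y ->
  x + y != 0 /\ pord P (x + y) = pord P x.
Proof.
move=> x0 xy; have N : ~~ val_ge P (pord P x + 1) (x + y).
  apply/negP => H; have := val_geB H xy; rewrite addrK val_geE //; lia.
have xy0 : x + y != 0 by apply: contraNneq N => ->; rewrite val_ge0.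
split=> //; apply/eqP; rewrite eq_le -(val_geE _ _ xy0) val_geD ?val_ge_pord ?andbT //.
  by move: N; rewrite val_geE //; lia.
by apply: val_ge_le xy; lia.
Qed.

Lemma val_ge_mulE P k x y : x != 0 -> val_ge P (k + pord P x) (x * y) = val_ge P k y.
Proof.
move=> x0; have [->|y0] := eqVneq y 0; first by rewrite mulr0 !val_ge0.
by rewrite !val_geE ?mulf_neq0 // pordM // addrC lerD2l.
Qed.

Lemma place_eq P Q : (forall x, x != 0 -> pord P x = pord Q x) -> P = Q.
Proof.
move=> H; have E : val_at P = val_at Q.
  apply/funext => x; have [->|x0] := eqVneq x 0; first by rewrite !place0.
  by rewrite !pordE // H.
case: P Q E {H} => [v h1 h2 h3 h4 h5] [v' h1' h2' h3' h4' h5'] /= E.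
by case: _ / E in h1' h2' h3' h4' h5' *; congr Place; exact: Prop_irrelevance.
Qed.

Lemma uniformizer P : exists2 t, t != 0 & pord P t = 1.
Proof.
have [t tP] := val_at_norm P; exists t; last by rewrite /pord tP.
by apply/eqP => t0; move: tP; rewrite t0 place0.
Qed.

(** If the valuation ring of P lay inside that of Q, units at P would be units at Q, so Q would be P
    multiplied by the constant [pord Q t], for t a uniformizer at P. Since Q takes the value 1, this
    constant is 1 and Q = P. *)
Lemma place_sep P Q : P != Q -> exists2 x, x != 0 & (0 <= pord P x) && (pord Q x < 0).
Proof.
move=> PQ; apply/not_exists2P => H.
have {}H x : x != 0 -> 0 <= pord P x -> 0 <= pord Q x.
  move=> x0 Px; case: (H x) => [/negP|/negP]; first by rewrite x0.
  by rewrite Px /= -leNgt.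
have H0 x : x != 0 -> pord P x = 0 -> pord Q x = 0.
  move=> x0 Px; apply/eqP; rewrite eq_le (H x) ?Px // andbT -oppr_ge0 -pordV //.
  by rewrite (H) ?invr_eq0 // pordV // Px.
have [t t0 tP] := uniformizer P; have [s s0 sQ] := uniformizer Q.
have E x : x != 0 -> pord Q x = pord P x * pord Q t.
  have E1 (n : nat) y : y != 0 -> pord P y = n%:Z -> pord Q y = pord P y * pord Q t.
    move=> y0 Py; have : pord Q (y / t ^+ n) = 0.
      apply: H0; rewrite ?mulf_neq0 ?invr_eq0 ?expf_neq0 // pordM ?invr_eq0 ?expf_neq0 //.
      by rewrite pordV ?expf_neq0 // pordX // Py tP; lia.
    by rewrite pordM ?invr_eq0 ?expf_neq0 // pordV ?expf_neq0 // pordX // Py; lia.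
  move=> x0; case: (lerP 0 (pord P x)) => Px.
    by apply: (E1 `|pord P x|%N) => //; lia.
  have := E1 `|pord P x|%N x^-1; rewrite invr_eq0 !pordV // => /(_ x0); lia.
have Qt : pord Q t = 1.
  have := E s s0; rewrite sQ => /esym E1; have := H t t0; rewrite tP => /(_ isT).
  move: (pord P s) (pord Q t) E1 => a b ab b0.
  case: (lerP a 0) => a0; first by nia.
  case: (lerP b 1) => b1; last by nia.
  case: (eqVneq b 0) => [b00|]; first by move: ab; rewrite b00 mulr0.
  lia.
by case/eqP: PQ; apply: place_eq => x x0; rewrite E // Qt mulr1.
Qed.

Lemma place_sep2 P Q : P != Q -> exists2 x, x != 0 & (0 < pord P x) && (pord Q x < 0).
Proof.
move=> PQ; have [x x0 /andP[Px Qx]] := place_sep PQ.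
rewrite eq_sym in PQ; have [y y0 /andP[Qy Py]] := place_sep PQ.
exists (x / y); first by rewrite mulf_neq0 ?invr_eq0.
by rewrite !pordM ?invr_eq0 // !pordV //; apply/andP; split; lia.
Qed.

(** Induction on [s]. If x has no pole at the new place Q, it is corrected to x + y^r, where y
    separates P from Q: for r large, y^r dominates wherever y has a pole, and at the other places of
    [s] y^r is integral and the pole of x survives. *)
Lemma place_seps P (s : seq (place L)) : P \notin s ->
  exists2 x, x != 0 & (0 < pord P x) && all (fun Q => pord Q x < 0) s.
Proof.
elim: s => [_|Q s IH].
  by have [t t0 tP] := uniformizer P; exists t; rewrite // tP.
rewrite inE negb_or => /andP[PQ /IH[x x0 /andP[Px /allP sx]]].
have [y y0 /andP[Py Qy]] := place_sep2 PQ.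
case: (ltrP (pord Q x) 0) => Qx.
  by exists x => //=; rewrite Px Qx; apply/allP.
have [r r1 rs] : exists2 r : nat, (0 < r)%N & forall Q', Q' \in s -> - r%:Z < pord Q' x.
  elim: (s) => [|Q' s' [r r1 IH']]; first by exists 1%N.
  exists (r + `|pord Q' x|%N)%N; first by lia.
  by move=> Q''; rewrite inE => /orP[/eqP ->|/IH'] ; lia.
have yr0 : y ^+ r != 0 by rewrite expf_neq0.
have key Q' : pord Q' y < 0 -> - r%:Z < pord Q' x ->
    x + y ^+ r != 0 /\ pord Q' (x + y ^+ r) < 0.
  move=> Q'y Q'x; have Hr : pord Q' (y ^+ r) <= - r%:Z by rewrite pordX //; nia.
  rewrite addrC; have [||-> ->] := @pord_dom Q' (y ^+ r) x => //.
    by rewrite val_geE //; lia.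
  by split=> //; lia.
have [z0 Qz] : x + y ^+ r != 0 /\ pord Q (x + y ^+ r) < 0 by apply: key => //; lia.
exists (x + y ^+ r) => //=; rewrite Qz /=; apply/andP; split.
  have : val_ge P 1 (x + y ^+ r).
    by apply: val_geD; rewrite val_geE ?pordX //; nia.
  by rewrite val_geE //; lia.
apply/allP => Q' Q's; case: (ltrP (pord Q' y) 0) => Q'y.
  by have [] := key Q' Q'y (rs _ Q's).
have := sx _ Q's => Q'x.
have [||_ ->] // := @pord_dom Q' x (y ^+ r) => //.
by rewrite val_geE // pordX //; nia.
Qed.

(** With x vanishing at P and having poles along [s], the element 1 / (1 + x^(N+1)) is close to 1 at
    P and close to 0 along [s]. *)
Lemma weak_approx P (s : seq (place L)) (N : nat) : P \notin s ->
  exists z, val_ge P N (z - 1) /\ (forall Q, Q \in s -> val_ge Q N z).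
Proof.
move=> /place_seps[x x0 /andP[Px /allP sx]].
have y0 : x ^+ N.+1 != 0 by rewrite expf_neq0.
have [||z0 zP] := @pord_dom P 1 (x ^+ N.+1).
- by rewrite oner_eq0.
- by rewrite val_geE // pord1 pordX //; nia.
exists (1 + x ^+ N.+1)^-1; split.
  have -> : (1 + x ^+ N.+1)^-1 - 1 = - (x ^+ N.+1 / (1 + x ^+ N.+1)) by field.
  by rewrite val_geN val_geE ?mulf_neq0 ?invr_eq0 // pordM ?invr_eq0 // pordV // zP pord1
    pordX //; nia.
move=> Q /sx Qx; have [||_ zQ] := @pord_dom Q (x ^+ N.+1) 1 => //.
  by rewrite val_geE ?oner_eq0 // pord1 pordX //; nia.
by rewrite val_geE ?invr_eq0 // pordV // addrC zQ pordX //; nia.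
Qed.

End Places.

(** * Dimensions of quotients of F-subspaces *)

Section QDim.
Variables (F : fieldType) (L : fieldExtType {fraction {poly F}}).
Local Notation scal := (@Defs.cst F L).
Implicit Types (V U W : set L).

Definition Fspace W :=
  [/\ W 0, forall x y, W x -> W y -> W (x + y)
    & forall c x, W x -> W (scal c * x)].

Definition Fcomb (J : finType) (b : J -> L) (c : J -> F) : L :=
  \sum_j scal (c j) * b j.

Definition indep (J : finType) (b : J -> L) W :=
  forall c : J -> F, W (Fcomb b c) -> forall j, c j = 0.

Definition spans (J : finType) (b : J -> L) V W :=
  forall x, V x -> exists c : J -> F, W (x - Fcomb b c).

Lemma FspaceN W x : Fspace W -> W x -> W (- x).
Proof. by move=> [_ _ WZ] Wx; rewrite -mulN1r -(rmorphN1 scal); apply: WZ. Qed.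

Lemma FspaceB W x y : Fspace W -> W x -> W y -> W (x - y).
Proof. by move=> Ws Wx Wy; have [_ WD _] := Ws; apply: WD => //; apply: FspaceN. Qed.

Lemma Fspace_sum W (I : Type) (r : seq I) (p : pred I) (f : I -> L) : Fspace W ->
  (forall i, p i -> W (f i)) -> W (\sum_(i <- r | p i) f i).
Proof. by move=> [W0 WD _] H; elim/big_ind: _. Qed.

Lemma Fspace_comb W (J : finType) (b : J -> L) (c : J -> F) : Fspace W ->
  (forall j, W (b j)) -> W (Fcomb b c).
Proof. by move=> Ws Wb; apply: Fspace_sum => // j _; have [_ _] := Ws; apply. Qed.

Lemma Fspace_zero : Fspace [set 0].
Proof. by split=> [|x y -> ->|c x ->] /=; rewrite ?addr0 ?mulr0. Qed.

Lemma FcombB (J : finType) (b : J -> L) c c' :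
  Fcomb b (fun j => c j - c' j) = Fcomb b c - Fcomb b c'.
Proof. by rewrite -sumrB; apply: eq_bigr => j _; rewrite rmorphB mulrBl. Qed.

Lemma FcombZ (J : finType) (b : J -> L) a c :
  Fcomb b (fun j => a * c j) = scal a * Fcomb b c.
Proof. by rewrite mulr_sumr; apply: eq_bigr => j _; rewrite rmorphM mulrA. Qed.

Lemma Fcomb_enum (J : finType) (b : J -> L) c :
  Fcomb b c = Fcomb (fun i : 'I_#|J| => b (enum_val i)) (fun i => c (enum_val i)).
Proof. by rewrite /Fcomb -(big_enum_val (fun j => scal (c j) * b j)). Qed.

(** Steinitz by rank: with more [u] than [b], the matrix of coordinates has a nonzero left kernel
    vector, which is a relation between the [u] modulo [W]. *)
Lemma indep_leq (I J : finType) (u : I -> L) (b : J -> L) W : Fspace W ->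
  (forall i, exists c, W (u i - Fcomb b c)) -> indep u W -> (#|I| <= #|J|)%N.
Proof.
move=> Ws /choice[C HC] iu; rewrite leqNgt; apply/negP => ltJI.
pose M := \matrix_(i < #|I|, j < #|J|) C (enum_val i) (enum_val j).
have : kermx M != 0.
  rewrite kermx_eq0 /row_free; apply/negP => /eqP rM.
  by have := rank_leq_col M; rewrite rM leqNgt ltJI.
case/rowV0Pn => v /sub_kermxP vM; case/eqP; apply/rowP => i; rewrite mxE.
rewrite -[i]enum_valK; apply: (iu (fun i => v 0 (enum_rank i))).
have -> : Fcomb u (fun i => v 0 (enum_rank i)) =
    Fcomb (fun i => u i - Fcomb b (C i)) (fun i => v 0 (enum_rank i)).
  apply/eqP; rewrite -subr_eq0 -sumrB; under eq_bigr do rewrite -mulrBr subKr.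
  under eq_bigr do rewrite mulr_sumr; rewrite exchange_big /= big1 // => j _.
  under eq_bigr do rewrite mulrA -rmorphM; rewrite -mulr_suml -raddf_sum.
  have -> : \sum_i v 0 (enum_rank i) * C i j = 0.
    have := congr1 (fun A : 'rV_ _ => A 0 (enum_rank j)) vM; rewrite !mxE.
    apply: etrans; rewrite [RHS](eq_bigr (fun k =>
      v 0 (enum_rank (enum_val k)) * C (enum_val k) j)).
      by rewrite -(big_enum_val (fun i => v 0 (enum_rank i) * C i j)).
    by move=> k _; rewrite mxE enum_valK enum_rankK.
  by rewrite raddf0 mul0r.
by apply: Fspace_comb.
Qed.

Lemma is_qdim_fin (J : finType) (b : J -> L) V W :
  (forall j, V (b j)) -> spans b V W -> indep b W -> is_qdim V W #|J|.
Proof.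
move=> Vb sb ib; exists (fun i => b (enum_val i)); split=> [i|x Vx|c Wc i] //.
  have [c Hc] := sb x Vx; exists (fun i => c (enum_val i)).
  by move: Hc; rewrite Fcomb_enum.
have := ib (fun j => c (enum_rank j)); rewrite Fcomb_enum.
have -> : (fun i => c (enum_rank (enum_val i))) = c.
  by apply/funext => k; rewrite enum_valK.
by move=> /(_ Wc (enum_val i)); rewrite enum_valK.
Qed.

Lemma is_qdim_indep V W n (I : finType) (u : I -> L) : Fspace W -> is_qdim V W n ->
  (forall i, V (u i)) -> indep u W -> (#|I| <= n)%N.
Proof.
move=> Ws [b [Vb sb ib]] Vu iu; rewrite -[n]card_ord.
by apply: (indep_leq Ws _ iu (b := b)) => i; apply: sb.
Qed.

Lemma is_qdim_uniq V W n m : Fspace W -> is_qdim V W n -> is_qdim V W m -> n = m.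
Proof.
move=> Ws Hn Hm; have [b [Vb sb ib]] := Hn; have [b' [Vb' sb' ib']] := Hm.
apply/eqP; rewrite eqn_leq -{1}[n]card_ord (is_qdim_indep Ws Hm Vb ib) /=.
by rewrite -{1}[m]card_ord (is_qdim_indep Ws Hn Vb' ib').
Qed.

(** An independent family of maximal length spans: a vector outside its span could be appended to
    it. *)
Lemma is_qdim_bound V W N : Fspace W ->
  (forall n (u : 'I_n -> L), (forall i, V (u i)) -> indep u W -> (n <= N)%N) ->
  exists2 n, (n <= N)%N & is_qdim V W n.
Proof.
move=> Ws bN; pose p n := `[< exists u : 'I_n -> L, (forall i, V (u i)) /\ indep u W >].
have p0 : exists n, p n by exists 0%N; apply/asboolP; exists (fun=> 0); split=> [|c _] [].
have pN n : p n -> (n <= N)%N by move/asboolP => [u [Vu iu]]; apply: bN iu.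
case: (ex_maxnP p0 pN) => n /asboolP[u [Vu iu]] nmax; exists n.
  exact: bN iu.
exists u; split=> // x Vx; apply: contrapT => Hx.
suff /nmax : p n.+1 by rewrite ltnn.
apply/asboolP; exists (fun i => oapp u x (unlift ord_max i)); split=> [i|c].
  by case: unliftP => [j|] _ /=.
pose d i := c (lift ord_max i).
have -> : Fcomb (fun i => oapp u x (unlift ord_max i)) c
   = Fcomb u d + scal (c ord_max) * x.
  rewrite /Fcomb big_ord_recr /= unlift_none /=; congr (_ + _).
  apply: eq_bigr => i _.
  have -> : widen_ord (leqnSn n) i = lift ord_max i.
    by apply: val_inj; rewrite [RHS]lift_max.
  by rewrite liftK.
have [_ WD WZ] := Ws.
have [c0|c0] := eqVneq (c ord_max) 0.
  rewrite c0 rmorph0 mul0r addr0 => /iu H j.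
  by case: (unliftP ord_max j) => [i ->|-> //]; apply: H.
move=> H; case: Hx; exists (fun i => - (c ord_max)^-1 * d i).
have := WZ (c ord_max)^-1 _ H; rewrite mulrDr mulrA -rmorphM mulVf // rmorph1 mul1r.
by rewrite -/(Fcomb u (fun i => _)) (FcombZ u _ d) rmorphN mulNr opprK addrC.
Qed.

Lemma is_qdim_add V U W n m : Fspace W -> Fspace U -> Fspace V ->
  (forall x, W x -> U x) -> (forall x, U x -> V x) ->
  is_qdim U W n -> is_qdim V U m -> is_qdim V W (n + m).
Proof.
move=> Ws Us Vs WU UV [b [Ub sb ib]] [b' [Vb sb' ib']].
rewrite -[n]card_ord -[m]card_ord -card_sum.
pose bb (k : 'I_n + 'I_m) := match k with inl i => b i | inr i => b' i end.
have E c : Fcomb bb c = Fcomb b (fun i => c (inl i)) + Fcomb b' (fun i => c (inr i)).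
  by rewrite /Fcomb big_sumType.
apply: (is_qdim_fin (b := bb)).
- by case=> i; [apply/UV/Ub|apply: Vb].
- move=> x /sb'[c' Hc']; have [c Hc] := sb _ Hc'.
  exists (fun k => match k with inl i => c i | inr i => c' i end).
  by rewrite E [X in _ - X]addrC opprD addrA.
- move=> c; rewrite E => Hc.
  have c'0 i : c (inr i) = 0.
    apply: (ib' (fun i => c (inr i))).
    have := FspaceB Us (WU _ Hc) (Fspace_comb (fun i => c (inl i)) Us Ub).
    by rewrite addrAC subrr add0r.
  have c0 : forall i, c (inl i) = 0.
    apply: ib; move: Hc; rewrite [Fcomb b' _]big1 ?addr0 // => i _.
    by rewrite c'0 rmorph0 mul0r.
  by case.
Qed.

End QDim.

(** * Extension of valuations by Zorn's lemma *)

Section Existence.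

Lemma fraction_eq (R : idomainType) (f : {fraction R}) :
  exists n d : R, d != 0 /\ f = tofrac n / tofrac d.
Proof.
elim/quotW: f => r; exists \n_r, \d_r; split; first exact: denom_ratioP.
apply: (canRL (mulfK _)); first by rewrite tofrac_eq0 denom_ratioP.
rewrite !piE; apply/eqP; rewrite piE FracField.equivfE /FracField.mulf.
by rewrite !numden_Ratio ?mulr1 ?mul1r ?oner_neq0 ?denom_ratioP // mulrC.
Qed.

Variables (F : fieldType) (L : fieldExtType {fraction {poly F}}).
Local Notation scal := (@Defs.cst F L).
Implicit Types (x y : L) (R S : set L).

Definition polyL (a : {poly F}) : L := in_alg L (tofrac a).

HB.instance Definition _ := GRing.RMorphism.copy polyL (in_alg L \o @tofrac {poly F}).

Lemma polyL_eq0 (a : {poly F}) : (polyL a == 0) = (a == 0).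
Proof. by rewrite fmorph_eq0 tofrac_eq0. Qed.

Lemma polyL_inj : injective polyL.
Proof. by move=> a b /fmorph_inj /eqP; rewrite tofrac_eq => /eqP. Qed.

Lemma polyLC c : polyL c%:P = scal c.
Proof. by []. Qed.

Lemma base_frac x : x \in 1%VS -> exists a b : {poly F}, b != 0 /\ x = polyL a / polyL b.
Proof.
case/vlineP => f ->; have [n [d [d0 ->]]] := fraction_eq f.
by exists n, d; split=> //; rewrite -/(in_alg L _) rmorphM fmorphV.
Qed.

Lemma polyL_base a : polyL a \in 1%VS.
Proof. exact: rpredZ (mem1v _). Qed.

Definition subring R := [/\ R 1, forall x y, R x -> R y -> R (x - y)
  & forall x y, R x -> R y -> R (x * y)].

Section Sring.
Variables (R : set L) (Rs : subring R).
Lemma subring1 : R 1. Proof. by have [] := Rs. Qed.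
Lemma subringB x y : R x -> R y -> R (x - y). Proof. by have [_ H _] := Rs; exact: H. Qed.
Lemma subringM x y : R x -> R y -> R (x * y). Proof. by have [_ _ H] := Rs; exact: H. Qed.
Lemma subring0 : R 0. Proof. by rewrite -(subrr 1); apply: subringB; apply: subring1. Qed.
Lemma subringN x : R x -> R (- x).
Proof. by move=> Rx; rewrite -sub0r; apply: subringB => //; apply: subring0. Qed.
Lemma subringD x y : R x -> R y -> R (x + y).
Proof. by move=> Rx Ry; rewrite -[y]opprK; apply: subringB => //; apply: subringN. Qed.
Lemma subring_sum (I : Type) (r : seq I) (p : pred I) (f : I -> L) :
  (forall i, p i -> R (f i)) -> R (\sum_(i <- r | p i) f i).
Proof. by move=> H; elim/big_ind: _ => //; [apply: subring0|apply: subringD]. Qed.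
Lemma subringX x n : R x -> R (x ^+ n).
Proof.
move=> Rx; elim: n => [|n IH]; first by rewrite expr0; apply: subring1.
by rewrite exprS; apply: subringM.
Qed.
End Sring.

Lemma max_subring S t : subring S -> ~ S t^-1 ->
  exists R, [/\ subring R, S `<=` R, ~ R t^-1
    & forall R', subring R' -> R `<=` R' -> ~ R' t^-1 -> R' `<=` R]%classic.
Proof.
move=> Ss St; pose good R := [/\ subring R, (S `<=` R)%classic & ~ R t^-1].
have [|R [Rg Rmax]] := @Zorn_bigcup L (fun R => R = set0%classic \/ good R).
  move=> C CP Ct; have [[R0 [CR0 R0g]]|none] := pselect (exists R, C R /\ good R); last first.
    left; rewrite -subset0 => x [R CR Rx]; have [R0|Rg] := CP _ CR.
      by move: Rx; rewrite R0.
    by case: none; exists R.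
  right; have Cg R x : C R -> R x -> good R.
    by move=> CR Rx; have [R0'|//] := CP _ CR; rewrite R0' in Rx.
  have dir R R' x y : C R -> C R' -> R x -> R' y ->
      exists R'', [/\ C R'', good R'', R'' x & R'' y].
    move=> CR CR' Rx R'y; have [RR'|R'R] := Ct _ _ CR CR'.
      by exists R'; split=> //; [apply: Cg R'y|apply: RR'].
    by exists R; split=> //; [apply: Cg Rx|apply: R'R].
  split.
  - split; first by exists R0 => //; apply: subring1; case: R0g.
    + move=> x y [R CR Rx] [R' CR' R'y].
      by have [R'' [CR'' [s _ _] ? ?]] := dir _ _ _ _ CR CR' Rx R'y; exists R'';
        last exact: subringB.
    + move=> x y [R CR Rx] [R' CR' R'y].
      by have [R'' [CR'' [s _ _] ? ?]] := dir _ _ _ _ CR CR' Rx R'y; exists R'';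
        last exact: subringM.
  - by move=> x Sx; exists R0 => //; case: R0g => _ + _; apply.
  - by move=> [R CR Rt]; case: (Cg _ _ CR Rt).
have [R0|Rgood] := Rg.
  case: (Rmax S); last by right; split.
  rewrite R0; split; first exact: sub0set.
  by move=> /(_ 1 (subring1 Ss)).
exists R; split; [by case: Rgood|by case: Rgood|by case: Rgood|].
move=> R' R's RR' R't; apply: contrapT => R'R; apply: (Rmax R') => //.
by right; split=> //; case: Rgood => _ SR _; apply: subset_trans RR'.
Qed.

Section Maximal.
Variables (R : set L) (t : L) (Rs : subring R) (t0 : t != 0) (Rt : R t) (Rt' : ~ R t^-1).
Hypothesis Rmax :
  forall R', subring R' -> (R `<=` R')%classic -> ~ R' t^-1 -> (R' `<=` R)%classic.

(* Otherwise R[1 / (1 + t r)] would be a larger subring avoiding 1 / t. *)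
Lemma max_unit r : R r -> 1 + t * r != 0 /\ R (1 + t * r)^-1.
Proof.
move=> Rr; set s := 1 + t * r.
have Rs' : R s by apply: (subringD Rs); [apply: subring1|apply: subringM].
have s0 : s != 0.
  apply/eqP => s0; apply: Rt'; have -> : t^-1 = - r; last exact: (subringN Rs).
  by apply: (mulfI t0); rewrite mulfV // mulrN; apply/eqP; rewrite -addr_eq0 -/s s0.
split=> //; pose R' : set L := fun x => exists k : nat, R (s ^+ k * x).
have sk k : exists2 b, R b & s ^+ k = 1 + t * b.
  elim: k => [|k [b Rb IH]]; first by exists 0; rewrite ?mulr0 ?addr0 //; apply: subring0.
  exists (b + r + t * r * b); last by rewrite exprS IH /s; ring.
  by apply: (subringD Rs); [apply: (subringD Rs)|apply: subringM => //; apply: subringM].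
apply: (Rmax (R' := R')).
- split; first by exists 0%N; rewrite expr0 mulr1; apply: subring1.
  + move=> x y [k Hk] [j Hj]; exists (k + j)%N.
    have -> : s ^+ (k + j) * (x - y) = s ^+ j * (s ^+ k * x) - s ^+ k * (s ^+ j * y).
      by rewrite exprD; ring.
    by apply: (subringB Rs); apply: subringM => //; apply: subringX.
  + move=> x y [k Hk] [j Hj]; exists (k + j)%N.
    by rewrite exprD mulrACA; apply: subringM.
- by move=> x Rx; exists 0%N; rewrite mul1r.
- move=> [k]; have [b Rb ->] := sk k; rewrite mulrDl mul1r mulrAC mulfV // mul1r => H.
  by apply: Rt'; rewrite -(addrK b t^-1); apply: (subringB Rs).
- by exists 1%N; rewrite expr1 mulfV //; apply: subring1.
Qed.

(* t^-1 lies in R + R x + ... + R x^(n-1). *)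
Definition inv_expansion x n := exists2 a : nat -> L, (forall i, R (a i)) &
  1 = t * \sum_(i < n) a i * x ^+ i.

(** The ring R[x] is strictly larger than [R], so by maximality it contains t^-1. *)
Lemma inv_expansion_adjoin x : ~ R x -> exists n, inv_expansion x n.
Proof.
move=> Rx; apply: contrapT => H.
pose R' : set L := fun y => exists n, exists2 a : nat -> L, (forall i, R (a i)) &
  y = \sum_(i < n) a i * x ^+ i.
have R'p y : R' y <-> exists2 p : {poly L}, (forall i, R p`_i) & y = p.[x].
  split=> [[n [a Ra ->]]|[p Rp ->]]; last first.
    by exists (size p), (nth 0 p) => //; rewrite horner_coef.
  exists (\poly_(i < n) a i); last by rewrite horner_poly.
  by move=> i; rewrite coef_poly; case: ifP => // _; apply: subring0.
apply: Rx; apply: (Rmax (R' := R')).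
- split.
  + apply/R'p; exists 1; last by rewrite hornerC.
    by move=> i; rewrite coef1; case: eqP => _; [apply: subring1|apply: subring0].
  + move=> y z /R'p[p Rp ->] /R'p[q Rq ->]; apply/R'p; exists (p - q).
      by move=> i; rewrite coefB; apply: subringB.
    by rewrite hornerD hornerN.
  + move=> y z /R'p[p Rp ->] /R'p[q Rq ->]; apply/R'p; exists (p * q).
      by move=> i; rewrite coefM; apply: subring_sum => // j _; apply: subringM.
    by rewrite hornerM.
- move=> y Ry; apply/R'p; exists y%:P; last by rewrite hornerC.
  by move=> i; rewrite coefC; case: eqP => _ //; apply: subring0.
- move=> [n [a Ra E]]; apply: H; exists n, a => //.
  by rewrite -E mulfV.
- apply/R'p; exists 'X; last by rewrite hornerX.
  by move=> i; rewrite coefX; case: eqP => _; [apply: subring1|apply: subring0].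
Qed.

(** Moving the constant term of the expansion in x^-1 to the left leaves the factor 1 - t b_0,
    invertible in [R] by [max_unit]. Multiplied by x^n it rewrites x^n through lower powers of x,
    which eliminates the top term of the expansion in x. *)
Lemma inv_expansion_reduce x n m : x != 0 -> (m <= n)%N ->
  inv_expansion x n.+1 -> inv_expansion x^-1 m.+1 -> inv_expansion x n.
Proof.
move=> x0 mn [a Ra Ea] [b Rb Eb].
have [] := @max_unit (- b 0%N); first exact: (subringN Rs).
rewrite mulrN; set u := 1 - _ => u0 Ru.
have xn : x ^+ n * u = t * \sum_(j < m) b j.+1 * x ^+ (n - j.+1).
  have -> : u = t * \sum_(j < m) b j.+1 * x^-1 ^+ j.+1.
    by rewrite /u {1}Eb big_ord_recl expr0 mulr1 mulrDr addrAC subrr add0r.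
  rewrite mulrCA; congr (_ * _); rewrite mulr_sumr; apply: eq_bigr => j _.
  have jn : (j < n)%N by apply: leq_trans mn.
  rewrite mulrCA; congr (_ * _); apply: (mulIf (expf_neq0 j.+1 x0)).
  by rewrite -mulrA -exprMn mulVf // expr1n mulr1 -exprD subnK.
(* In the rewritten x^n the coefficient b_(j+1) goes with x^(n-j-1); for i = n - j - 1 it is
   b_(n-i), present exactly when j = n - i - 1 < m. *)
pose c i := a i + (if (n - i.+1 < m)%N then t * a n * (b (n - i)%N * u^-1) else 0).
exists c.
  move=> i; apply: (subringD Rs) => //; case: ifP => _; last exact: subring0.
  by apply: subringM => //; apply: subringM.
rewrite {1}Ea big_ord_recr /=; congr (_ * _).
under [RHS]eq_bigr do rewrite mulrDl; rewrite big_split /=; congr (_ + _).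
have -> : x ^+ n = t * (\sum_(j < m) b j.+1 * x ^+ (n - j.+1)) / u by rewrite -xn mulfK.
under [RHS]eq_bigr => i _ do rewrite (fun_if (fun z => z * x ^+ i)) mul0r.
rewrite -big_mkcond /= [RHS](reindex_inj rev_ord_inj) /=.
rewrite [RHS](eq_bigl (fun i : 'I_n => (i < m)%N)); last first.
  by move=> i /=; have := ltn_ord i => ?; congr (_ < _)%N; lia.
rewrite [RHS](eq_bigr (fun i : 'I_n => t * a n / u * (b i.+1 * x ^+ (n - i.+1)))); last first.
  move=> i _; have -> : (n - (n - i.+1) = i.+1)%N by have := ltn_ord i; lia.
  by field.
rewrite -mulr_sumr -(big_ord_widen _ (fun i => b i.+1 * x ^+ (n - i.+1))) //.
by field.
Qed.

(** Chevalley's argument: if both x and x^-1 are outside [R], both admit expansions of t^-1, and the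
    longer one can be shortened by means of the other until one of them is empty and reads 1 = 0. *)
Lemma max_valuation x : x != 0 -> R x \/ R x^-1.
Proof.
move=> x0; apply: contrapT => H.
have {}H : ~ R x /\ ~ R x^-1 by split=> ?; apply: H; [left|right].
have [Rx Rx'] := H.
have [n Hn] := inv_expansion_adjoin Rx; have [m Hm] := inv_expansion_adjoin Rx'.
have inv_expansion0 y : ~ inv_expansion y 0.
  by move=> [a _]; rewrite big_ord0 mulr0 => /eqP; rewrite oner_eq0.
have : forall N k j y, y != 0 -> (k + j <= N)%N -> inv_expansion y k ->
  inv_expansion y^-1 j -> False.
  elim=> [|N IH] k j y y0.
    by rewrite leqn0 addn_eq0 => /andP[/eqP -> _] /inv_expansion0.
  case: k => [_ /inv_expansion0 //|k]; case: j => [_ _ /inv_expansion0 //|j] kjN Hk Hj.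
  have [jk|kj] := leqP j k.
    by apply: (IH k j.+1 y) => //; apply: inv_expansion_reduce Hj.
  apply: (IH k.+1 j y) => //; first by lia.
  by apply: (@inv_expansion_reduce y^-1 j k) => //; rewrite ?invr_eq0 ?invrK //; lia.
by move=> /(_ _ n m x x0 (leqnn _) Hn Hm).
Qed.

End Maximal.
End Existence.

(** * Discrete valuations from valuation rings *)

Section ValuationRing.
Variables (F : fieldType) (L : fieldExtType {fraction {poly F}}).
Local Notation scal := (@Defs.cst F L).
Implicit Types (x y u : L).

Section FromRing.
Variables (R : set L) (Rs : subring R) (Rv : forall x, x != 0 -> R x \/ R x^-1).

Definition ring_unit u := [/\ u != 0, R u & R u^-1].

Lemma ring_unitM x y : ring_unit x -> ring_unit y -> ring_unit (x * y).
Proof.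
move=> [x0 Rx Rx'] [y0 Ry Ry']; split; first by rewrite mulf_neq0.
  exact: subringM.
by rewrite invfM; apply: subringM.
Qed.

Lemma ring_unitV x : ring_unit x -> ring_unit x^-1.
Proof. by move=> [x0 Rx Rx']; split; rewrite ?invr_eq0 ?invrK. Qed.

Lemma ring_unit1 : ring_unit 1.
Proof. by split; rewrite ?oner_eq0 ?invr1 //; apply: subring1. Qed.

Lemma ring_unitX x n : ring_unit x -> ring_unit (x ^+ n).
Proof.
move=> Ux; elim: n => [|n IH]; first by rewrite expr0; apply: ring_unit1.
by rewrite exprS; apply: ring_unitM.
Qed.

Definition nonunit x := x = 0 \/ ~ R x^-1.

Lemma nonunitD x y : nonunit x -> nonunit y -> nonunit (x + y).
Proof.
have [->|x0] := eqVneq x 0; first by rewrite add0r.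
have [->|y0] := eqVneq y 0; first by rewrite addr0.
have [->|xy0] := eqVneq (x + y) 0; first by left.
move=> [/eqP|Rx]; first by rewrite (negbTE x0).
move=> [/eqP|Ry]; first by rewrite (negbTE y0).
right=> Rxy; have key a b : a != 0 -> b != 0 -> a + b != 0 -> R (a + b)^-1 ->
    R (a / b) -> R b^-1.
  move=> a0 b0 ab0 Rab Rq.
  have -> : b^-1 = (a + b)^-1 * (a / b + 1) by field; rewrite ab0 b0.
  by apply: (subringM Rs) => //; apply: (subringD Rs) => //; apply: subring1.
have q0 : x / y != 0 by rewrite mulf_neq0 ?invr_eq0.
case: (Rv q0) => [|Rq]; first by move/(key _ _ x0 y0 xy0 Rxy).
by apply: Rx; apply: (key y x) => //; rewrite 1?addrC //; rewrite invf_div in Rq.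
Qed.

Lemma nonunit_sum (I : Type) (r : seq I) (p : pred I) (f : I -> L) :
  (forall i, p i -> nonunit (f i)) -> nonunit (\sum_(i <- r | p i) f i).
Proof. by move=> H; elim/big_ind: _ => //; [left|apply: nonunitD]. Qed.

Lemma ring_unit_not_nonunit x : R x -> ~ nonunit x -> ring_unit x.
Proof.
move=> Rx nx; split=> //; first by apply/eqP => x0; apply: nx; left.
by apply: contrapT => H; apply: nx; right.
Qed.

Lemma dominating n (f : 'I_n -> L) (s : seq 'I_n) : has (fun j => f j != 0) s ->
  exists i, [/\ i \in s, f i != 0 & forall j, j \in s -> R (f j / f i)].
Proof.
elim: s => //= k s IH; have [fk0|fk0] := eqVneq (f k) 0.
  move=> /= /IH[i [si fi0 H]]; exists i; split=> //; first by rewrite inE si orbT.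
  by move=> j; rewrite inE => /orP[/eqP ->|/H //]; rewrite fk0 mul0r; apply: subring0.
move=> _; have [/IH[i [si fi0 H]]|/hasPn N] := boolP (has (fun j => f j != 0) s); last first.
  exists k; split; rewrite ?mem_head // => j; rewrite inE => /orP[/eqP ->|/N].
    by rewrite mulfV //; apply: subring1.
  by rewrite negbK => /eqP ->; rewrite mul0r; apply: subring0.
have q0 : f k / f i != 0 by rewrite mulf_neq0 ?invr_eq0.
case: (Rv q0) => Rq.
  exists i; split=> //; first by rewrite inE si orbT.
  by move=> j; rewrite inE => /orP[/eqP ->|/H //].
exists k; split; rewrite ?mem_head // => j; rewrite inE => /orP[/eqP ->|/H Rj].
  by rewrite mulfV //; apply: subring1.
have -> : f j / f k = (f j / f i) * (f k / f i)^-1 by field; rewrite fk0 fi0.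
exact: subringM.
Qed.

(** Two terms must share the least value; otherwise, dividing by the one dominating term, -1 would
    be a sum of nonunits and hence a nonunit. *)
Lemma sum0_ratio n (f : 'I_n -> L) k : f k != 0 -> \sum_j f j = 0 ->
  exists i j : 'I_n, (i < j)%N /\ [/\ f i != 0, f j != 0 & ring_unit (f j / f i)].
Proof.
move=> fk0 S0; have [|i [_ fi0 H]] := @dominating n f (enum 'I_n).
  by apply/hasP; exists k; rewrite ?mem_enum.
suff [j [ji U]] : exists j, j != i /\ ring_unit (f j / f i).
  have fj0 : f j != 0 by apply: contraTneq isT => fj0; case: U; rewrite fj0 mul0r eqxx.
  have := ji; rewrite neq_ltn => /orP[?|?]; first exists j, i; last by exists i, j.
  by split=> //; split=> //; rewrite -invf_div; apply: ring_unitV.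
apply: contrapT => N; have : nonunit (- 1).
  have -> : - 1 = \sum_(j | j != i) f j / f i.
    move: S0; rewrite (bigD1 i) //= => /eqP; rewrite addr_eq0 => /eqP E.
    by rewrite -mulr_suml -[\sum_(_ | _) _]opprK -E mulNr mulfV.
  apply: nonunit_sum => j ji; apply: contrapT => U; apply: N; exists j; split=> //.
  by apply: ring_unit_not_nonunit => //; apply: H; rewrite mem_enum.
case=> [/eqP|]; first by rewrite oppr_eq0 oner_eq0.
by apply; rewrite invrN invr1; apply: (subringN Rs); apply: subring1.
Qed.

(** Two monomials of the minimal polynomial of x over F(X) have the same value at x; their quotient
    is the required product, and the exponent is bounded by the degree of x. *)
Lemma power_ratio x : x != 0 -> exists i, [/\ (0 < i <= \dim {:L})%N
  & exists2 a, a \in 1%VS & a != 0 /\ ring_unit (x ^+ i * a)].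
Proof.
move=> x0; set p := minPoly 1%AS x; set n := size p.
have pn : p`_n.-1 = 1 by have /monicP := monic_minPoly 1%AS x.
have n0 : (0 < n)%N by rewrite /n size_minPoly.
pose f (j : 'I_n) := p`_j * x ^+ j.
have fS : \sum_j f j = 0.
  by rewrite -horner_coef; apply/eqP; have := root_minPoly 1%AS x.
have nn : (n.-1 < n)%N by lia.
have fk : f (Ordinal nn) != 0 by rewrite /f /= pn mul1r expf_neq0.
have [i [j [ij [fi fj U]]]] := sum0_ratio fk fS.
have pi0 : p`_i != 0 by move: fi; rewrite /f; apply: contra_neq => ->; rewrite mul0r.
have pj0 : p`_j != 0 by move: fj; rewrite /f; apply: contra_neq => ->; rewrite mul0r.
have pB : p \is a polyOver 1%AS by apply: minPolyOver.
exists (j - i)%N; split.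
  rewrite subn_gt0 ij /=; have : (adjoin_degree 1%AS x <= \dim {:L})%N.
    by have := dimvS (subvf <<1%AS; x>>); rewrite dim_Fadjoin dimv1 muln1.
  have : n = (adjoin_degree 1%AS x).+1 by rewrite /n size_minPoly.
  by have := ltn_ord j; lia.
exists (p`_j / p`_i).
  by apply: rpred_div; [have /polyOverP := pB|have /polyOverP := pB].
split; first by rewrite mulf_neq0 ?invr_eq0.
suff -> : x ^+ (j - i) * (p`_j / p`_i) = f j / f i by [].
have xj : x ^+ j = x ^+ i * x ^+ (j - i) by rewrite -exprD subnKC // ltnW.
by rewrite /f xj; field; rewrite pi0 expf_neq0.
Qed.

Variables (pi : L) (pi0 : pi != 0) (Rpi : ~ R pi^-1).
Hypothesis Rk : forall a, a \in 1%VS -> a != 0 -> exists k : int, ring_unit (a * pi ^ k).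
Hypothesis Rc : forall c : F, R (scal c).

Lemma R_pi : R pi.
Proof. by case: (Rv pi0). Qed.

Lemma R_piX (n : nat) : ~ R (pi ^+ n.+1)^-1.
Proof.
move=> H; apply: Rpi; have -> : pi^-1 = pi ^+ n * (pi ^+ n.+1)^-1.
  by rewrite exprS; field; rewrite pi0 expf_neq0.
by apply: (subringM Rs) => //; apply: (subringX Rs); apply: R_pi.
Qed.

Lemma R_piz (k : int) : R (pi ^ k) -> 0 <= k.
Proof. by case: k => // n; rewrite NegzE -exprnN => /R_piX. Qed.

Lemma ring_unit_pi (k : int) : ring_unit (pi ^ k) -> k = 0.
Proof.
move=> [_ /R_piz k0]; rewrite invr_expz => /R_piz; lia.
Qed.

(* w x is the valuation of x^(n!) relative to pi; the factor n! makes it an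
   integer, since some x^i with i <= n is a base element up to a unit. *)
Lemma power_pi : {w : L -> int | forall x, x != 0 ->
  ring_unit (x ^+ (\dim {:L})`! * pi ^ (- w x))}.
Proof.
suff /choice[w Hw] : forall x, exists k : int,
  x != 0 -> ring_unit (x ^+ (\dim {:L})`! * pi ^ (- k)) by exists w.
move=> x; have [->|x0] := eqVneq x 0; first by exists 0 => /eqP.
have [i [/andP[i0 iN] [a aB [a0 U]]]] := power_ratio x0.
have [k Uk] := Rk aB a0.
have /dvdnP[m ->] : (i %| (\dim {:L})`!)%N by apply: dvdn_fact; rewrite i0 iN.
exists (k * m%:Z) => _.
have -> : x ^+ (m * i) * pi ^ (- (k * m%:Z)) = (x ^+ i * a * (a * pi ^ k)^-1) ^+ m.
  rewrite -mulNr -exprz_exp -exprnP mulnC exprM -exprMn; congr (_ ^+ m).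
  by rewrite -invr_expz; field; rewrite a0 expfz_neq0.
by apply/ring_unitX/ring_unitM => //; apply: ring_unitV.
Qed.

(** The integer-valued function [w] of [power_pi] is already a valuation nonnegative on [R]; it only
    has to be rescaled so that it takes the value 1. *)
Lemma place_of_ring : exists P : place L,
  0 < pord P pi /\ forall x, R x -> val_ge P 0 x.
Proof.
have [w] := power_pi; have := fact_gt0 (\dim {:L}).
move: (_`!) => N N0 Hw.
have wE x k : x != 0 -> ring_unit (x ^+ N * pi ^ k) -> w x = - k.
  move=> x0 U; have := ring_unitM U (ring_unitV (Hw x x0)).
  have -> : x ^+ N * pi ^ k * (x ^+ N * pi ^ (- w x))^-1 = pi ^ (k + w x).
    rewrite expfzDr // -invr_expz; field.
    by rewrite expfz_neq0 // expf_neq0.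
  by move/ring_unit_pi; lia.
have wM x y : x != 0 -> y != 0 -> w (x * y) = w x + w y.
  move=> x0 y0; rewrite -[RHS]opprK; apply: wE; first by rewrite mulf_neq0.
  have -> : (x * y) ^+ N * pi ^ (- (w x + w y)) =
      (x ^+ N * pi ^ (- w x)) * (y ^+ N * pi ^ (- w y)).
    by rewrite opprD expfzDr // exprMn; ring.
  by apply: ring_unitM; apply: Hw.
have wR x : x != 0 -> R x -> 0 <= w x.
  move=> x0 Rx; apply: R_piz; have [h0 h1 h2] := Hw x x0.
  have -> : pi ^ w x = x ^+ N * (x ^+ N * pi ^ (- w x))^-1.
    by rewrite -invr_expz; field; rewrite expfz_neq0 // expf_neq0.
  by apply: (subringM Rs) => //; apply: subringX.
have w1 : w 1 = 0 by have := wM 1 1 (oner_neq0 _) (oner_neq0 _); rewrite mulr1; lia.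
have wV x : x != 0 -> w x^-1 = - w x.
  by move=> x0; have := wM x x^-1 x0 (invr_neq0 x0); rewrite mulfV // w1; lia.
have wpi : w pi = N%:Z.
  rewrite -[RHS]opprK; apply: wE => //; rewrite exprnP -expfzDr // subrr.
  exact: ring_unit1.
have wD x y : x != 0 -> y != 0 -> x + y != 0 -> Order.min (w x) (w y) <= w (x + y).
  have key a b : a != 0 -> b != 0 -> a + b != 0 -> R (b / a) -> w a <= w (a + b).
    move=> a0 b0 ab0 Rq; have q0 : 1 + b / a != 0.
      by apply: contraNneq ab0 => H; rewrite -(mulr0 a) -H mulrDr mulr1 mulrCA mulfV // mulr1.
    have -> : a + b = a * (1 + b / a) by field.
    rewrite wM // lerDl; apply: wR => //.
    by apply: (subringD Rs) => //; apply: subring1.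
  move=> x0 y0 xy0; rewrite ge_min; apply/orP.
  have q0 : y / x != 0 by rewrite mulf_neq0 ?invr_eq0.
  case: (Rv q0) => Rq; [left|right]; first exact: key.
  by rewrite addrC in xy0 *; apply: key => //; rewrite invf_div in Rq.
have wX x n : x != 0 -> w (x ^+ n) = w x * n%:Z.
  move=> x0; elim: n => [|n IH]; first by rewrite expr0 w1 mulr0.
  by rewrite exprS wM ?expf_neq0 // IH; lia.
(* The values of [w] form a nonzero subgroup of the integers, as w(pi) = N > 0. Its generator is the
   least positive value, written e + 1 here. *)
pose p n := `[< exists2 x, x != 0 & w x = n.+1%:Z >].
have [|e /asboolP[y y0 we] emin] := @ex_minnP p.
  by exists N.-1; apply/asboolP; exists pi => //; rewrite wpi; lia.
have dvde x : x != 0 -> exists k : int, w x = k * e.+1%:Z.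
  move=> x0; exists (w x %/ e.+1%:Z)%Z.
  set q := (w x %/ e.+1%:Z)%Z; have Eq := divz_eq (w x) e.+1%:Z.
  have r0 := modz_ge0 (w x) (isT : e.+1%:Z != 0).
  have r1 := ltz_pmod (w x) (isT : 0 < e.+1%:Z).
  rewrite -/q in Eq; move: (w x %% e.+1%:Z)%Z r0 r1 Eq => r r0 r1 Eq.
  rewrite Eq; suff -> : r = 0 by rewrite addr0.
  apply/eqP; apply: contraT => rn0.
  have : p `|r|.-1%N.
    apply/asboolP; exists (x * y ^ (- q)); first by rewrite mulf_neq0 ?expfz_neq0.
    rewrite wM ?expfz_neq0 //; have -> : w (y ^ (- q)) = - q * e.+1%:Z.
      case: (- q) => n; first by rewrite -exprnP wX // we mulrC.
      by rewrite NegzE -exprnN wV ?expf_neq0 // wX // we; lia.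
    by rewrite Eq; lia.
  by move/emin; lia.
pose v x : \bar int := if x == 0 then +oo%E else (w x %/ e.+1%:Z)%Z%:E.
have vE x k : x != 0 -> w x = k * e.+1%:Z -> v x = k%:E.
  by move=> x0 wx; rewrite /v (negbTE x0) wx mulzK.
have v1 x : v x = +oo%E <-> x = 0.
  by rewrite /v; case: eqP => // x0; split.
have v2 x y' : v (x * y') = (v x + v y')%E.
  have [->|x0] := eqVneq x 0; first by rewrite mul0r /v eqxx; case: ifP.
  have [->|y'0] := eqVneq y' 0; first by rewrite mulr0 /v eqxx (negbTE x0).
  have [k Hk] := dvde x x0; have [j Hj] := dvde y' y'0.
  rewrite (vE x k) // (vE y' j) // (vE _ (k + j)) ?mulf_neq0 // wM // Hk Hj; lia.
have v3 x y' : (Order.min (v x) (v y') <= v (x + y')%R)%E.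
  have [->|x0] := eqVneq x 0; first by rewrite add0r ge_min lexx orbT.
  have [->|y'0] := eqVneq y' 0; first by rewrite addr0 ge_min lexx.
  have [->|xy0] := eqVneq (x + y') 0; first by rewrite [v 0]/v eqxx leey.
  have [k Hk] := dvde x x0; have [j Hj] := dvde y' y'0; have [i Hi] := dvde _ xy0.
  have := wD x y' x0 y'0 xy0.
  rewrite (vE x k) // (vE y' j) // (vE _ i) // Hk Hj Hi !ge_min !lee_fin.
  by rewrite !ler_pM2r.
have v4 : exists t, v t = 1%:E by exists y; apply: vE; rewrite // we mul1r.
have v5 (c : F) : c != 0 -> v (scal c) = 0%E.
  move=> c0; have sc0 : scal c != 0 by rewrite fmorph_eq0.
  apply: vE => //; rewrite mul0r; have := wR _ sc0 (Rc c).
  have E : scal c^-1 = (scal c)^-1 by rewrite fmorphV.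
  have := wR (scal c)^-1; rewrite invr_eq0 -E => /(_ sc0 (Rc _)).
  by rewrite E wV //; lia.
exists (Place v1 v2 v3 v4 v5); split.
  have [k Hk] := dvde pi pi0; rewrite /pord /= (vE pi k) //= .
  by move: Hk; rewrite wpi; nia.
move=> x Rx; rewrite /val_ge /=; have [->|x0] := eqVneq x 0; first by rewrite /v eqxx leey.
have [k Hk] := dvde x x0; rewrite (vE x k) // lee_fin.
by have := wR x x0 Rx; rewrite Hk; nia.
Qed.

End FromRing.
End ValuationRing.

(** * Places and the subfield F(X) *)

Section BasePlaces.
Variables (F : fieldType) (L : fieldExtType {fraction {poly F}}).
Local Notation scal := (@Defs.cst F L).
Local Notation polyL := (@polyL F L).
Implicit Types (P Q : place L) (x y u : L).

Definition fin_place P := 0 <= pord P (polyL 'X).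
(* The multiplicity at P of the pole divisor of X. *)
Definition inf_mult P : int := Num.max 0 (- pord P (polyL 'X)).

Lemma polyLX0 : polyL 'X != 0. Proof. by rewrite polyL_eq0 polyX_eq0. Qed.

Lemma fin_polyL P (a : {poly F}) : fin_place P -> val_ge P 0 (polyL a).
Proof.
move=> fP; elim/poly_ind: a => [|a c IH]; first by rewrite rmorph0 val_ge0.
rewrite rmorphD rmorphM /= polyLC val_geD ?val_ge_cst // -(addr0 0) val_geM //.
by rewrite val_geE ?polyLX0.
Qed.

Lemma inf_polyL P (a : {poly F}) : ~~ fin_place P -> a != 0 ->
  pord P (polyL a) = (size a).-1%:Z * pord P (polyL 'X).
Proof.
rewrite /fin_place -ltNge => iP; elim/poly_ind: a => [|a c IH]; first by rewrite eqxx.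
rewrite size_MXaddC => ac0; have [a0|a0] := eqVneq a 0.
  rewrite a0 mul0r add0r in ac0 *; rewrite polyLC; move: ac0; rewrite polyC_eq0 => c0.
  by rewrite pord_cst // (negbTE c0) /= size_poly0 mul0r.
rewrite /= rmorphD rmorphM /=.
have aX0 : polyL a * polyL 'X != 0 by rewrite mulf_neq0 ?polyLX0 ?polyL_eq0.
have sa : (0 < size a)%N by rewrite size_poly_gt0.
have E : pord P (polyL a * polyL 'X) = (size a)%:Z * pord P (polyL 'X).
  rewrite pordM ?polyL_eq0 ?polyX_eq0 // IH //.
  nia.
have [||_ ->] // := @pord_dom _ _ P (polyL a * polyL 'X) (polyL c%:P) => //.
by apply: val_ge_le (val_ge_cst P c); rewrite E; nia.
Qed.

Lemma integral_val_ge P x n (c : 'I_n -> L) : (forall i, val_ge P 0 (c i)) ->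
  x ^+ n = \sum_(i < n) c i * x ^+ i -> val_ge P 0 x.
Proof.
move=> Hc E; have [->|x0] := eqVneq x 0; first exact: val_ge0.
rewrite val_geE // leNgt; apply/negP => vx.
have : val_ge P (n%:Z * pord P x + 1) (x ^+ n).
  rewrite E; apply: val_ge_sum => i _; apply: (@val_ge_le _ _ _ (0 + i%:Z * pord P x)).
    by have := ltn_ord i; nia.
  by apply: val_geM => //; rewrite -pordX // val_ge_pord.
by rewrite val_geE ?expf_neq0 // pordX //; lia.
Qed.

Lemma minPoly_expand x (p := minPoly 1%AS x) :
  x ^+ (size p).-1 = \sum_(i < (size p).-1) - p`_i * x ^+ i.
Proof.
have pm : p \is monic by apply: monic_minPoly.
have pr : root p x by apply: root_minPoly.
move: pr; rewrite /root horner_coef; have : (0 < size p)%N by rewrite size_poly_gt0;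
  exact: monic_neq0.
move: (monicP pm); rewrite /lead_coef; case: (size p) => // n /= pn _.
rewrite big_ord_recr /= pn mul1r addrC addr_eq0 => /eqP ->.
by rewrite -sumrN; apply: eq_bigr => i _; rewrite mulNr.
Qed.

Lemma minPoly_relation x : exists n (c : 'I_n -> L),
  (forall i, c i \in 1%VS) /\ x ^+ n = \sum_(i < n) c i * x ^+ i.
Proof.
exists (size (minPoly 1%AS x)).-1, (fun i => - (minPoly 1%AS x)`_i).
split=> [i|]; last exact: minPoly_expand.
by rewrite rpredN; have /polyOverP := minPolyOver 1%AS x; apply.
Qed.

Lemma integral_base P x : (forall a, a \in 1%VS -> val_ge P 0 a) -> val_ge P 0 x.
Proof.
by move=> H; have [n [c [cB E]]] := minPoly_relation x; apply: integral_val_ge E => i;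
  exact/H/cB.
Qed.

(** A valuation trivial on F(X) would be nonnegative on all of [L], which is algebraic over F(X);
    the inverse of a uniformizer contradicts this. *)
Lemma nontrivial_base P : exists a, [/\ a \in 1%VS, a != 0 & pord P a != 0].
Proof.
apply: contrapT => H; have [t t0 tP] := uniformizer P.
have : val_ge P 0 t^-1.
  apply: integral_base => a aB; have [->|a0] := eqVneq a 0; first exact: val_ge0.
  rewrite val_geE //; suff -> : pord P a = 0 by [].
  by apply/eqP; apply: contrapT => ?; apply: H; exists a; split=> //; apply/negP.
by rewrite val_geE ?invr_eq0 // pordV // tP.
Qed.

Lemma nontrivial_poly P : exists2 a : {poly F}, a != 0 & pord P (polyL a) != 0.
Proof.
have [x [xB x0 Px]] := nontrivial_base P; have [a [b [b0 xE]]] := base_frac xB.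
have a0 : a != 0 by apply: contraNneq x0 => a0; rewrite xE a0 rmorph0 mul0r.
apply: contrapT => H; case/eqP: Px.
have V c : c != 0 -> pord P (polyL c) = 0.
  by move=> c0; apply/eqP; apply: contrapT => ?; apply: H; exists c => //; apply/negP.
by rewrite xE pordM ?invr_eq0 ?polyL_eq0 // pordV ?polyL_eq0 // !V.
Qed.

Lemma dvdp_quot (p a : {poly F}) : p %| a -> exists b : {poly F}, a = b * p.
Proof. by move/dvdpP. Qed.

Lemma size_lt_mul (p b : {poly F}) : b != 0 -> (1 < size p)%N -> (size b < size (b * p)%R)%N.
Proof.
move=> b0 sp; have p0 : p != 0 by rewrite -size_poly_gt0 ltnW.
rewrite size_mul //; move: b0; rewrite -size_poly_gt0.
by move: (size b) (size p) sp => i j; lia.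
Qed.

(* p generates the prime ideal of F[X] below P. *)
Definition base_prime P (p : {poly F}) := [/\ p != 0, 0 < pord P (polyL p),
  forall a : {poly F}, a != 0 -> 0 < pord P (polyL a) -> p %| a
  & forall a : {poly F}, ~~ (p %| a) -> exists s t : {poly F}, s * a + t * p = 1].

(** The generator is a polynomial of least degree among those vanishing at P; division with
    remainder does the rest. *)
Lemma base_prime_exists P : fin_place P -> exists p : {poly F}, base_prime P p.
Proof.
move=> fP.
pose g n := `[< exists2 a : {poly F}, a != 0 & 0 < pord P (polyL a) /\ size a = n >].
have [|n /asboolP[p p0 [Pp sp]] nmin] := @ex_minnP g.
  have [a a0 Pa] := nontrivial_poly P; exists (size a); apply/asboolP; exists a => //.
  by split=> //; have := fin_polyL a fP; rewrite val_geE ?polyL_eq0 //; lia.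
have pmn (a : {poly F}) : a != 0 -> 0 < pord P (polyL a) -> (size p <= size a)%N.
  by move=> a0 Pa; rewrite sp; apply: nmin; apply/asboolP; exists a.
have pd (a : {poly F}) : a != 0 -> 0 < pord P (polyL a) -> p %| a.
  move=> a0 Pa; rewrite /dvdp; apply: contraT => r0.
  have := pmn (a %% p) r0; rewrite leqNgt ltn_modp p0 => H.
  have : val_ge P 1 (polyL (a %% p)).
    have -> : a %% p = a - a %/ p * p by rewrite {2}(divp_eq a p) addrAC subrr add0r.
    rewrite rmorphB rmorphM /=; apply: val_geB; first by rewrite val_geE ?polyL_eq0 //; lia.
    rewrite -(add0r 1); apply: val_geM; first exact: fin_polyL.
    by rewrite val_geE ?polyL_eq0 //; lia.
  by rewrite val_geE ?polyL_eq0 // => h; have := H; apply; lia.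
exists p; split=> // a pa.
(* Write p = k h with h the gcd. If h vanishes at P, then p divides h and so a. Otherwise k vanishes
   at P, has the size of p by minimality, and h is constant. *)
have /Bezout_eq1_coprimepP[[s t] /= E] : coprimep a p; last by exists s, t.
rewrite /coprimep; set h := gcdp a p.
have hp : h %| p by apply: dvdp_gcdr.
have h0 : h != 0 by rewrite gcdp_eq0 negb_and p0 orbT.
have /dvdp_quot[k pk] := hp; have k0 : k != 0 by apply: contraNneq p0 => k0;
  rewrite pk k0 mul0r.
have : pord P (polyL p) = pord P (polyL k) + pord P (polyL h) by rewrite pk rmorphM pordM
  ?polyL_eq0.
have hv := fin_polyL h fP; have kv := fin_polyL k fP;
  rewrite !val_geE ?polyL_eq0 // in hv kv => vp.
have [vh|vh] := ltrP 0 (pord P (polyL h)).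
  by case/negP: pa; apply: dvdp_trans (pd h h0 vh) (dvdp_gcdl _ _).
have sh : (0 < size h)%N by rewrite size_poly_gt0.
have sk : (0 < size k)%N by rewrite size_poly_gt0.
have sE : (size p = (size k + size h).-1)%N by rewrite pk size_mul.
have : (size p <= size k)%N by apply: pmn => //; lia.
by move=> ?; apply/eqP; lia.
Qed.

(** The relation s a + t p = 1 makes a and p without common zero at any finite place. Allowing Q to
    differ from P is what later compares two places above the same p. *)
Lemma base_prime_pord0 P Q (p a : {poly F}) : base_prime P p -> fin_place Q ->
  0 < pord Q (polyL p) -> ~~ (p %| a) ->
  pord Q (polyL a) = 0.
Proof.
move=> [p0 Pp _ H] fQ Qp pa; have [s [t E]] := H a pa.
have a0 : a != 0 by apply: contraNneq pa => ->; apply: dvdp0.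
have := fin_polyL a fQ; rewrite val_geE ?polyL_eq0 // => a1.
apply/eqP; rewrite eq_le a1 andbT leNgt; apply/negP => a2.
have : val_ge Q 1 (polyL 1).
  rewrite -E rmorphD !rmorphM /=; apply: val_geD; rewrite -(add0r 1); apply: val_geM.
  - exact: fin_polyL.
  - by rewrite val_geE ?polyL_eq0 //; lia.
  - exact: fin_polyL.
  - by rewrite val_geE ?polyL_eq0 //; lia.
by rewrite rmorph1 val_geE ?oner_eq0 // pord1.
Qed.

Lemma base_prime_factor P (p a : {poly F}) : base_prime P p -> a != 0 ->
  exists (k : nat) (b : {poly F}), [/\ a = p ^+ k * b, b != 0 & ~~ (p %| b)].
Proof.
move=> [p0 Pp _ H]; have sp : (1 < size p)%N.
  have : (0 < size p)%N by rewrite size_poly_gt0.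
  case: (ltngtP (size p) 1) => // /eqP/size_poly1P[c c0 E] _.
  by move: Pp; rewrite E polyLC pord_cst.
have [n] := ubnP (size a); elim: n a => // n IH a an a0.
have [/dvdp_quot[b ab]|pa] := boolP (p %| a); last first.
  by exists 0%N, a; rewrite mul1r.
have b0 : b != 0 by apply: contraNneq a0 => b0; rewrite ab b0 mul0r.
have [|//|k [c [bE c0 pc]]] := IH b.
  by move: an; rewrite ab ltnS; apply: leq_trans; apply: size_lt_mul.
by exists k.+1, c; split=> //; rewrite ab bE exprS; ring.
Qed.

(** Take a maximal subring containing F[X] and avoiding 1 / d. A polynomial p of least degree that
    is not invertible in it plays the role of [pi] in [place_of_ring]: every nonzero polynomial is a
    power of p times a unit, by division with remainder. *)
Lemma exists_fin_place (d : {poly F}) : (1 < size d)%N ->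
  exists P, fin_place P /\ 0 < pord P (polyL d).
Proof.
move=> sd; have d0 : d != 0 by rewrite -size_poly_gt0; lia.
pose S : set L := fun x => exists a, x = polyL a.
have Ss : subring S.
  split; first by exists 1; rewrite rmorph1.
    by move=> _ _ [a ->] [b ->]; exists (a - b); rewrite rmorphB.
  by move=> _ _ [a ->] [b ->]; exists (a * b); rewrite rmorphM.
have Sd : ~ S (polyL d)^-1.
  move=> [a Ea]; have : polyL (a * d) = polyL 1 by rewrite rmorphM /= -Ea mulVf
    ?polyL_eq0 // rmorph1.
  move/polyL_inj => ad; have sad : (size (a * d)%R = 1)%N by rewrite ad size_poly1.
  have a0 : a != 0 by apply: contraTneq isT => a0; move/eqP: ad;
    rewrite a0 mul0r eq_sym oner_eq0.
  have := size_lt_mul a0 sd; rewrite sad ltnS leqn0 size_poly_eq0.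
  by rewrite (negbTE a0).
have [R [Rs SR Rd Rmax]] := max_subring Ss Sd.
have RA a : R (polyL a) by apply: SR; exists a.
have Rv : forall x, x != 0 -> R x \/ R x^-1.
  by apply: (max_valuation Rs _ (RA d) Rd Rmax); rewrite polyL_eq0.
pose g n := `[< exists2 a : {poly F}, a != 0 & ~ R (polyL a)^-1 /\ size a = n >].
have [|n /asboolP[p p0 [Rp sp]] nmin] := @ex_minnP g.
  by exists (size d); apply/asboolP; exists d.
have unitA (a : {poly F}) : a != 0 -> exists (k : nat) (b :
  {poly F}), a = p ^+ k * b /\ ring_unit R (polyL b).
  have [m] := ubnP (size a); elim: m a => // m IH a am a0.
  have [Ra|Ra] := pselect (R (polyL a)^-1).
    by exists 0%N, a; rewrite mul1r; split=> //; split; rewrite ?polyL_eq0.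
  have pa : p %| a.
    rewrite /dvdp; apply: contraT => r0.
    suff : (size p <= size (a %% p)%R)%N by rewrite leqNgt ltn_modp p0.
    rewrite sp; apply: nmin; apply/asboolP; exists (a %% p) => //; split=> // Rr.
    have [/eqP|] : nonunit R (polyL (a %% p)); last by apply.
      have -> : a %% p = a - a %/ p * p by rewrite {2}(divp_eq a p) addrAC subrr add0r.
      rewrite rmorphB rmorphM /=; apply: (nonunitD Rs Rv); first by right.
      have [->|q0] := eqVneq (a %/ p) 0; first by rewrite rmorph0 mul0r oppr0; left.
      right; rewrite -mulrN invfM invrN => Rq; apply: Rp.
      have -> : (polyL p)^-1 = - (polyL (a %/ p) * ((polyL (a %/ p))^-1 * - (polyL p)^-1)).
        by field; rewrite !polyL_eq0 p0 q0.
      by apply: (subringN Rs); apply: (subringM Rs).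
    by rewrite polyL_eq0 (negbTE r0).
  have /dvdp_quot[b ab] := pa.
  have b0 : b != 0 by apply: contraNneq a0 => b0; rewrite ab b0 mul0r.
  have sp1 : (1 < size p)%N.
    have : (0 < size p)%N by rewrite size_poly_gt0.
    case: (ltngtP (size p) 1) => // /eqP/size_poly1P[c c0 E] _.
    case: Rp; rewrite E.
    by have -> : (polyL c%:P)^-1 = polyL (c^-1)%:P by rewrite !polyLC fmorphV.
  have [|//|k [c [bE Uc]]] := IH b.
    by move: am; rewrite ab ltnS; apply: leq_trans; apply: size_lt_mul.
  by exists k.+1, c; split=> //; rewrite ab bE exprS; ring.
have pp0 : polyL p != 0 by rewrite polyL_eq0.
have [a aB a0|c|P [Pp PR]] := @place_of_ring _ _ R Rs Rv (polyL p) pp0 Rp.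
- have [n1 [d1 [d10 aE]]] := base_frac aB.
  have n10 : n1 != 0 by apply: contraNneq a0 => z; rewrite aE z rmorph0 mul0r.
  have [k [b [nE Ub]]] := unitA _ n10; have [j [b' [dE Ub']]] := unitA _ d10.
  exists (j%:Z - k%:Z).
  have -> : a * polyL p ^ (j%:Z - k%:Z) = polyL b * (polyL b')^-1.
    rewrite aE nE dE !rmorphM !rmorphXn /= expfzDr // -invr_expz -!exprnP; field.
    by case: Ub' => b'0 _ _; rewrite !expf_neq0 ?b'0.
  by apply: ring_unitM => //; apply: ring_unitV.
- by rewrite -polyLC.
have fP : fin_place P by rewrite /fin_place -val_geE ?polyLX0 //; apply: PR.
exists P; split=> //; rewrite ltNge; apply/negP => Pd; apply: Rd.
have [k [b [dE Ub]]] := unitA d d0.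
have b0 : b != 0 by apply: contraNneq d0 => b0; rewrite dE b0 mulr0.
have Pb : 0 <= pord P (polyL b) by have := fin_polyL b fP; rewrite val_geE ?polyL_eq0.
move: Pd; rewrite dE rmorphM rmorphXn /= pordM ?expf_neq0 ?polyL_eq0 // pordX //.
case: k {dE} => [|k] h; last by exfalso; nia.
by rewrite mul1r; case: Ub.
Qed.

(** Here the starting ring consists of the fractions of degree at most 0, the valuation ring of F(X)
    at infinity, and 1 / X serves both as the avoided noninvertible element and as [pi]. *)
Lemma exists_inf_place : exists P, ~~ fin_place P.
Proof.
pose S : set L := fun x => exists a b : {poly F}, [/\ b != 0, (size a <= size b)%N &
  x = polyL a / polyL b].
have sz (a b c d : {poly F}) : b != 0 -> d != 0 -> (size a <= size b)%N ->
    (size c <= size d)%N -> (size (a * c)%R <= size (b * d)%R)%N.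
  move=> b0 d0 ab cd; apply: leq_trans (size_polyMleq _ _) _.
  by rewrite size_mul // -!subn1 leq_sub2r // leq_add.
have Ss : subring S.
  split; first by exists 1, 1; rewrite oner_eq0 rmorph1 divr1.
    move=> _ _ [a [b [b0 ab ->]]] [c [d [d0 cd ->]]]; exists (a * d - c * b), (b * d).
    split; first by rewrite mulf_neq0.
      apply: leq_trans (size_polyD _ _) _; rewrite size_polyN geq_max sz //=.
      by rewrite (mulrC b d) sz.
    rewrite rmorphB !rmorphM /=; field; by rewrite !polyL_eq0 b0 d0.
  move=> _ _ [a [b [b0 ab ->]]] [c [d [d0 cd ->]]]; exists (a * c), (b * d).
  split; [by rewrite mulf_neq0|exact: sz|].
  by rewrite !rmorphM /=; field; rewrite !polyL_eq0 b0 d0.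
have SX : ~ S ((polyL 'X)^-1)^-1.
  rewrite invrK => -[a [b [b0 ab E]]].
  have : polyL ('X * b) = polyL a by rewrite rmorphM /= E divfK ?polyL_eq0.
  by move/polyL_inj => aE; move: ab; rewrite -aE mulrC size_mulX // ltnn.
have [R [Rs SR RX Rmax]] := max_subring Ss SX.
have X0 : (polyL 'X)^-1 != 0 by rewrite invr_eq0 polyLX0.
have RX' : R (polyL 'X)^-1.
  apply: SR; exists 1, 'X; rewrite polyX_eq0 size_poly1 size_polyX rmorph1 div1r.
  by [].
have Rv := max_valuation Rs X0 RX' RX Rmax.
have [a aB a0|c|P [Pp PR]] := @place_of_ring _ _ R Rs Rv _ X0 RX.
- have [n1 [d1 [d10 aE]]] := base_frac aB.
  have n10 : n1 != 0 by apply: contraNneq a0 => z; rewrite aE z rmorph0 mul0r.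
  have U (b : {poly F}) : b != 0 -> ring_unit R (polyL b * (polyL 'X)^-1 ^+ (size b).-1).
    move=> b0; have sb : (0 < size b)%N by rewrite size_poly_gt0.
    have Xb : 'X^((size b).-1) != 0 :> {poly F} by rewrite monic_neq0 ?monicXn.
    split; first by rewrite mulf_neq0 ?expf_neq0 ?polyL_eq0.
      apply: SR; exists b, 'X^((size b).-1); split=> //.
        by rewrite size_polyXn prednK.
      by rewrite rmorphXn exprVn.
    apply: SR; exists 'X^((size b).-1), b; split=> //.
      by rewrite size_polyXn prednK.
    by rewrite rmorphXn exprVn invfM invrK mulrC.
  exists ((size n1).-1%:Z - (size d1).-1%:Z).
  have -> : a * (polyL 'X)^-1 ^ ((size n1).-1%:Z - (size d1).-1%:Z) =
     (polyL n1 * (polyL 'X)^-1 ^+ (size n1).-1) * (polyL d1 * (polyL 'X)^-1 ^+ (size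
       d1).-1)^-1.
    rewrite aE expfzDr // -invr_expz -!exprnP; field.
    by rewrite !expf_neq0 ?polyLX0 ?polyL_eq0.
  by apply: (ring_unitM Rs); [apply: U|apply: ring_unitV; apply: U].
- apply: SR; exists c%:P, 1; rewrite oner_eq0 rmorph1 divr1; split=> //.
  by rewrite size_poly1 size_polyC; case: (c != 0).
exists P; rewrite /fin_place -ltNge; move: Pp; rewrite pordV ?polyLX0 //; lia.
Qed.

(** In lowest terms, a nonconstant denominator would vanish at some finite place, where the
    numerator is then a unit by Bezout, so [a] would have a pole there. *)
Lemma base_poly a : a \in 1%VS -> (forall P, fin_place P -> val_ge P 0 a) ->
  exists c : {poly F}, a = polyL c.
Proof.
move=> aB H; have [n [d [d0 aE]]] := base_frac aB.
have g0 : gcdp n d != 0 by rewrite gcdp_eq0 negb_and d0 orbT.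
set n' := n %/ gcdp n d; set d' := d %/ gcdp n d.
have nE : n = n' * gcdp n d by rewrite divpK ?dvdp_gcdl.
have dE : d = d' * gcdp n d by rewrite divpK ?dvdp_gcdr.
have d'0 : d' != 0 by apply: contraNneq d0 => z; rewrite dE z mul0r.
have {}aE : a = polyL n' / polyL d'.
  have nE' : polyL n = polyL n' * polyL (gcdp n d) by rewrite -rmorphM -nE.
  have dE' : polyL d = polyL d' * polyL (gcdp n d) by rewrite -rmorphM -dE.
  by rewrite aE nE' dE' -mulf_div mulfV ?mulr1 // polyL_eq0.
have /Bezout_eq1_coprimepP[[s t] /= E] : coprimep n' d'.
  by apply: coprimep_div_gcd; rewrite d0 orbT.
have [sd|sd] := ltnP 1 (size d').
  have [P [fP Pd]] := exists_fin_place sd.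
  have /H : fin_place P by []; have [n0|n0] := eqVneq n' 0.
    move: E; rewrite n0 mulr0 add0r => E; exfalso.
    have : pord P (polyL (t * d')) = 0 by rewrite E rmorph1 pord1.
    have t0 : t != 0 by apply: contraTneq isT => z; move/eqP: E;
      rewrite z mul0r eq_sym oner_eq0.
    rewrite rmorphM /= pordM ?polyL_eq0 //; have :=
      fin_polyL t fP; rewrite val_geE ?polyL_eq0 //; lia.
  rewrite aE val_geE ?mulf_neq0 ?invr_eq0 ?polyL_eq0 // pordM ?invr_eq0 ?polyL_eq0 //
    pordV ?polyL_eq0 //.
  move=> h; have : val_ge P 1 (polyL 1).
    rewrite -E rmorphD !rmorphM /=; apply: val_geD; rewrite -(add0r 1); apply: val_geM.
    - exact: fin_polyL.
    - by rewrite val_geE ?polyL_eq0 //; lia.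
    - exact: fin_polyL.
    - by rewrite val_geE ?polyL_eq0 //; lia.
  by rewrite rmorph1 val_geE ?oner_eq0 // pord1.
have : size d' == 1%N by rewrite eqn_leq sd size_poly_gt0 d'0.
case/size_poly1P => c c0 dc; exists (c^-1%:P * n').
by rewrite aE dc rmorphM /= !polyLC [RHS]mulrC fmorphV.
Qed.

(** Let d clear the denominators of a monic relation of degree n for x. Then d x satisfies the monic
    relation with coefficients c_i d^(n-i), which are polynomials since i < n. *)
Lemma denominator x : exists2 d : {poly F}, d != 0 & forall P, fin_place P ->
  val_ge P 0 (polyL d * x).
Proof.
have [n [c [cB E]]] := minPoly_relation x.
have [d d0 Hd] : exists2 d, d != 0 & forall i : 'I_n, exists a, polyL d * c i = polyL a.
  have : forall i, exists b, b != 0 /\ exists a, polyL b * c i = polyL a.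
    move=> i; have [a [b [b0 ->]]] := base_frac (cB i); exists b; split=> //.
    by exists a; rewrite mulrC divfK ?polyL_eq0.
  move=> /choice[b Hb]; exists (\prod_i b i).
    by apply/prodf_neq0 => i _; case: (Hb i).
  move=> i; have [_ [a Ea]] := Hb i; exists ((\prod_(j | j != i) b j) * a).
  by rewrite (bigD1 i) //= !rmorphM /= -Ea; ring.
exists d => // P fP; apply: (@integral_val_ge P _ n (fun i => c i * polyL d ^+ (n - i))).
  move=> i; have := ltn_ord i => ni; have -> : (n - i = (n - i.+1).+1)%N by lia.
  rewrite exprS mulrA [c i * _]mulrC; have [a ->] := Hd i.
  by rewrite -rmorphXn -rmorphM fin_polyL.
rewrite exprMn E mulr_sumr; apply: eq_bigr => i _.
have -> : polyL d ^+ n = polyL d ^+ (n - i) * polyL d ^+ i by rewrite -exprD subnK // ltnW.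
by rewrite exprMn; ring.
Qed.

Lemma ram_exists P : exists e : nat, [/\ (0 < e)%N,
  exists a, [/\ a \in 1%VS, a != 0 & pord P a = e%:Z]
  & forall a, a \in 1%VS -> a != 0 -> (e%:Z %| pord P a)%Z].
Proof.
pose g n := `[< (0 < n)%N /\ exists a, [/\ a \in 1%VS, a != 0 & pord P a = n%:Z] >].
have [|e /asboolP[e0 [b [bB b0 Pb]]] emin] := @ex_minnP g.
  have [a [aB a0 Pa]] := nontrivial_base P; exists `|pord P a|%N; apply/asboolP.
  split; first by lia.
  have [h|h] := ltrP 0 (pord P a); first by exists a; split=> //; lia.
  exists a^-1; rewrite invr_eq0 pordV //; split=> //; last by lia.
  by rewrite rpredV.
exists e; split=> //; first by exists b.
move=> a aB a0; have e00 : e%:Z != 0 by lia.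
set q := (pord P a %/ e%:Z)%Z; have Eq := divz_eq (pord P a) e%:Z.
have r0 := modz_ge0 (pord P a) e00; have r1 :
  (pord P a %% e%:Z)%Z < e%:Z by apply: ltz_pmod; lia.
apply/dvdz_mod0P; apply/eqP; apply: contraT => rn0.
have vz y (k : int) : y != 0 -> pord P (y ^ k) = k * pord P y.
  move=> y0; case: k => m; first by rewrite -exprnP pordX.
  by rewrite NegzE -exprnN pordV ?expf_neq0 // pordX //; lia.
have : g `|(pord P a %% e%:Z)%Z|%N.
  apply/asboolP; split; first by lia.
  exists (a * b ^ (- q)); split; [|by rewrite mulf_neq0 ?expfz_neq0|].
    rewrite rpredM //; case: (- q) => m; first by rewrite rpredX.
    by rewrite NegzE -exprnN rpredV rpredX.
  rewrite pordM ?expfz_neq0 // vz // Pb; move: Eq; rewrite -/q => Eq.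
  lia.
by move/emin; lia.
Qed.

(** The positive generator of the group of values of P on the nonzero elements of F(X); as P is
    normalized, this is the ramification index. *)
Definition ram_index P : nat := projT1 (cid (ram_exists P)).

Lemma ram_gt0 P : (0 < ram_index P)%N.
Proof. by rewrite /ram_index; case: cid => e []. Qed.

Lemma ram_unif P : exists a, [/\ a \in 1%VS, a != 0 & pord P a = (ram_index P)%:Z].
Proof. by rewrite /ram_index; case: cid => e []. Qed.

Lemma ram_dvd P a : a \in 1%VS -> a != 0 -> ((ram_index P)%:Z %| pord P a)%Z.
Proof. by rewrite /ram_index; case: cid => e /= [_ _ H]; exact: H. Qed.

End BasePlaces.

(** * Galois action on places *)

Section GaloisPlaces.
Variables (F : fieldType) (L : splittingFieldType {fraction {poly F}}).
Local Notation scal := (@Defs.cst F L).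
Local Notation polyL := (@polyL F L).
Local Notation gT := (gal_of {:L}).
Local Notation G := ('Gal({:L} / 1))%g.
Local Notation Tr := (galTrace 1 {:L}).
Implicit Types (P Q : place L) (x y u : L) (s t : gT).

Lemma gal_base s x : x \in 1%VS -> s x = x.
Proof. by case/vlineP => k ->; rewrite linearZ /= rmorph1. Qed.

Lemma galK s x : s ((s^-1)%g x) = x.
Proof. by rewrite -galM ?memvf // mulVg gal_id. Qed.

Section Conj.
Variables (s : gT) (P : place L).
Lemma conj_place_eqy x : P (s x) = +oo%E <-> x = 0.
Proof. by rewrite val_at_eqy; split=> [/eqP|->]; rewrite ?rmorph0 // fmorph_eq0 => /eqP. Qed.
Lemma conj_placeM_ax x y : P (s (x * y)) = (P (s x) + P (s y))%E.
Proof. by rewrite rmorphM val_atM. Qed.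
Lemma conj_placeD_ax x y : (Order.min (P (s x)) (P (s y)) <= P (s (x + y)%R))%E.
Proof. by rewrite rmorphD val_atD. Qed.
Lemma conj_place_norm : exists x, P (s x) = 1%:E.
Proof. by have [t tP] := val_at_norm P; exists ((s^-1)%g t); rewrite galK. Qed.
Lemma conj_place_cst (c : F) : c != 0 -> P (s (scal c)) = 0%E.
Proof. by move=> c0; rewrite gal_base ?val_at_cst // -polyLC polyL_base. Qed.
Definition conj_place : place L :=
  @Place F L (fun x => P (s x)) conj_place_eqy conj_placeM_ax conj_placeD_ax
    conj_place_norm conj_place_cst.
Lemma pord_conj_place x : pord conj_place x = pord P (s x). Proof. by []. Qed.
Lemma val_ge_conj_place k x : val_ge conj_place k x = val_ge P k (s x). Proof. by []. Qed.
Lemma fin_conj_place : fin_place conj_place = fin_place P.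
Proof. by rewrite /fin_place pord_conj_place gal_base ?polyL_base. Qed.
End Conj.

Lemma conj_place1 P : conj_place 1%g P = P.
Proof. by apply: place_eq => x _; rewrite pord_conj_place gal_id. Qed.

Lemma conj_placeM s t P : conj_place (s * t)%g P = conj_place s (conj_place t P).
Proof. by apply: place_eq => x _; rewrite !pord_conj_place galM ?memvf. Qed.

Lemma ram_conj_place s P : ram_index (conj_place s P) = ram_index P.
Proof.
have [a [aB a0 Pa]] := ram_unif P; have [b [bB b0 Pb]] := ram_unif (conj_place s P).
have := ram_dvd P bB b0; have := ram_dvd (conj_place s P) aB a0.
move: Pb; rewrite !pord_conj_place !gal_base // Pa => -> ? ?.
by apply/eqP; rewrite eqn_dvd; apply/andP.
Qed.

Definition conj_orbit P : seq (place L) := [seq conj_place s P | s <- enum G].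

Lemma galT s : s \in G.
Proof.
rewrite gal_kHom ?sub1v //; apply/kHomP; split=> [x y _ _|x xB]; first by rewrite rmorphM.
exact: gal_base.
Qed.

Lemma mem_conj_orbit s P : conj_place s P \in conj_orbit P.
Proof. by apply/map_f; rewrite mem_enum galT. Qed.

Lemma conj_orbitP P Q : Q \in conj_orbit P -> exists s, Q = conj_place s P.
Proof. by case/mapP => s _ ->; exists s. Qed.

Definition decomp P : {set gT} := [set s in G | conj_place s P == P].

Lemma decomp_fix s P : s \in decomp P -> conj_place s P = P.
Proof. by rewrite inE => /andP[_ /eqP]. Qed.

Lemma group_set_decomp P : group_set (decomp P).
Proof.
apply/group_setP; split=> [|s t]; first by rewrite inE galT conj_place1 eqxx.
rewrite !inE !galT /= => /eqP sP /eqP tP.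
by rewrite conj_placeM tP sP eqxx.
Qed.
Canonical decomp_group P := Group (group_set_decomp P).

Section Galois.
Hypothesis galL : galois 1 {:L}.

Lemma Tr_base x : Tr x \in 1%VS.
Proof. exact: (mem_galTrace galL (memvf x)). Qed.

Lemma Norm_base x : galNorm 1 {:L} x \in 1%VS.
Proof. exact: (mem_galNorm galL (memvf x)). Qed.

Lemma val_ge_polyM P (p q : {poly L}) : (forall i, val_ge P 0 p`_i) ->
  (forall i, val_ge P 0 q`_i) ->
  forall i, val_ge P 0 (p * q)`_i.
Proof.
by move=> Hp Hq i; rewrite coefM; apply: val_ge_sum => j _; rewrite -(addr0 0) val_geM.
Qed.

(* Elements integral at all conjugates of P are integral over the valuation
   ring of F(X) below P, because minimal polynomials split into conjugates. *)
Lemma conj_of_base P Q : (forall a, a \in 1%VS -> val_ge P 0 a -> val_ge Q 0 a) ->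
  Q \in conj_orbit P.
Proof.
move=> H; apply: contraT => QP; have [x x0 /andP[Qx /allP Px]] := place_seps QP.
set y := x^-1; have y0 : y != 0 by rewrite invr_eq0.
have : val_ge Q 0 y.
  apply: integral_val_ge (minPoly_expand y) => i; rewrite val_geN.
  apply: H; first by have /polyOverP := minPolyOver 1%AS y; apply.
  move: (nat_of_ord i) => {}i.
  have [r [_ _ ->]] := elimT (galois_factors (sub1v {:L})) galL y (memvf y).
  elim: r i => [|s r IH] i.
    by rewrite big_nil coef1; case: eqP => _; rewrite ?val_ge0 // val_geE ?oner_eq0 // pord1.
  rewrite /= big_cons; apply: val_ge_polyM => {}i //.
  rewrite coefB coefX coefC; apply: val_geB; case: eqP => _; rewrite ?val_ge0 //.
    by rewrite val_geE ?oner_eq0 // pord1.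
  rewrite -val_ge_conj_place val_geE // pordV //; have := Px _ (mem_conj_orbit s P); lia.
by rewrite val_geE // pordV //; lia.
Qed.

(** At a pole of X the valuation of a fraction is its degree times a negative number, so all such
    places have the same valuation ring in F(X). *)
Lemma inf_conj P Q : ~~ fin_place P -> ~~ fin_place Q -> Q \in conj_orbit P.
Proof.
move=> iP iQ; apply: conj_of_base => a aB; have [n [d [d0 ->]]] := base_frac aB.
have [->|n0] := eqVneq n 0; first by rewrite rmorph0 mul0r !val_ge0.
have nd : polyL n / polyL d != 0 by rewrite mulf_neq0 ?invr_eq0 ?polyL_eq0.
rewrite !val_geE // !pordM ?invr_eq0 ?polyL_eq0 // !pordV ?polyL_eq0 //.
rewrite (inf_polyL iP n0) (inf_polyL iP d0) (inf_polyL iQ n0) (inf_polyL iQ d0).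
move: iP iQ; rewrite /fin_place -!ltNge => iP iQ.
by rewrite -!mulrBl !nmulr_lge0.
Qed.

Lemma fin_conj P Q p : base_prime P p -> fin_place Q -> 0 < pord Q (polyL p) ->
  fin_place P -> Q \in conj_orbit P.
Proof.
move=> Pm fQ Qp fP; have [p0 Pp _ _] := Pm.
apply: conj_of_base => a aB; have [n [d [d0 ->]]] := base_frac aB.
have [->|n0] := eqVneq n 0; first by rewrite rmorph0 mul0r !val_ge0.
have nd : polyL n / polyL d != 0 by rewrite mulf_neq0 ?invr_eq0 ?polyL_eq0.
rewrite !val_geE // !pordM ?invr_eq0 ?polyL_eq0 // !pordV ?polyL_eq0 //.
have [k [n' [-> n'0 pn']]] := base_prime_factor Pm n0.
have [j [d' [-> d'0 pd']]] := base_prime_factor Pm d0.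
have E R (m : nat) b : b != 0 -> pord R (polyL (p ^+ m * b)) = m%:Z * pord R (polyL p) +
  pord R (polyL b).
  by move=> b0; rewrite rmorphM rmorphXn /= pordM ?expf_neq0 ?polyL_eq0 // pordX // polyL_eq0.
rewrite !E // (base_prime_pord0 Pm fP Pp pn') (base_prime_pord0 Pm fP Pp pd').
by rewrite (base_prime_pord0 Pm fQ Qp pn') (base_prime_pord0 Pm fQ Qp pd') !addr0
  -!mulrBl !pmulr_lge0.
Qed.

(** The factor c is a denominator of b stripped of the powers of p, the prime below P.
    Multiplication by c suffices: where p does not vanish the removed powers are units, and where it
    does the place is a conjugate of P. *)
Lemma globalize P b : fin_place P -> (forall s, val_ge P 0 (s b)) ->
  exists c : {poly F}, [/\ c != 0, pord P (polyL c) = 0 & forall Q, fin_place Q ->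
    val_ge Q 0 (polyL c * b)].
Proof.
move=> fP Hb; have [d d0 Hd] := denominator b.
have [p Pm] := base_prime_exists fP; have [p0 Pp _ _] := Pm.
have [k [c [dE c0 pc]]] := base_prime_factor Pm d0.
exists c; split=> //; first exact: (base_prime_pord0 Pm).
move=> Q fQ; have := fin_polyL p fQ; rewrite val_geE ?polyL_eq0 // le_eqVlt =>
  /orP[/eqP Qp|Qp].
  have := Hd Q fQ; rewrite dE rmorphM -mulrA => H.
  rewrite -(val_ge_mulE Q 0 _ (x := polyL (p ^+ k))) ?polyL_eq0 ?expf_neq0 //.
  by rewrite {1}rmorphXn /= pordX ?polyL_eq0 // -Qp mulr0 addr0.
have /conj_orbitP[s ->] := fin_conj Pm fQ Qp fP.
by rewrite val_ge_conj_place rmorphM /= -(addr0 0) val_geM // gal_base ?polyL_base //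
  fin_polyL.
Qed.

(** Induction on the degree, removing a prime factor p of a: the zeros of p are conjugates of one
    finite place, and the places at infinity are conjugates of each other. *)
Lemma finite_support_polyL (a : {poly F}) : a != 0 ->
  finite_set [set P | pord P (polyL a) != 0].
Proof.
have [Pinf iPinf] := exists_inf_place L.
have Hs (s : seq (place L)) (A : set (place L)) : (forall P, A P -> P \in s) -> finite_set A.
  by move=> H; apply: sub_finite_set (finite_seq s) => P /H.
have [n] := ubnP (size a); elim: n a => // n IH a an a0.
have [sa|sa] := leqP (size a) 1.
  have /size_poly1P[c c0 ->] : size a == 1%N by rewrite eqn_leq sa size_poly_gt0.
  by apply: (Hs [::]) => P /=; rewrite polyLC pord_cst.
have [P [fP Pa]] := exists_fin_place L sa.
have [p Pm] := base_prime_exists fP; have [p0 Pp pd _] := Pm.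
have /dvdp_quot[b ab] : p %| a by apply: pd.
have b0 : b != 0 by apply: contraNneq a0 => b0; rewrite ab b0 mul0r.
have sp : (1 < size p)%N.
  rewrite ltnNge; apply/negP => sp; have : size p == 1%N by rewrite eqn_leq sp size_poly_gt0.
  by case/size_poly1P => c c0 E; move: Pp; rewrite E polyLC pord_cst.
have finb : finite_set [set P | pord P (polyL b) != 0].
  by apply: IH => //; move: an; rewrite ab ltnS; apply: leq_trans; apply: size_lt_mul.
have /finite_seqP[s sE] := finb.
apply: (Hs (s ++ conj_orbit P ++ conj_orbit Pinf)) => Q /= Qa; rewrite !mem_cat.
have [fQ|iQ] := boolP (fin_place Q); last by rewrite (inf_conj iPinf iQ) !orbT.
have [Qb|Qb] := eqVneq (pord Q (polyL b)) 0; last first.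
  by have -> : Q \in s by have : [set` s]%classic Q by rewrite -sE.
rewrite (fin_conj Pm fQ _ fP) ?orbT //.
have := fin_polyL p fQ; rewrite val_geE ?polyL_eq0 //.
by rewrite le_eqVlt eq_sym => /orP[/eqP Qp|//]; move: Qa;
  rewrite ab rmorphM /= pordM ?polyL_eq0 // Qb Qp eqxx.
Qed.

(** The trace lies in F(X), so its valuation at P is a multiple of e_P; a multiple that is at least
    1 - e_P is nonnegative. *)
Lemma val_ge_Tr P y : (forall s, val_ge P (1 - (ram_index P)%:Z) (s y)) -> val_ge P 0 (Tr y).
Proof.
move=> H; have : val_ge P (1 - (ram_index P)%:Z) (Tr y) by apply: val_ge_sum.
have [->|T0] := eqVneq (Tr y) 0; first by rewrite !val_ge0.
rewrite !val_geE //; have /dvdzP[k ->] := ram_dvd P (Tr_base y) T0; have := ram_gt0 P.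
move: (ram_index P) => e e0; case: (lerP 0 k) => k0 H'; first by rewrite mulr_ge0.
have : k * e%:Z <= - e%:Z by rewrite -mulN1r ler_wpM2r //; lia.
lia.
Qed.

Lemma approx_conj P (N : nat) : exists z, val_ge P N (z - 1) /\
  forall s, conj_place s P != P -> val_ge P N (s z).
Proof.
have [|z [z1 Hz]] := @weak_approx _ _ P [seq Q <- conj_orbit P | Q != P] N.
  by rewrite mem_filter eqxx.
by exists z; split=> // s sP; have := Hz (conj_place s P);
  rewrite mem_filter sP mem_conj_orbit; apply.
Qed.

(** Multiplying x by a z close to 1 at P and to 0 at its other conjugates cuts the trace down to the
    decomposition group. The same z makes a second element x' small at those conjugates. *)
Lemma Tr_approx P x x' (k : int) : exists z,
  [/\ val_ge P 0 z, forall s, conj_place s P != P -> val_ge P k (s (x' * z))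
    & val_ge P k (Tr (x * z) - \sum_(s in decomp P) s x)].
Proof.
have [N Ns] : exists N : nat, forall s,
    `|k|%:Z + `|pord P (s x)|%:Z + `|pord P (s x')|%:Z <= N%:Z.
  exists (`|k| + \sum_(s : gT) (`|pord P (s x)| + `|pord P (s x')|))%N => s.
  by rewrite (bigD1 s) //=; lia.
have [z [z1 zs]] := approx_conj P N; exists z.
have h1 s y : pord P (s y) + N >= k -> conj_place s P != P -> val_ge P k (s (y * z)).
  move=> yN sP; rewrite rmorphM /=; apply: (@val_ge_le _ _ _ (pord P (s y) + N)) => //.
  by apply: val_geM; [apply: val_ge_pord|apply: zs].
split.
- rewrite -(subrK 1 z); apply: val_geD; first by apply: val_ge_le z1; lia.
  by rewrite val_geE ?oner_eq0 // pord1.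
- by move=> s sP; apply: h1; [have := Ns s; lia|].
rewrite /galTrace (bigID (mem (decomp P))) /=.
rewrite (eq_bigl (mem (decomp P))); last by move=> s; rewrite /= inE galT.
rewrite addrAC -sumrB; apply: val_geD; apply: val_ge_sum => s.
  move/decomp_fix => sP; rewrite -rmorphB /= -val_ge_conj_place sP.
  rewrite -{2}(mulr1 x) -mulrBr; apply: (@val_ge_le _ _ _ (pord P x + N)); last first.
    by apply: val_geM; [apply: val_ge_pord|].
  by have := Ns s; rewrite -pord_conj_place sP; lia.
by rewrite inE galT /= => sP; apply: h1; [have := Ns s; lia|].
Qed.

Section Tame.
Hypothesis tame : forall n, (n %| #|G|)%N -> n%:R != 0 :> F.

(* With val_ge_Tr: the trace dual of the integral closure at P is given by the
   valuations >= 1 - e_P. *)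
Lemma not_dual P y : y != 0 -> pord P y <= - (ram_index P)%:Z ->
  exists b, (forall s, val_ge P 0 (s b)) /\ ~~ val_ge P 0 (Tr (y * b)).
Proof.
move=> y0 Py; have [p [pB p0 Pp]] := ram_unif P; have e0 := ram_gt0 P.
have [z [z0 zs zT]] := Tr_approx P p^-1 (y * p)^-1 0.
have yp0 : y * p != 0 by rewrite mulf_neq0.
(* The product of y and the witness is z / p, with trace #|decomp P| / p up to an element integral
   at P. By tameness the numerator is a nonzero constant, and 1 / p has valuation -e_P. *)
exists ((y * p)^-1 * z); split.
  move=> s; have [sP|] := eqVneq (conj_place s P) P; last exact: zs.
  rewrite -val_ge_conj_place sP -(addr0 0) val_geM // val_geE ?invr_eq0 // pordV // pordM //.
  by rewrite oppr_ge0 Pp -lerBrDr sub0r.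
have -> : y * ((y * p)^-1 * z) = p^-1 * z by field; rewrite y0 p0.
apply/negP => H; have := val_geB H zT; rewrite subKr.
rewrite (eq_bigr (fun=> p^-1)); last by move=> s _; rewrite gal_base // rpredV.
have c0 : (#|decomp P|)%:R != 0 :> F.
  apply: tame; have sG : decomp P \subset G by apply/fintype.subsetP => s _; apply: galT.
  exact: (cardSg (H := decomp_group P) (G := galoisG_group _ _) sG).
rewrite sumr_const -mulr_natl -(rmorph_nat scal) val_geE; last first.
  by rewrite mulf_neq0 ?invr_eq0 // fmorph_eq0.
by rewrite pordM ?invr_eq0 ?fmorph_eq0 // pord_cst // pordV // Pp add0r oppr_ge0 leNgt
  ltz_nat e0.
Qed.

Hypothesis primeG : prime #|G|.

(* If the decomposition group were trivial, an element of valuation 1 at P and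
   large valuation at the other conjugates would have a trace of valuation 1. *)
Lemma ram_decomp P : (1 < ram_index P)%N -> decomp P = G.
Proof.
move=> e1; have sG : decomp P \subset G by apply/fintype.subsetP => s _; apply: galT.
have := cardSg (H := decomp_group P) (G := galoisG_group _ _) sG.
case/primeP: primeG => _ H /H /orP[/eqP c1|/eqP cG]; last first.
  by apply/eqP; rewrite eqEcard sG cG leqnn.
have S1 : decomp P = [set 1%g] by apply: (@card1_trivg _ (decomp_group P)).
have [r r0 Pr] := uniformizer P.
have [z [_ _]] := Tr_approx P r r 2; rewrite S1 big_set1 gal_id => zT.
have [|T0 vT] := @pord_dom _ _ P r (Tr (r * z) - r) r0.
  by apply: val_ge_le zT; rewrite Pr.
move: T0 vT; rewrite addrC subrK => T0 vT.
have := ram_dvd P (Tr_base (r * z)) T0; rewrite vT Pr.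
by rewrite dvdz1 /= => /eqP e; move: e1; rewrite -[ram_index P]/(`|(ram_index P)%:Z|%N) e.
Qed.

Lemma conj_place_fix P s : (1 < ram_index P)%N -> conj_place s P = P.
Proof. by move=> /ram_decomp E; have := galT s; rewrite -E inE => /andP[_ /eqP]. Qed.

Lemma pord_prod P (I : eqType) (r : seq I) (p : pred I) (f : I -> L) :
  (forall i, p i -> f i != 0) ->
  pord P (\prod_(i <- r | p i) f i) = \sum_(i <- r | p i) pord P (f i).
Proof.
move=> H; elim: r => [|i r IH]; first by rewrite !big_nil pord1.
rewrite !big_cons; case: ifP => // pi; rewrite pordM ?IH ?H //.
by rewrite prodf_seq_neq0; apply/allP => j _; apply/implyP => /H.
Qed.

(** All conjugates of a uniformizer have valuation 1 at P, so its norm, an element of F(X), has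
    valuation #|G|. Thus e_P divides a prime. *)
Lemma ram_prime P : (1 < ram_index P)%N -> ram_index P = #|G|.
Proof.
move=> e1; have [r r0 Pr] := uniformizer P.
have N0 : galNorm 1 {:L} r != 0 by rewrite galNorm_eq0.
have := ram_dvd P (Norm_base r) N0; rewrite /galNorm pord_prod; last first.
  by move=> s _; rewrite fmorph_eq0.
rewrite (eq_bigr (fun=> 1)); last by move=> s _; rewrite -pord_conj_place conj_place_fix.
rewrite sumr_const natz dvdzE /= => /(prime_nt_dvdP primeG); apply.
by rewrite neq_ltn e1 orbT.
Qed.

End Tame.
End Galois.
End GaloisPlaces.

(** * Residue fields and Riemann-Roch spaces *)

Section Residue.
Variables (F : fieldType) (L : fieldExtType {fraction {poly F}}).
Local Notation scal := (@Defs.cst F L).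
Local Notation polyL := (@polyL F L).
Implicit Types (P Q : place L) (x y u : L).

Lemma val_idealE P x : val_ideal P x <-> val_ge P 1 x.
Proof.
rewrite /val_ideal /=; have [->|x0] := eqVneq x 0; first by rewrite place0 val_ge0 ltey.
by rewrite pordE // lte_fin val_geE.
Qed.

Lemma Fspace_val_ge P k : Fspace [set x | val_ge P k x].
Proof. by split=> [|x y|c x] /=; [exact: val_ge0|exact: val_geD|exact: val_ge_cstM]. Qed.

Lemma Fspace_val_ring P : Fspace (val_ring P).
Proof. exact: Fspace_val_ge. Qed.

Lemma val_ideal_val_ge P : val_ideal P = [set x | val_ge P 1 x]%classic.
Proof. by apply/funext => x; apply/propext; exact: val_idealE. Qed.

Lemma Fspace_val_ideal P : Fspace (val_ideal P).
Proof. by rewrite val_ideal_val_ge; apply: Fspace_val_ge. Qed.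

Lemma Fcomb_polyL n (r : {poly F}) : (size r <= n)%N ->
  polyL r = Fcomb (fun i : 'I_n => polyL 'X^i) (fun i : 'I_n => r`_i).
Proof.
move=> rn; rewrite /Fcomb -{1}(coefK r) poly_def (big_ord_widen _ (fun i => r`_i *: 'X^i) rn).
rewrite big_mkcond rmorph_sum; apply: eq_bigr => i _.
case: ltnP => [_|/leq_sizeP/(_ _ (leqnn _)) ->]; last by rewrite !rmorph0 mul0r.
by rewrite -mul_polyC rmorphM.
Qed.

(** The residue field of F(X) below P is finite-dimensional over F: spanned by powers of X modulo p
    at a finite place, and equal to F at infinity. *)
Lemma base_residue P : exists m (b : 'I_m -> L),
  (forall j, val_ge P 0 (b j)) /\ forall a, a \in 1%VS -> val_ge P 0 a ->
    exists c, val_ge P 1 (a - Fcomb b c).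
Proof.
have [fP|iP] := boolP (fin_place P).
  have [p Pm] := base_prime_exists fP; have [p0 Pp _ pB] := Pm.
  exists (size p), (fun i => polyL 'X^i); split=> [j|a aB aP]; first exact: fin_polyL.
  have [n [d [d0 aE]]] := base_frac aB.
  have [n0|n0] := eqVneq n 0.
    exists (fun=> 0); rewrite aE n0 rmorph0 mul0r /Fcomb big1 ?subr0 ?val_ge0 // => j _.
    by rewrite rmorph0 mul0r.
  have [k [n' [nE n'0 pn]]] := base_prime_factor Pm n0.
  have [j [d' [dE d'0 pd]]] := base_prime_factor Pm d0.
  have vn := base_prime_pord0 Pm fP Pp pn; have vd := base_prime_pord0 Pm fP Pp pd.
  have jk : (j <= k)%N.
    move: aP; rewrite aE nE dE !rmorphM !rmorphXn /= val_geE; last first.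
      by rewrite !mulf_neq0 ?invr_eq0 ?mulf_neq0 ?expf_neq0 ?polyL_eq0.
    rewrite pordM ?invr_eq0 ?mulf_neq0 ?expf_neq0 ?polyL_eq0 //.
    rewrite pordV ?mulf_neq0 ?expf_neq0 ?polyL_eq0 //.
    rewrite !pordM ?expf_neq0 ?polyL_eq0 // !pordX ?polyL_eq0 // vn vd !addr0 -mulrBl.
    by rewrite pmulr_lge0 // subr_ge0 lez_nat.
  have {}aE : a = polyL (p ^+ (k - j) * n') / polyL d'.
    rewrite aE nE dE -{1}(subnK jk) exprD !rmorphM !rmorphXn /=.
    by field; rewrite polyL_eq0 d'0 expf_neq0 ?polyL_eq0.
  move: (p ^+ (k - j) * n') aE => n'' aE.
  (* Modulo p, s inverts d', so n'' / d' has the residue of the polynomial n'' s, which is then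
     reduced modulo p. *)
  have [s [t st]] := pB d' pd.
  have E : polyL n'' / polyL d' - polyL (n'' * s) = polyL (n'' * t * p) / polyL d'.
    have -> : polyL (n'' * t * p) = polyL n'' * (1 - polyL s * polyL d').
      by rewrite -(rmorph1 polyL) -!rmorphM -rmorphB -rmorphM -st; congr (polyL _); ring.
    by rewrite rmorphM /=; field; rewrite polyL_eq0.
  exists (fun i : 'I_(size p) => ((n'' * s) %% p)`_i).
  rewrite -Fcomb_polyL; last by rewrite ltnW // ltn_modp.
  have -> : a - polyL ((n'' * s) %% p) = polyL (n'' * t * p) / polyL d' + polyL ((n'' *
    s) %/ p * p).
    rewrite -E aE; rewrite -addrA; congr (_ + _).
    by rewrite {2}(divp_eq (n'' * s) p) rmorphD /= opprD addrAC addNr add0r.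
  apply: val_geD.
    rewrite rmorphM /= mulrAC -(add0r 1); apply: val_geM; last by rewrite val_geE ?polyL_eq0.
    rewrite -(addr0 0); apply: val_geM; first exact: fin_polyL.
    by rewrite val_geE ?invr_eq0 ?polyL_eq0 // pordV ?polyL_eq0 // vd.
  rewrite rmorphM /= -(add0r 1); apply: val_geM; first exact: fin_polyL.
  by rewrite val_geE ?polyL_eq0.
exists 1%N, (fun=> 1); split=> [j|a aB aP]; first by rewrite val_geE ?oner_eq0 // pord1.
have [n [d [d0 aE]]] := base_frac aB.
have sd : (0 < size d)%N by rewrite size_poly_gt0.
have XP : pord P (polyL 'X) < 0 by rewrite ltNge.
have nd : (size n <= size d)%N.
  have [->|n0] := eqVneq n 0; first by rewrite size_poly0.
  move: aP; rewrite aE val_geE ?mulf_neq0 ?invr_eq0 ?polyL_eq0 //.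
  rewrite pordM ?invr_eq0 ?polyL_eq0 // pordV ?polyL_eq0 // (inf_polyL iP n0) (inf_polyL
    iP d0).
  rewrite -mulrBl nmulr_lge0 // subr_le0 lez_nat.
  by move: sd; case: (size d) => // e _; case: (size n).
(* The value of the fraction at infinity: the quotient of the leading coefficients if the degrees
   agree, and 0 if the numerator has smaller degree. *)
have [c cE] : exists c, c * lead_coef d = n`_(size d).-1.
  by exists (n`_(size d).-1 / lead_coef d); rewrite divfK // lead_coef_eq0.
exists (fun=> c); rewrite /Fcomb big_ord1 mulr1.
pose r := n - c%:P * d.
have rs : (size r < size d)%N.
  have rd : (size r <= size d)%N.
    rewrite /r; apply: leq_trans (size_polyD _ _) _; rewrite size_polyN geq_max nd mul_polyC.
    exact: size_scale_leq.
  rewrite ltn_neqAle rd andbT; apply/eqP => rE.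
  have : lead_coef r = 0.
    by rewrite /lead_coef rE /r coefB coefCM -/(lead_coef d) cE subrr.
  by move/eqP; rewrite lead_coef_eq0 -size_poly_eq0 rE; case: (size d) sd.
have -> : a - scal c = polyL r / polyL d.
  by rewrite aE /r rmorphB rmorphM /= polyLC; field; rewrite polyL_eq0.
have [->|r0] := eqVneq r 0; first by rewrite rmorph0 mul0r val_ge0.
rewrite val_geE ?mulf_neq0 ?invr_eq0 ?polyL_eq0 // pordM ?invr_eq0 ?polyL_eq0 //.
rewrite pordV ?polyL_eq0 // (inf_polyL iP r0) (inf_polyL iP d0) -mulrBl.
have sr : (0 < size r)%N by rewrite size_poly_gt0.
rewrite -gtz0_ge1 nmulr_lgt0 // subr_lt0 ltz_nat.
by move: rs sr sd; case: (size r) => // i; case: (size d).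
Qed.

Lemma subring_val_ring P : subring (val_ring P).
Proof.
split; first by rewrite -[val_ring P 1]/(is_true (val_ge P 0 1)) val_geE ?oner_eq0 // pord1.
  by move=> x y; apply: val_geB.
by move=> x y Px Py; rewrite -[val_ring P _]/(is_true (val_ge P 0 (x * y))) -(addr0 0) val_geM.
Qed.

Lemma valuation_val_ring P x : x != 0 -> val_ring P x \/ val_ring P x^-1.
Proof.
move=> x0; have [h|h] := lerP 0 (pord P x).
  by left; rewrite -[val_ring P _]/(is_true (val_ge P 0 _)) val_geE.
by right; rewrite -[val_ring P _]/(is_true (val_ge P 0 _)) val_geE ?invr_eq0 // pordV //
  oppr_ge0 ltW.
Qed.

(** Linear independence of the residues of the [u i] over the residue field of F(X) below P. *)
Definition residue_indep P r (u : 'I_r -> L) := forall a : 'I_r -> L,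
  (forall i, a i \in 1%VS) -> (forall i, val_ge P 0 (a i)) ->
  val_ge P 1 (\sum_i a i * u i) -> forall i, val_ge P 1 (a i).

(** A linear relation over F(X), divided by its coefficient of least valuation, would reduce to a
    nontrivial relation between residues. *)
Lemma residue_indep_leq P r (u : 'I_r -> L) : residue_indep P u -> (r <= \dim {:L})%N.
Proof.
move=> ku; pose X := [tuple u i | i < r].
have [fX|] := boolP (free X).
  by have := dimvS (subvf <<X>>); rewrite (eqP fX) size_tuple.
move/freeP => H; exfalso; apply: H => k kS.
have nz (j : 'I_r) : k j != 0 -> False.
  move=> kj; pose f i := (k i)%:A : L.
  have fj : f j != 0 by rewrite /f scaler_eq0 negb_or kj oner_eq0.
  have [|i [_ fi0 fR]] := @dominating _ _ _ (subring_val_ring P) (@valuation_val_ring P)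
    _ f (enum 'I_r).
    by apply/hasP; exists j; rewrite ?mem_enum.
  have : val_ge P 1 (f i / f i).
    apply: (ku (fun l => f l / f i)) => [l|l|].
    - by rewrite rpred_div // rpredZ // mem1v.
    - by apply: fR; rewrite mem_enum.
    - under eq_bigr do rewrite mulrAC; rewrite -mulr_suml.
      rewrite [X in X / _](_ : _ = 0) ?mul0r ?val_ge0 // -[RHS]kS.
      by apply: eq_bigr => l _; rewrite /f (nth_map l) ?size_enum_ord // nth_ord_enum
        -scalerAl mul1r.
  by rewrite mulfV // val_geE ?oner_eq0 // pord1.
by move=> i; apply/eqP; apply: contraT => /nz.
Qed.

(** Keeps [place_deg] from being the junk value: the products of a maximal residue-independent
    family with F-generators of the residue field of F(X) span the residue field at P. *)
Lemma residue_dim P : exists d, is_qdim (val_ring P) (val_ideal P) d.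
Proof.
pose p r := `[< exists u : 'I_r -> L, (forall i, val_ge P 0 (u i)) /\ residue_indep P u >].
have p0 : exists r, p r by exists 0%N; apply/asboolP; exists (fun=> 0); split=> [|a _ _ _] [].
have pN r : p r -> (r <= \dim {:L})%N by move/asboolP => [u [_ /residue_indep_leq]].
case: (ex_maxnP p0 pN) => r /asboolP[u [Pu ku]] r_max.
have [m [b [Pb Hb]]] := base_residue P.
pose bu (ij : 'I_r * 'I_m) := b ij.2 * u ij.1.
have [N _ HN] : exists2 d, (d <= #|{: 'I_r * 'I_m}|)%N & is_qdim (val_ring P) (val_ideal P) d.
  apply: is_qdim_bound; first exact: Fspace_val_ideal.
  move=> n v Pv iv; rewrite -[n]card_ord;
    apply: (indep_leq (Fspace_val_ideal P) _ iv (b := bu)) => j.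
  apply: contrapT => Hx; set x := v j.
  suff /r_max : p r.+1 by rewrite ltnn.
  apply/asboolP; exists (fun i => oapp u x (unlift ord_max i)); split=> [i|a aB aP].
    by case: unliftP => [l|] _ /=; [apply: Pu|apply: Pv].
  rewrite big_ord_recr /= unlift_none /=.
  rewrite (eq_bigr (fun i : 'I_r => a (lift ord_max i) * u i)); last first.
    move=> i _; have -> : widen_ord (leqnSn r) i = lift ord_max i.
      by apply: val_inj; rewrite [RHS]lift_max.
    by rewrite liftK.
  have [a1|a1] := boolP (val_ge P 1 (a ord_max)).
    move=> H; have /ku K : val_ge P 1 (\sum_i a (lift ord_max i) * u i).
      rewrite -[X in val_ge P 1 X](addrK (a ord_max * x)); apply: val_geB => //.
      by rewrite -(addr0 1) val_geM //; apply: Pv.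
    by move=> l; case: (unliftP ord_max l) => [i ->|-> //]; apply: K.
  (* The coefficient of x is a unit at P, so the relation gives the residue of x in terms of the
     [u i], with coefficients whose residues are F-combinations of [b]. *)
  move=> H; case: Hx; set al := a ord_max in a1 H *.
  have al0 : al != 0 by apply: contraNneq a1 => ->; rewrite val_ge0.
  have val : pord P al = 0.
    by apply/eqP; move: a1 (aP ord_max); rewrite !val_geE // -/al; lia.
  have bi i : exists c, val_ge P 1 (- (a (lift ord_max i) / al) - Fcomb b c).
    apply: Hb; first by rewrite rpredN; apply: rpred_div; apply: aB.
    rewrite val_geN -(addr0 0); apply: val_geM => //.
    by rewrite val_geE ?invr_eq0 // pordV // val.
  have [c Hc] := choice bi; exists (fun ij => c ij.1 ij.2); apply/val_idealE.
  have -> : v j - Fcomb bu (fun ij => c ij.1 ij.2) =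
    (\sum_i a (lift ord_max i) * u i + al * x) / al +
    \sum_i (- (a (lift ord_max i) / al) - Fcomb b (c i)) * u i.
    have -> : Fcomb bu (fun ij => c ij.1 ij.2) = \sum_i Fcomb b (c i) * u i.
      under [RHS]eq_bigr do rewrite mulr_suml; rewrite pair_bigA /=.
      by apply: eq_bigr => ij _; rewrite mulrA.
    have -> : \sum_i (- (a (lift ord_max i) / al) - Fcomb b (c i)) * u i =
        - (\sum_i a (lift ord_max i) * u i / al) - \sum_i Fcomb b (c i) * u i.
      by rewrite -sumrN -sumrB; apply: eq_bigr => i _; rewrite mulrBl mulNr mulrAC.
    rewrite -mulr_suml -/x; field.
    exact: al0.
  apply: val_geD.
    rewrite -(addr0 1); apply: val_geM => //; by rewrite val_geE ?invr_eq0 // pordV // val.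
  by apply: val_ge_sum => i _; rewrite -(addr0 1); apply: val_geM.
by exists N.
Qed.
End Residue.

(** * Divisors, Riemann-Roch spaces and Riemann's equality *)

Section RiemannRoch.
Variables (F : fieldType) (L : splittingFieldType {fraction {poly F}}).
Local Notation scal := (@Defs.cst F L).
Local Notation polyL := (@polyL F L).
Implicit Types (P Q : place L) (D E : divisor L) (x y u : L).

Lemma pordXz P x (k : int) : x != 0 -> pord P (x ^ k) = k * pord P x.
Proof.
move=> x0; case: k => n; first by rewrite -exprnP pordX.
by rewrite NegzE -exprnN pordV ?expf_neq0 // pordX // mulNr.
Qed.

Lemma is_qdim_mul (V W V' W' : set L) u n : u != 0 ->
  (forall x, V' x <-> V (u * x)) -> (forall x, W' x <-> W (u * x)) ->
  is_qdim V W n -> is_qdim V' W' n.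
Proof.
move=> u0 HV HW [b [Vb sb ib]].
have E (c : 'I_n -> F) : u * Fcomb (fun i => u^-1 * b i) c = Fcomb b c.
  rewrite /Fcomb mulr_sumr; apply: eq_bigr => i _.
  by rewrite mulrCA mulVKf.
exists (fun i => u^-1 * b i); split.
- by move=> i; apply/HV; rewrite mulVKf.
- move=> x /HV/sb[c Hc]; exists c; apply/HW.
  by rewrite -/(Fcomb _ c) mulrBr E.
- move=> c /HW; rewrite -/(Fcomb _ c) E; exact: ib.
Qed.

Lemma is_qdim_refl (V : set L) : Fspace V -> is_qdim V V 0.
Proof.
move=> [V0 _ _]; exists (fun=> 0); split=> [[]//|x Vx|c _ []//].
by exists (fun=> 0); rewrite big_ord0 subr0.
Qed.

Lemma place_degP P : is_qdim (val_ring P) (val_ideal P) (place_deg P).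
Proof. by have [d Hd] := residue_dim P; apply: xgetPex; exists d. Qed.

Lemma div_eq D E : (forall P, D P = E P) -> D = E.
Proof.
move=> H; have /= e : div_mult D = div_mult E by apply/funext.
case: D E e {H} => f fp [h hp] /= e; case: _ / e in hp *.
by congr Divisor; apply: Prop_irrelevance.
Qed.

Lemma finite_supp_seq (f : place L -> int) (s : seq (place L)) :
  (forall P, f P != 0 -> P \in s) -> finite_set [set P | f P != 0].
Proof. by move=> H; apply: sub_finite_set (finite_seq s) => P /H. Qed.

Lemma supp D : exists2 s : seq (place L), uniq s & forall P, D P != 0 -> P \in s.
Proof.
have /finite_seqP[s sE] := div_fin D; exists (undup s); first exact: undup_uniq.
by move=> P DP; rewrite mem_undup; have : [set` s]%classic P by rewrite -sE.
Qed.

Lemma div_add_fin D E : finite_set [set P | D P + E P != 0].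
Proof.
have [s _ sD] := supp D; have [s' _ s'E] := supp E.
apply: (@finite_supp_seq _ (s ++ s')) => P; rewrite mem_cat; apply: contraNT.
rewrite negb_or => /andP[Ps Ps'].
have /eqP -> : D P == 0 by apply: contraNT Ps => /sD.
by rewrite add0r; apply: contraNT Ps' => /s'E.
Qed.
Definition div_add D E : divisor L := Divisor (div_add_fin D E).

Lemma div_scale_fin (k : int) D : finite_set [set P | k * D P != 0].
Proof.
have [s _ sD] := supp D; apply: (@finite_supp_seq _ s) => P; apply: contraNT => Ps.
by have /eqP -> : D P == 0 by [apply: contraNT Ps => /sD]; rewrite mulr0.
Qed.
Definition div_scale k D : divisor L := Divisor (div_scale_fin k D).

Lemma div_point_fin P : finite_set [set Q | ((Q == P)%:Z : int) != 0].
Proof. by apply: (@finite_supp_seq _ [:: P]) => Q; rewrite inE; case: (Q == P). Qed.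
Definition div_point P : divisor L := Divisor (div_point_fin P).

Lemma div_degE D (s : seq (place L)) : uniq s -> (forall P, D P != 0 -> P \in s) ->
  div_deg D = \sum_(P <- s) D P * (place_deg P)%:Z.
Proof.
move=> us sD; rewrite /div_deg (fsbigE s) //=.
  by apply: eq_bigl => P; rewrite in_setT.
move=> P _ Ps; have /eqP -> : D P == 0 by apply: contraNT Ps => /sD.
by rewrite mul0r.
Qed.

Lemma div_degD D E : div_deg (div_add D E) = div_deg D + div_deg E.
Proof.
have [s us sD] := supp D; have [s' us' s'E] := supp E.
have U : uniq (undup (s ++ s')) by apply: undup_uniq.
rewrite !(div_degE U) /=.
- by rewrite -big_split; apply: eq_bigr => P _; rewrite mulrDl.
- by move=> P /s'E Ps; rewrite mem_undup mem_cat Ps orbT.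
- by move=> P /sD Ps; rewrite mem_undup mem_cat Ps.
- move=> P; rewrite mem_undup mem_cat; apply: contraNT.
  rewrite negb_or => /andP[Ps Ps'].
  have /eqP -> : D P == 0 by apply: contraNT Ps => /sD.
  by rewrite add0r; apply: contraNT Ps' => /s'E.
Qed.

Lemma div_deg_scale k D : div_deg (div_scale k D) = k * div_deg D.
Proof.
have [s us sD] := supp D; rewrite !(div_degE us) //=; last first.
  move=> P; apply: contraNT => Ps.
  by have /eqP -> : D P == 0 by [apply: contraNT Ps => /sD]; rewrite mulr0.
by rewrite mulr_sumr; apply: eq_bigr => P _; rewrite mulrA.
Qed.

Lemma div_deg_point P : div_deg (div_point P) = (place_deg P)%:Z.
Proof.
rewrite (@div_degE _ [:: P]) //= => [|Q]; last by rewrite inE; case: (Q == P).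
by rewrite big_seq1 eqxx mul1r.
Qed.

Lemma Fspace_RR D : Fspace (RR_space D).
Proof.
split=> [P|x y Hx Hy P|c x Hx P].
- exact: val_ge0.
- by apply: val_geD; [apply: Hx|apply: Hy].
- by apply: val_ge_cstM; apply: Hx.
Qed.

(** Multiplication by t, of valuation D(P) + 1 at P, embeds L(D + P) / L(D) into the residue field
    at P. *)
Lemma RR_point D P : exists n, is_qdim (RR_space (div_add D (div_point P))) (RR_space D) n
  /\ (n <= place_deg P)%N.
Proof.
have [r r0 Pr] := uniformizer P; pose t := r ^ (D P + 1).
have t0 : t != 0 by rewrite expfz_neq0.
have Pt : pord P t = D P + 1 by rewrite pordXz // Pr mulr1.
have [n nP Hn] : exists2 n, (n <= place_deg P)%N &
    is_qdim (RR_space (div_add D (div_point P))) (RR_space D) n; last by exists n.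
apply: is_qdim_bound; first exact: Fspace_RR.
move=> m v Hv iv; rewrite -[m]card_ord.
apply: (is_qdim_indep (Fspace_val_ideal P) (place_degP P) (u := fun i => t * v i)) => [i|c Hc].
  rewrite -[val_ring _ _]/(is_true (val_ge P 0 _)).
  by have := Hv i P; rewrite /= eqxx -[X in X ->
    _]/(is_true (val_ge P (- (D P + 1)) (v i))) -Pt -(val_ge_mulE P _ _ t0) addNr.
apply: iv => Q; rewrite -[X in is_true X]/(val_ge Q (- D Q) (Fcomb v c)).
have [->|QP] := eqVneq Q P.
  rewrite -(val_ge_mulE P _ _ t0) Pt addKr; move/val_idealE: Hc.
  rewrite /Fcomb mulr_sumr; congr (is_true (val_ge _ _ _)).
  by apply: eq_bigr => i _; rewrite mulrCA.
apply: val_ge_sum => i _; apply: val_ge_cstM.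
by have := Hv i Q; rewrite /= (negbTE QP) addr0.
Qed.

Definition RR_grow D E := exists n, is_qdim (RR_space E) (RR_space D) n
  /\ n%:Z <= div_deg E - div_deg D.

Lemma RR_grow_trans D E D' : (forall P, D P <= E P) -> (forall P, E P <= D' P) ->
  RR_grow D E -> RR_grow E D' -> RR_grow D D'.
Proof.
move=> DE ED' [n [Hn nd]] [m [Hm md]]; exists (n + m)%N; split; last by lia.
apply: (is_qdim_add (Fspace_RR D) (Fspace_RR E) (Fspace_RR D') _ _ Hn Hm) => x Hx P.
  by apply: (@val_ge_le _ _ _ (- D P)); [rewrite lerN2|apply: Hx].
by apply: (@val_ge_le _ _ _ (- E P)); [rewrite lerN2|apply: Hx].
Qed.

Lemma RR_grow_refl D : RR_grow D D.
Proof. by exists 0%N; rewrite subrr; split=> //; apply/is_qdim_refl/Fspace_RR. Qed.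

Lemma RR_grow_point D P (k : nat) : RR_grow D (div_add D (div_scale k (div_point P))).
Proof.
elim: k => [|k IH].
  rewrite (_ : div_add _ _ = D); first exact: RR_grow_refl.
  by apply: div_eq => Q /=; rewrite mul0r addr0.
have -> : div_add D (div_scale k.+1 (div_point P)) = div_add (div_add D (div_scale k
  (div_point P))) (div_point P).
  by apply: div_eq => Q /=; rewrite -addrA; congr (_ + _); rewrite -addn1 PoszD mulrDl mul1r.
apply: RR_grow_trans IH _ => [Q|Q|] /=.
- by rewrite lerDl mulr_ge0.
- by rewrite lerDl.
have [n [Hn nP]] := RR_point (div_add D (div_scale k (div_point P))) P; exists n; split=> //.
by rewrite [div_deg (div_add _ (div_point P))]div_degD div_deg_point addrAC subrr add0r
  lez_nat.
Qed.

Lemma RR_grow_le D E : (forall P, D P <= E P) -> RR_grow D E.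
Proof.
move=> DE; have [s _ sDE] := supp (div_add E (div_scale (-1) D)).
have {}sDE P : P \notin s -> D P = E P.
  move=> Ps; apply/eqP; rewrite eq_sym -subr_eq0; apply: contraNT Ps => H.
  by apply: sDE; rewrite /= mulN1r.
elim: s D DE sDE => [|P s IH] D DE sDE.
  by rewrite (_ : D = E); [apply: RR_grow_refl|apply: div_eq => P; apply: sDE].
pose D' := div_add D (div_scale `|E P - D P|%N (div_point P)).
have D'P : D' P = E P.
  by rewrite /D' /= eqxx mulr1 gez0_abs ?subr_ge0 // addrCA subrr addr0.
have D'Q Q : Q != P -> D' Q = D Q by move=> QP; rewrite /D' /= (negbTE QP) mulr0 addr0.
have DD' Q : D Q <= D' Q by have [->|/D'Q ->] := eqVneq Q P; rewrite ?D'P.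
have D'E Q : D' Q <= E Q by have [->|/D'Q ->] := eqVneq Q P; rewrite ?D'P.
apply: (RR_grow_trans DD' D'E (RR_grow_point D P _)); apply: IH => // Q Qs.
have [->|QP] := eqVneq Q P; rewrite ?D'P // D'Q // sDE // inE negb_or QP.
exact: Qs.
Qed.

Lemma inf_mult_fin P : inf_mult P != 0 -> pord P (polyL 'X) != 0.
Proof. by rewrite /inf_mult; apply: contraNneq => ->; rewrite oppr0 maxxx. Qed.

Lemma inf_mult_ge0 P : 0 <= inf_mult P.
Proof. by rewrite /inf_mult le_max lexx. Qed.

Lemma fin_inf_mult P : fin_place P -> inf_mult P = 0.
Proof. by rewrite /fin_place /inf_mult => H; apply/max_idPl; rewrite oppr_le0. Qed.

Lemma inf_inf_mult P : ~~ fin_place P -> inf_mult P = - pord P (polyL 'X) /\ 0 < inf_mult P.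
Proof.
rewrite /fin_place -ltNge => H; have -> : inf_mult P = - pord P (polyL 'X).
  by apply/max_idPr; rewrite oppr_ge0 ltW.
by rewrite oppr_gt0.
Qed.

Section Galois.
Hypothesis galL : galois 1 {:L}.

Lemma div_infty_fin : finite_set [set P : place L | inf_mult P != 0].
Proof.
apply: sub_finite_set (finite_support_polyL galL (a := 'X) _); last by rewrite polyX_eq0.
by move=> P; apply: inf_mult_fin.
Qed.
Definition div_infty : divisor L := Divisor div_infty_fin.

Definition div_princ (a : {poly F}) (a0 : a != 0) : divisor L :=
  Divisor (finite_support_polyL galL a0).

Lemma fin_prod_gal P x : (forall s, val_ge (conj_place s P) 0 x) ->
  val_ge P 0 (galNorm 1 {:L} x).
Proof. by move=> H; apply: val_ge_prod => s _; apply: H. Qed.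

(** The norm of x is a polynomial, being without finite poles, and it vanishes at infinity; so it is
    0. *)
Lemma RR_neg x : RR_space (div_scale (-1) div_infty) x -> x = 0.
Proof.
move=> Hx; apply/eqP; rewrite -(galNorm_eq0 1 {:L}); set N := galNorm _ _ x.
have {}Hx P : val_ge P (inf_mult P) x by have := Hx P; rewrite /= mulN1r opprK.
have [c Nc] : exists c : {poly F}, N = polyL c.
  apply: base_poly; first exact: Norm_base.
  by move=> P fP; apply: fin_prod_gal => s; apply: val_ge_le (Hx _); apply: inf_mult_ge0.
have [P iP] := exists_inf_place L; rewrite Nc polyL_eq0; apply: contraT => c0.
have NP : val_ge P 1 N.
  rewrite /N /galNorm (bigD1 1%g) ?galT //= gal_id -(addr0 1); apply: val_geM.
    by apply: val_ge_le (Hx P); have [_] := inf_inf_mult iP.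
  by apply: val_ge_prod => s _; rewrite -val_ge_conj_place; apply: val_ge_le (Hx _);
    apply: inf_mult_ge0.
move: NP; rewrite Nc val_geE ?polyL_eq0 // (inf_polyL iP c0); move: iP;
  rewrite /fin_place -ltNge => iP.
have : (size c).-1%:Z * pord P (polyL 'X) <= 0 by rewrite mulr_ge0_le0 // ltW.
lia.
Qed.

(** Below D lies the divisor min(D, -(X)oo), whose space is zero by [RR_neg]; the growth from there
    to D is bounded by the degrees. *)
Lemma RR_finite D : exists n, is_qdim (RR_space D) [set 0] n.
Proof.
have fE : finite_set [set P | Num.min (D P) (- inf_mult P) != 0].
  have [s _ sD] := supp D; have [s' _ s'E] := supp div_infty.
  apply: (@finite_supp_seq _ (s ++ s')) => P; rewrite mem_cat; apply: contraNT.
  rewrite negb_or => /andP[Ps Ps'].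
  have /eqP -> : D P == 0 by apply: contraNT Ps => /sD.
  have /eqP -> : inf_mult P == 0 by apply: contraNT Ps' => /s'E.
  by rewrite oppr0 minxx.
pose E := Divisor fE; have [|n [Hn _]] := @RR_grow_le E D.
  by move=> P; rewrite /= ge_min lexx.
have E0 : is_qdim (RR_space E) [set 0] 0.
  have -> : RR_space E = [set 0]%classic.
    apply/funext => x; apply/propext; split=> [Hx|->]; last by case: (Fspace_RR E).
    apply: RR_neg => P; apply: val_ge_le (Hx P).
    by rewrite /= lerN2 mulN1r ge_min lexx orbT.
  exact/is_qdim_refl/Fspace_zero.
exists (0 + n)%N; apply: (is_qdim_add (Fspace_zero L) (Fspace_RR E) (Fspace_RR D) _ _ E0 Hn).
  by move=> x ->; case: (Fspace_RR E).
move=> x Hx P; apply: val_ge_le (Hx P).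
by rewrite /= lerN2 ge_min lexx.
Qed.

Lemma RR_dimP D : is_qdim (RR_space D) [set 0] (RR_dim D).
Proof. by have [n Hn] := RR_finite D; apply: xgetPex; exists n. Qed.

Lemma RR_mono D E : (forall P, D P <= E P) ->
  (RR_dim E)%:Z - (RR_dim D)%:Z <= div_deg E - div_deg D.
Proof.
move=> DE; have [n [Hn nd]] := RR_grow_le DE.
have H : is_qdim (RR_space E) [set 0] (RR_dim D + n).
  apply: (is_qdim_add (Fspace_zero L) (Fspace_RR D) (Fspace_RR E) _ _ (RR_dimP D) Hn).
    by move=> x ->; case: (Fspace_RR D).
  by move=> x Hx P; apply: val_ge_le (Hx P); rewrite lerN2.
by rewrite (is_qdim_uniq (Fspace_zero L) (RR_dimP E) H) PoszD addrAC subrr add0r.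
Qed.

Lemma RR_dim_mul D E u : u != 0 -> (forall P, E P = D P + pord P u) -> RR_dim E = RR_dim D.
Proof.
move=> u0 H; apply: (is_qdim_uniq (Fspace_zero L) (RR_dimP E)).
apply: (is_qdim_mul u0 _ _ (RR_dimP D)) => x; split.
- move=> Hx P; have := Hx P; rewrite H -[X in X ->
  _]/(is_true (val_ge P (- (D P + pord P u)) x)).
  by rewrite -(val_ge_mulE P _ _ u0) opprD addrNK.
- move=> Hx P; rewrite -[X in is_true X]/(val_ge P (- E P) x) H -(val_ge_mulE P _ _ u0)
  opprD addrNK.
  exact: Hx.
- by move=> ->; rewrite /= mulr0.
- by move=> /eqP; rewrite mulf_eq0 (negbTE u0) => /eqP.
Qed.

Section Genus.
Variables (g : nat) (Hg : has_genus L g).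

(* l(k (a)) does not depend on k, so k deg (a) is bounded in terms of g. *)
Lemma deg_princ (a : {poly F}) (a0 : a != 0) : div_deg (div_princ a0) = 0.
Proof.
have H (k : int) : k * div_deg (div_princ a0) - (RR_dim (div_scale 0 div_infty))%:Z + 1
  <= g%:Z.
  have [+ _] := Hg => /(_ (div_scale k (div_princ a0))); rewrite div_deg_scale.
  rewrite (@RR_dim_mul (div_scale 0 div_infty) _ (polyL a ^ k)) ?expfz_neq0 ?polyL_eq0 // => P.
  by rewrite /= mul0r add0r pordXz // polyL_eq0.
set C := g%:Z - 1 + (RR_dim (div_scale 0 div_infty))%:Z.
have {}H k : k * div_deg (div_princ a0) <= C by have := H k; rewrite /C; lia.
have C0 : 0 <= C by have := H 0; rewrite mul0r.
apply/eqP; apply: contraT; rewrite neq_lt => /orP[d|d].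
  by have := H (- (C + 1)); nia.
by have := H (C + 1); nia.
Qed.

Lemma pord_polyL_ge0 P (c : {poly F}) : c != 0 ->
  0 <= pord P (polyL c) + (size c)%:Z * inf_mult P.
Proof.
move=> c0; have [fP|iP] := boolP (fin_place P).
  by rewrite (fin_inf_mult fP) mulr0 addr0 -val_geE ?polyL_eq0 // fin_polyL.
have [E I] := inf_inf_mult iP; rewrite (inf_polyL iP c0) -[pord _ _]opprK -E mulrN addrC
  -mulrBl.
by rewrite mulr_ge0 ?inf_mult_ge0 // subr_ge0 lez_nat leq_pred.
Qed.

(* A polynomial with zeros of order k at the finite places of s. *)
Lemma cofinal (s : seq (place L)) (k : nat) : exists (c : {poly F}) (M : nat), c != 0 /\
  forall m : nat, (M <= m)%N -> (forall P, 0 <= pord P (polyL c) + m%:Z * inf_mult P) /\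
  (forall P, P \in s -> k%:Z <= pord P (polyL c) + m%:Z * inf_mult P).
Proof.
elim: s => [|Q s [c [M [c0 H]]]].
  exists 1, 0%N; rewrite oner_eq0; split=> // m _; split=> // P.
  by rewrite rmorph1 pord1 add0r mulr_ge0 ?inf_mult_ge0.
have [fQ|iQ] := boolP (fin_place Q); last first.
  have [_ I] := inf_inf_mult iQ.
  exists c, (M + k)%N; split=> // m Mm.
  have [H1 H2] := H (m - k)%N ltac:(lia).
  have E P : m%:Z * inf_mult P = (m - k)%N%:Z * inf_mult P + k%:Z * inf_mult P.
    by rewrite -mulrDl -PoszD subnK //; lia.
  have kP P : 0 <= k%:Z * inf_mult P by rewrite mulr_ge0 ?inf_mult_ge0.
  split=> P; first by rewrite E addrA addr_ge0.
  rewrite inE E addrA => /orP[/eqP ->|/H2 h].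
    by rewrite -[X in X <= _]add0r lerD // ler_peMr // -gtz0_ge1.
  by rewrite -[X in X <= _]addr0 lerD.
have [p [p0 Qp _ _]] := base_prime_exists fQ.
have pk0 : p ^+ k != 0 by rewrite expf_neq0.
exists (c * p ^+ k), (M + size (p ^+ k)%R)%N; split; first by rewrite mulf_neq0.
move=> m Mm; have [H1 H2] := H (m - size (p ^+ k)%R)%N ltac:(lia).
have E P : pord P (polyL (c * p ^+ k)) + m%:Z * inf_mult P =
   (pord P (polyL c) + (m - size (p ^+ k)%R)%N%:Z * inf_mult P) +
   (pord P (polyL (p ^+ k)) + (size (p ^+ k)%R)%:Z * inf_mult P).
  rewrite rmorphM /= pordM ?polyL_eq0 // addrACA -mulrDl -PoszD subnK //.
  exact: leq_trans (leq_addl _ _) Mm.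
have kP P := pord_polyL_ge0 P pk0.
split=> P; first by rewrite E addr_ge0.
rewrite inE E => /orP[/eqP ->|/H2 h]; last by rewrite -[X in X <= _]addr0 lerD.
rewrite -[X in X <= _]add0r lerD // (fin_inf_mult fQ) mulr0 addr0 rmorphXn /= pordX
  ?polyL_eq0 //.
by rewrite ler_peMr // -gtz0_ge1.
Qed.

(* D + M (X)oo is linearly equivalent to a divisor above one that realizes g. *)
Lemma RR_asym D : exists M : nat, forall m : nat, (M <= m)%N ->
  (RR_dim (div_add D (div_scale m div_infty)))%:Z = div_deg D + m%:Z * div_deg div_infty
    + 1 - g%:Z.
Proof.
have [Hmax [D0 HD0]] := Hg.
have [s us sD] := supp (div_add D0 (div_scale (-1) D)).
pose k := (\sum_(P <- s) `|D0 P - D P|)%N.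
have [c [M [c0 H]]] := cofinal s k; exists M => m Mm; have [H1 H2] := H m Mm.
pose E := div_add D (div_scale m div_infty); pose E' := div_add E (div_princ c0).
have D0E' P : D0 P <= E' P.
  rewrite /E' /E /= -addrA [X in _ + X]addrC.
  have [Ps|Ps] := boolP (P \in s); last first.
    have : div_add D0 (div_scale (-1) D) P == 0 by apply: contraNT Ps => /sD.
    by rewrite /= mulN1r subr_eq0 => /eqP ->; rewrite lerDl.
  rewrite -lerBlDl; apply: le_trans (H2 P Ps).
  apply: le_trans (lez_abs _) _; rewrite /k (big_rem P) //= lez_nat leq_addr.
  by [].
(* Since deg - l does not decrease when a divisor grows, E' reaches at least the value g - 1 of D0;
   the definition of the genus gives the converse bound. *)
have := RR_mono D0E'; rewrite (@RR_dim_mul E E' (polyL c)) ?polyL_eq0 // /E' div_degD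
  deg_princ addr0.
have := Hmax E; rewrite -/E -HD0 {2 4}/E div_degD div_deg_scale -/E; lia.
Qed.

End Genus.
End Galois.
End RiemannRoch.

(** * Reduced bases and trace duality *)

Section Lattice.

Lemma max_index (I : finType) (p : pred I) (f : I -> int) i0 : p i0 ->
  exists2 i, p i & forall j, p j -> f j <= f i.
Proof. by move=> pi0; case: (arg_maxP f pi0) => i pi H; exists i => // j pj; exact: H. Qed.

Variables (F : fieldType) (L : splittingFieldType {fraction {poly F}}).
Local Notation scal := (@Defs.cst F L).
Local Notation polyL := (@polyL F L).
Implicit Types (P Q : place L) (D E : divisor L) (x y u a : L).

(* The degree in X of the base element a; it is junk at other elements. *)
Lemma degX_exists a : exists k : int, a \in 1%VS -> a != 0 ->
  forall P, ~~ fin_place P -> pord P a = - k * inf_mult P.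
Proof.
have [aB|] := boolP (a \in 1%VS); last by exists 0.
have [n [d [d0 aE]]] := base_frac aB.
exists ((size n).-1%:Z - (size d).-1%:Z) => _ a0 P iP.
have n0 : n != 0 by apply: contraNneq a0 => n0; rewrite aE n0 rmorph0 mul0r.
have [E _] := inf_inf_mult iP.
rewrite aE pordM ?invr_eq0 ?polyL_eq0 // pordV ?polyL_eq0 // (inf_polyL iP n0) (inf_polyL
  iP d0) E.
by rewrite -mulrBl mulNr mulrN opprK.
Qed.

Definition degX : L -> int := projT1 (choice degX_exists).

Lemma degXE P a : ~~ fin_place P -> a \in 1%VS -> a != 0 -> pord P a = - degX a * inf_mult P.
Proof. by move=> iP aB a0; rewrite /degX; case: choice => f /= H; apply: H. Qed.

Lemma degX_uniq P a (k : int) : ~~ fin_place P -> a \in 1%VS -> a != 0 ->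
  pord P a = - k * inf_mult P -> degX a = k.
Proof.
move=> iP aB a0; rewrite (degXE iP aB a0) => H; have [_ I] := inf_inf_mult iP.
by apply: oppr_inj; apply: (mulIf _ H); rewrite gt_eqF.
Qed.

Lemma degX_polyL (c : {poly F}) : c != 0 -> degX (polyL c) = (size c).-1%:Z.
Proof.
move=> c0; have [P iP] := exists_inf_place L; have [E _] := inf_inf_mult iP.
apply: (degX_uniq iP); rewrite ?polyL_base ?polyL_eq0 // (inf_polyL iP c0) E.
by rewrite mulNr mulrN opprK.
Qed.

Lemma degXM a b : a \in 1%VS -> b \in 1%VS -> a != 0 -> b != 0 ->
  degX (a * b) = degX a + degX b.
Proof.
move=> aB bB a0 b0; have [P iP] := exists_inf_place L.
apply: (degX_uniq iP); rewrite ?mulf_neq0 ?rpredM //.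
by rewrite pordM // (degXE iP aB a0) (degXE iP bB b0) opprD mulrDl.
Qed.

Lemma rpred1z a (k : int) : a \in 1%VS -> a ^ k \in (1%AS : {subfield L}).
Proof.
by move=> aB; case: k => n; rewrite ?NegzE -?exprnN ?rpredV -?exprnP rpredX.
Qed.

Lemma degX_expz (k : int) : degX (polyL 'X ^ k) = k.
Proof.
have [P iP] := exists_inf_place L; have [E _] := inf_inf_mult iP.
apply: (degX_uniq iP); rewrite ?expfz_neq0 ?polyLX0 ?rpred1z ?polyL_base //.
by rewrite pordXz ?polyLX0 // E mulNr mulrN opprK.
Qed.

Definition degX_le a (k : int) := (a == 0) || (degX a <= k).

Lemma degX_le_val_ge P a k : ~~ fin_place P -> a \in 1%VS ->
  degX_le a k = val_ge P (- k * inf_mult P) a.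
Proof.
move=> iP aB; rewrite /degX_le; have [->|a0] := eqVneq a 0; first by rewrite val_ge0.
have [_ I] := inf_inf_mult iP.
by rewrite val_geE // (degXE iP aB a0) !mulNr lerN2 ler_pM2r.
Qed.

Lemma degX_leB a b k : a \in 1%VS -> b \in 1%VS -> degX_le a k -> degX_le b k ->
  degX_le (a - b) k.
Proof.
move=> aB bB; have [P iP] := exists_inf_place L.
by rewrite !(degX_le_val_ge _ iP) ?rpredB //; apply: val_geB.
Qed.

Lemma degX_le_le a j k : j <= k -> degX_le a j -> degX_le a k.
Proof. by move=> jk /orP[h|h]; rewrite /degX_le ?h // (le_trans h jk) orbT. Qed.

Lemma degX_le_polyL_neg (c : {poly F}) : degX_le (polyL c) (-1) -> c = 0.
Proof.
by move=> h; apply/eqP; apply: contraTT h => c0;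
  rewrite /degX_le polyL_eq0 (negbTE c0) /= degX_polyL.
Qed.

Lemma degX_le_polyL (c : {poly F}) (k : nat) : degX_le (polyL c) k%:Z = (size c <= k.+1)%N.
Proof.
rewrite /degX_le polyL_eq0; have [->|c0] := eqVneq c 0; first by rewrite size_poly0.
by rewrite degX_polyL // lez_nat; case: (size c).
Qed.

Lemma poly_part a : a \in 1%VS -> exists (c : {poly F}) (f : L),
  [/\ a = polyL c + f, f \in 1%VS & degX_le f (-1)].
Proof.
move=> aB; have [n [d [d0 aE]]] := base_frac aB.
exists (n %/ d), (polyL (n %% d) / polyL d); split.
- by rewrite {1}aE {1}(divp_eq n d) rmorphD rmorphM /=; field; rewrite polyL_eq0.
- by apply: rpred_div; apply: polyL_base.
rewrite /degX_le mulf_eq0 invr_eq0 !polyL_eq0 (negbTE d0) orbF.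
have [//|r0] := eqVneq (n %% d) 0.
have E : degX (polyL (n %% d) / polyL d) = (size (n %% d)%R).-1%:Z - (size d).-1%:Z.
  apply/eqP; rewrite -subr_eq opprK eq_sym -(degX_polyL r0) -(degX_polyL d0) -degXM
    ?polyL_base ?polyL_eq0 //.
  - by rewrite divfK // polyL_eq0.
  - by apply: rpred_div; apply: polyL_base.
  - by rewrite mulf_neq0 ?invr_eq0 ?polyL_eq0.
rewrite E /=; have : (size (n %% d)%R < size d)%N by rewrite ltn_modp.
have : (0 < size (n %% d)%R)%N by rewrite size_poly_gt0.
by move: (size (n %% d)%R) (size d) => i j ? ?; lia.
Qed.

(** The integral closure of F[X] in [L]. *)
Definition aff_int x := forall P, fin_place P -> val_ge P 0 x.
Definition inf_le (m : int) x := forall P, ~~ fin_place P -> val_ge P (- m * inf_mult P) x.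

Lemma aff_intB x y : aff_int x -> aff_int y -> aff_int (x - y).
Proof. by move=> Vx Vy P fP; apply: val_geB; [apply: Vx|apply: Vy]. Qed.
Lemma aff_int_polyL c x : aff_int x -> aff_int (polyL c * x).
Proof. by move=> Vx P fP; rewrite -(addr0 0); apply: val_geM;
  [apply: fin_polyL|apply: Vx]. Qed.
Lemma aff_int_sum (I : Type) (r : seq I) (p : pred I) (f : I -> L) :
  (forall i, p i -> aff_int (f i)) -> aff_int (\sum_(i <- r | p i) f i).
Proof. by move=> H P fP; apply: val_ge_sum => i pi; apply: H. Qed.
Lemma inf_le0 m : inf_le m 0. Proof. by move=> P _; apply: val_ge0. Qed.
Lemma inf_leB m x y : inf_le m x -> inf_le m y -> inf_le m (x - y).
Proof. by move=> Vx Vy P fP; apply: val_geB; [apply: Vx|apply: Vy]. Qed.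
Lemma inf_le_sum m (I : Type) (r : seq I) (p : pred I) (f : I -> L) :
  (forall i, p i -> inf_le m (f i)) -> inf_le m (\sum_(i <- r | p i) f i).
Proof. by move=> H P fP; apply: val_ge_sum => i pi; apply: H. Qed.
Lemma inf_le_le m k x : m <= k -> inf_le m x -> inf_le k x.
Proof.
move=> mk Nx P iP; apply: val_ge_le (Nx P iP).
by rewrite !mulNr lerN2 ler_wpM2r ?inf_mult_ge0.
Qed.
Lemma inf_le_mul m x a k : a \in 1%VS -> degX_le a k -> inf_le m x -> inf_le (m + k) (a * x).
Proof.
move=> aB /orP[/eqP ->|dk] Nx; first by rewrite mul0r; apply: inf_le0.
have [->|a0] := eqVneq a 0; first by rewrite mul0r; apply: inf_le0.
apply: (@inf_le_le (m + degX a)); first by rewrite lerD2l.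
move=> P iP; rewrite addrC opprD mulrDl -(degXE iP aB a0).
by apply: val_geM; [apply: val_ge_pord|apply: Nx].
Qed.

Section Galois.
Hypothesis galL : galois 1 {:L}.

Lemma RR_div_infty (m : nat) x : RR_space (div_scale m (div_infty galL)) x <-> aff_int x
  /\ inf_le m x.
Proof.
split=> [H|[Vx Nx] P].
  split=> P fP; have := H P; last by rewrite /= -mulNr.
  by rewrite /= (fin_inf_mult fP) mulr0 oppr0.
rewrite -[X in is_true X]/(val_ge P (- (m%:Z * inf_mult P)) x).
have [fP|iP] := boolP (fin_place P); last by rewrite -mulNr; apply: Nx.
by rewrite (fin_inf_mult fP) mulr0 oppr0; apply: Vx.
Qed.

Lemma aff_intN_neg x k : k < 0 -> aff_int x -> inf_le k x -> x = 0.
Proof.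
move=> k0 Vx Nx; apply: (@RR_neg _ _ galL) => P.
rewrite -[X in is_true X]/(val_ge P (- (-1 * inf_mult P)) x) mulN1r opprK.
have [fP|iP] := boolP (fin_place P); first by rewrite (fin_inf_mult fP); apply: Vx.
apply: val_ge_le (Nx P iP); rewrite ler_peMl ?inf_mult_ge0 //; lia.
Qed.

Local Notation n := (\dim {:L}).
Definition lincomb (w a : 'I_n -> L) : L := \sum_i a i * w i.
Definition base_coefs (a : 'I_n -> L) := forall i, a i \in 1%VS.
Definition basis (w : 'I_n -> L) :=
  (forall x, exists2 a : 'I_n -> L, base_coefs a & x = lincomb w a) /\
  (forall a : 'I_n -> L, base_coefs a -> lincomb w a = 0 -> forall i, a i = 0).
(** Only a basis over F(X) is asked for; minimality of the sum of the m_i will make it a basis of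
    the integral closure over F[X]. *)
Definition lattice_basis (w : 'I_n -> L) (m : 'I_n -> nat) :=
  basis w /\ forall i, aff_int (w i) /\ inf_le (m i) (w i).

Lemma basis_exists : exists w, basis w.
Proof.
have fX := basis_free (vbasisP {:L}).
exists (fun i => (vbasis {:L})`_i); split=> [x|a aB a0 i].
  exists (fun i => (coord (vbasis {:L}) i x)%:A).
    by move=> i; rewrite rpredZ // mem1v.
  rewrite {1}(coord_vbasis (memvf x)); apply: eq_bigr => i _.
  by rewrite -scalerAl mul1r.
have /choice[k Hk] : forall i, exists k : {fraction {poly F}}, a i = k%:A.
  by move=> j; have /vlineP[k ->] := aB j; exists k.
rewrite Hk; move/freeP: fX => ->; first by rewrite scale0r.
by rewrite -[RHS]a0; apply: eq_bigr => j _; rewrite Hk -scalerAl mul1r.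
Qed.

Lemma lincombD w (a b : 'I_n -> L) : lincomb w (fun i =>
  a i + b i) = lincomb w a + lincomb w b.
Proof. by rewrite -big_split; apply: eq_bigr => i _; rewrite mulrDl. Qed.

Lemma lincombZ w (a : 'I_n -> L) b : lincomb w (fun i => b * a i) = b * lincomb w a.
Proof. by rewrite mulr_sumr; apply: eq_bigr => i _; rewrite mulrA. Qed.

(** The monomials X^j w_i with j < k_i form the basis. *)
Lemma is_qdim_graded (w : 'I_n -> L) (k : 'I_n -> nat) (W : set L) :
  (forall c : 'I_n -> {poly F}, lincomb w (fun i => polyL (c i)) = 0 -> forall i, c i = 0) ->
  (forall x, W x <-> exists c : 'I_n -> {poly F},
     (forall i, size (c i) <= k i)%N /\ x = lincomb w (fun i => polyL (c i))) ->
  is_qdim W [set 0] (\sum_i k i)%N.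
Proof.
move=> iw HW; pose T_ i : finType := 'I_(k i); pose J := {i : 'I_n & T_ i}.
have -> : (\sum_i k i)%N = #|{: J}|.
  by rewrite card_tagged sumnE big_map big_enum; apply: eq_bigr => i _; rewrite card_ord.
pose b (p : J) := polyL 'X^(tagged p) * w (tag p).
have E (c : J -> F) : Fcomb b c = lincomb w (fun i =>
    Fcomb (fun j : 'I_(k i) => polyL 'X^j) (fun j => c (Tagged T_ j))).
  rewrite /lincomb /Fcomb; under [RHS]eq_bigr do rewrite mulr_suml.
  by rewrite sig_big_dep /=; apply: eq_bigr => -[i j] _; rewrite mulrA.
apply: (is_qdim_fin (b := b)).
- move=> [i j]; apply/HW; exists (fun l => if l == i then 'X^j else 0); split=> [l|].
    by case: eqP => [->|_]; rewrite ?size_polyXn ?size_poly0 //; apply: ltn_ord.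
  rewrite /lincomb (bigD1 i) //= eqxx big1 ?addr0 // => l li.
  by rewrite (negbTE li) rmorph0 mul0r.
- move=> x /HW[c [sc ->]].
  exists (fun p : J => (c (tag p))`_(tagged p : 'I_(k (tag p)))).
  rewrite E -sumrB big1 // => i _.
  by rewrite (@Fcomb_polyL _ _ (k i) (c i)) ?subrr.
- move=> c; rewrite E => H [i j].
  pose r i := \poly_(l < k i) oapp (fun l => c (Tagged T_ l)) 0 (insub l : option 'I_(k i)).
  have /(_ i) : forall i, r i = 0.
    apply: iw; rewrite -[RHS]H; apply: eq_bigr => l _; congr (_ * _).
    rewrite (@Fcomb_polyL _ _ (k l)) ?size_poly //.
    by apply: eq_bigr => a _; rewrite coef_poly ltn_ord valK.
  by move/(congr1 (fun p : {poly F} => p`_j)); rewrite coef_poly ltn_ord valK coef0.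
Qed.

Lemma basis_scale w c : c != 0 -> c \in 1%VS -> basis w -> basis (fun i => c * w i).
Proof.
move=> c0 cB [sw iw]; have E (a : 'I_n -> L) : lincomb (fun i =>
  c * w i) a = lincomb w (fun i => c * a i).
  by apply: eq_bigr => i _; rewrite mulrCA mulrA.
split=> [x|a aB]; last first.
  rewrite E => /iw H i; have /eqP : c * a i = 0.
    by apply: H => j; apply: rpredM.
  by rewrite mulf_eq0 (negbTE c0) => /eqP.
have [a aB ->] := sw x; exists (fun i => c^-1 * a i).
  by move=> i; rewrite rpredM // rpredV.
by rewrite E; apply: eq_bigr => i _; rewrite mulVKf.
Qed.

Lemma common_denominator (w : 'I_n -> L) : exists2 c : {poly F}, c != 0 &
  forall i, aff_int (polyL c * w i).
Proof.
have /choice[d Hd] : forall i, exists c : {poly F}, c != 0 /\ aff_int (polyL c * w i).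
  by move=> i; have [c c0 H] := denominator (w i); exists c.
exists (\prod_i d i); first by apply/prodf_neq0 => i _; case: (Hd i).
move=> i; rewrite (bigD1 i) //= rmorphM /= mulrAC mulrC; apply: aff_int_polyL.
by case: (Hd i).
Qed.

(** The places at infinity form a single orbit, so a bound over the conjugates of x at one of them
    is enough. *)
Lemma inf_le_exists x : exists m : nat, inf_le m x.
Proof.
have [P iP] := exists_inf_place L; exists (\sum_(s : gal_of {:L}) `|pord P (s x)|)%N => Q iQ.
have /conj_orbitP[s ->] := inf_conj galL iP iQ.
have iPs : ~~ fin_place (conj_place s P) by rewrite fin_conj_place.
have [_ I] := inf_inf_mult iPs.
have [->|x0] := eqVneq x 0; first exact: val_ge0.
rewrite val_geE // pord_conj_place (bigD1 s) //=.
move: (\sum_(_ | _) _)%N (pord P (s x)) I => k v; rewrite gtz0_ge1 => I.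
apply: (@le_trans _ _ (- (`|v|%N + k)%N%:Z)); last by lia.
by rewrite mulNr lerN2 ler_peMr.
Qed.

Lemma lattice_basis_exists : exists w m, lattice_basis w m.
Proof.
have [w0 Bw0] := basis_exists; have [c c0 Vc] := common_denominator w0.
have /choice[m Hm] : forall i, exists m : nat, inf_le m (polyL c * w0 i) by move=> i;
  apply: inf_le_exists.
exists (fun i => polyL c * w0 i), m; split; first by apply: basis_scale;
  rewrite ?polyL_eq0 ?polyL_base.
by move=> i; split.
Qed.

Definition reduced w m := lattice_basis w m /\
  forall w' m', lattice_basis w' m' -> (\sum_i m i <= \sum_i m' i)%N.

Lemma reduced_exists : exists w m, reduced w m.
Proof.
pose p k := `[< exists w m, lattice_basis w m /\ (\sum_i m i = k)%N >].
have [|k /asboolP[w [m [Bw mk]]] kmin] := @ex_minnP p.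
  have [w [m Bw]] := lattice_basis_exists; exists (\sum_i m i)%N; apply/asboolP.
  by exists w, m.
exists w, m; split=> // w' m' Bw'; rewrite mk; apply: kmin.
by apply/asboolP; exists w', m'.
Qed.

Section Reduced.
Variables (w : 'I_n -> L) (m : 'I_n -> nat) (Rw : reduced w m).

(* The exchange of w i for lincomb w b cannot lower the sum of the pole orders. *)
Lemma reduced_replace (b : 'I_n -> L) i (k : int) : base_coefs b -> b i != 0 ->
  aff_int (lincomb w b) ->
  inf_le k (lincomb w b) -> (m i)%:Z <= k.
Proof.
move=> bB bi0 Vu Nu; have [[[sw iw] Hw] Hmin] := Rw.
rewrite leNgt; apply/negP => km.
(* The orders m are natural numbers, so k must be nonnegative to replace m_i; a negative k would
   force the combination to be 0. *)
have k0 : 0 <= k.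
  rewrite leNgt; apply/negP => k0; case/eqP: bi0.
  by apply: (iw b bB); apply: aff_intN_neg k0 Vu Nu.
pose w' j := if j == i then lincomb w b else w j.
pose m' j := if j == i then `|k|%N else m j.
have E (a : 'I_n -> L) : lincomb w' a = lincomb w (fun j =>
  a i * b j + (if j == i then 0 else a j)).
  rewrite lincombD lincombZ /lincomb (bigD1 i) //= {1}/w' eqxx; congr (_ + _).
  rewrite [RHS](bigD1 i) //= eqxx mul0r add0r; apply: eq_bigr => j ji.
  by rewrite /w' (negbTE ji).
have : lattice_basis w' m'.
  split; last first.
    move=> j; rewrite /w' /m'; case: eqP => // _; split=> //.
    by rewrite gez0_abs.
  split=> [x|a aB].
    have [a aB ->] := sw x.
    exists (fun j => if j == i then a i / b i else a j - a i / b i * b j).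
      move=> j; case: ifP => _; first by apply: rpred_div; [apply: aB|apply: bB].
      by rewrite rpredB ?aB // rpredM ?bB // rpred_div ?aB ?bB.
    rewrite E; apply: eq_bigr => j _; rewrite eqxx; congr (_ * _).
    case: eqP => [->|_]; first by rewrite addr0 divfK.
    by rewrite addrC subrK.
  rewrite E => /iw H j.
  have {}H l : a i * b l + (if l == i then 0 else a l) = 0.
    apply: H => {}l; rewrite rpredD ?rpredM ?aB ?bB //.
    by case: ifP => _; rewrite ?aB // rpred0.
  have ai : a i = 0.
    by have := H i; rewrite eqxx addr0 => /eqP; rewrite mulf_eq0 (negbTE bi0) orbF => /eqP.
  by have := H j; rewrite ai mul0r add0r; case: eqP => [->|].
move/Hmin; rewrite (bigD1 i) //= [X in (_ <= X)%N](bigD1 i) //= {1}/m' eqxx.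
rewrite [X in (_ <= _ + X)%N](eq_bigr m) => [|j ji]; last by rewrite /m' (negbTE ji).
by rewrite leq_add2r; lia.
Qed.

Lemma lincomb_sub (a b : 'I_n -> L) : lincomb w (fun i =>
  a i - b i) = lincomb w a - lincomb w b.
Proof. by rewrite -sumrB; apply: eq_bigr => i _; rewrite mulrBl. Qed.

Lemma reduced_inf_le_term i a k : a \in 1%VS -> degX_le a k -> inf_le ((m i)%:Z + k) (a * w i).
Proof. by move=> aB dk; apply: inf_le_mul => //; have [[_ H] _] := Rw; case: (H i). Qed.

Lemma aff_int_lincomb (c : 'I_n -> {poly F}) : aff_int (lincomb w (fun i => polyL (c i))).
Proof. by apply: aff_int_sum => i _; apply: aff_int_polyL; have [[_ H] _] :=
  Rw; case: (H i). Qed.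

(** Subtracting the polynomial parts leaves a combination with coefficients of negative degree,
    still without finite poles. It could replace, among the w_j with nonzero coefficient, one of
    largest m_j, with order at most m_j - 1. *)
Lemma reduced_aff_int (a : 'I_n -> L) : base_coefs a -> aff_int (lincomb w a) ->
  forall i, exists c : {poly F}, a i = polyL c.
Proof.
move=> aB Va; have /choice[cf Hcf] : forall i, exists cf : {poly F} * L,
    [/\ a i = polyL cf.1 + cf.2, cf.2 \in 1%VS & degX_le cf.2 (-1)].
  by move=> i; have [c [f H]] := poly_part (aB i); exists (c, f).
pose f i := (cf i).2; have fB : base_coefs f by move=> i; case: (Hcf i).
have Vf : aff_int (lincomb w f).
  have -> : lincomb w f = lincomb w a - lincomb w (fun i => polyL (cf i).1).
    rewrite -lincomb_sub; apply: eq_bigr => i _; congr (_ * _).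
    by have [-> _ _] := Hcf i; rewrite addrAC subrr add0r.
  by apply: aff_intB => //; apply: aff_int_lincomb.
suff f0 i : f i = 0.
  by move=> i; exists (cf i).1; have [-> _ _] := Hcf i; rewrite -/(f i) f0 addr0.
apply/eqP; apply: contraT => fi0.
have [j fj0 jmax] := max_index (fun i => (m i)%:Z) (p := fun i => f i != 0) fi0.
suff : (m j)%:Z <= (m j)%:Z - 1 by lia.
apply: reduced_replace fB fj0 Vf _; apply: inf_le_sum => l _.
have [->|fl0] := eqVneq (f l) 0; first by rewrite mul0r; apply: inf_le0.
apply: (@inf_le_le ((m l)%:Z - 1)); first by rewrite lerD2r jmax.
by apply: reduced_inf_le_term => //; case: (Hcf l).
Qed.

(** Leading terms at infinity cannot cancel: a cancellation among the terms of largest degree d_j =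
    deg a_j + m_j would provide, after rounding the coefficients to polynomials, a replacement for
    one w_i of smaller order. *)
Lemma reduced_inf_le (a : 'I_n -> L) (k : int) : base_coefs a ->
  inf_le k (lincomb w a) -> forall i, degX_le (a i) (k - (m i)%:Z).
Proof.
move=> aB Na i0; apply: contraT; rewrite /degX_le negb_or -ltNge => /andP[ai00 di0].
pose d i := degX (a i) + (m i)%:Z.
have [i1 ai10 i1max] := max_index d (p := fun i => a i != 0) ai00.
have [|i /andP[ai0 /eqP di] imax] :=
    @max_index _ (fun i => (a i != 0) && (d i == d i1)) (fun i => (m i)%:Z) i1.
  by rewrite ai10 eqxx.
have {i1max}dmax j : a j != 0 -> d j <= d i by rewrite di; apply: i1max.
have {di imax ai10}mmax j : a j != 0 -> d j = d i -> (m j)%:Z <= (m i)%:Z.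
  by move=> aj0 dj; apply: imax; rewrite aj0 dj di eqxx.
have kd : k < d i by have := dmax i0 ai00; rewrite /d in di0 *; lia.
(* After this scaling the i-th coefficient has degree 0, so its polynomial part is a nonzero
   constant. *)
pose t : L := polyL 'X ^ ((m i)%:Z - d i).
have tB : t \in 1%VS by apply: rpred1z; apply: polyL_base.
have t0 : t != 0 by rewrite expfz_neq0 // polyLX0.
pose a' j := t * a j.
have a'B : base_coefs a' by move=> j; rewrite rpredM // aB.
have da' j : a j != 0 -> degX (a' j) = (m i)%:Z - d i + degX (a j).
  by move=> aj0; rewrite degXM // degX_expz.
have /choice[cf Hcf] : forall i, exists cf : {poly F} * L,
    [/\ a' i = polyL cf.1 + cf.2, cf.2 \in 1%VS & degX_le cf.2 (-1)].
  by move=> j; have [c [f H]] := poly_part (a'B j); exists (c, f).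
pose f j := (cf j).2; pose c j := polyL (cf j).1.
have cE j : c j = a' j - f j by have [-> _ _] := Hcf j; rewrite addrK.
have Nu : inf_le ((m i)%:Z - 1) (lincomb w c).
  have -> : lincomb w c = t * lincomb w a - lincomb w f.
    by rewrite -lincombZ -lincomb_sub; apply: eq_bigr => j _; rewrite cE.
  apply: inf_leB.
    apply: (@inf_le_le (k + ((m i)%:Z - d i))); first by lia.
    by apply: inf_le_mul => //; rewrite /degX_le degX_expz lexx orbT.
  apply: inf_le_sum => j _; have [Ej fB fd] := Hcf j.
  have [mji|mij] := lerP (m j)%:Z (m i)%:Z.
    apply: (@inf_le_le ((m j)%:Z - 1)); first by rewrite lerD2r.
    exact: reduced_inf_le_term.
  (* If m_j > m_i and a_j is nonzero, then d_j < d_i by the choice of i; so a'_j has negative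
     degree, is its own fractional part, and contributes order at most m_i - 1. *)
  have ad : degX_le (a' j) ((m i)%:Z - 1 - (m j)%:Z).
    rewrite /degX_le; have [//|a'j0] := eqVneq (a' j) 0; apply/orP; right.
    have aj0 : a j != 0 by apply: contraNneq a'j0 => z; rewrite /a' z mulr0.
    have := dmax j aj0; rewrite le_eqVlt => /orP[/eqP/(mmax j aj0)|h].
      by rewrite leNgt mij.
    by rewrite da' //; move: h; rewrite /d; clear; lia.
  have ad1 : degX_le (a' j) (-1) by apply: degX_le_le ad; move: mij; clear; lia.
  have c0 : (cf j).1 = 0.
    by apply: degX_le_polyL_neg; rewrite -/(c j) cE; apply: degX_leB.
  have -> : f j = a' j by rewrite Ej c0 rmorph0 add0r.
  have -> : (m i)%:Z - 1 = (m j)%:Z + ((m i)%:Z - 1 - (m j)%:Z) by rewrite [RHS]addrC subrK.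
  exact: reduced_inf_le_term.
suff : (m i)%:Z <= (m i)%:Z - 1 by lia.
apply: (reduced_replace _ _ _ Nu).
- by move=> j; apply: polyL_base.
- have [_ fB fd] := Hcf i; apply: contraTneq fd => ci0.
  have -> : (cf i).2 = a' i by rewrite -[LHS]add0r -ci0 cE subrK.
  rewrite /degX_le negb_or -ltNge da' // mulf_neq0 //= /d; lia.
- exact: aff_int_lincomb.
Qed.

Lemma reduced_dim (M : nat) : (forall i, m i <= M)%N ->
  is_qdim (RR_space (div_scale M (div_infty galL))) [set 0] (\sum_i (M.+1 - m i))%N.
Proof.
move=> mM; have [[[sw iw] Hw] _] := Rw.
have mE i : M%:Z - (m i)%:Z = (M - m i)%N%:Z by rewrite subzn.
apply: (is_qdim_graded (w := w)) => [c c0 i|x].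
  by apply/eqP; rewrite -(polyL_eq0 L); apply/eqP; apply: iw c0 i => j; apply: polyL_base.
rewrite RR_div_infty; split=> [[Vx Nx]|[c [sc ->]]].
  have [a aB xE] := sw x; rewrite xE in Vx Nx.
  have /choice[c Hc] := reduced_aff_int aB Vx; exists c; split; last first.
    by rewrite xE; apply: eq_bigr => i _; rewrite Hc.
  by move=> i; have := reduced_inf_le aB Nx i; rewrite Hc mE degX_le_polyL subSn.
split; first exact: aff_int_lincomb.
apply: inf_le_sum => i _; rewrite -(subrK (m i)%:Z M%:Z) addrC.
by apply: reduced_inf_le_term; [apply: polyL_base|rewrite mE degX_le_polyL -subSn].
Qed.

End Reduced.
End Galois.
End Lattice.

(** * The trace form, the different and the dual lattice *)

Section Dual.
Variables (F : fieldType) (L : splittingFieldType {fraction {poly F}}).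
Local Notation scal := (@Defs.cst F L).
Local Notation polyL := (@polyL F L).
Local Notation G := ('Gal({:L} / 1))%g.
Local Notation Tr := (galTrace 1 {:L}).
Local Notation n := (\dim {:L}).
Implicit Types (P Q : place L) (D E : divisor L) (x y u : L).
Hypothesis galL : galois 1 {:L}.
Hypothesis tame : forall n, (n %| #|G|)%N -> n%:R != 0 :> F.

Lemma TrZ a x : a \in 1%VS -> Tr (a * x) = a * Tr x.
Proof.
move=> aB; rewrite /galTrace mulr_sumr; apply: eq_bigr => s _.
by rewrite rmorphM /= gal_base.
Qed.

Lemma Tr1 : Tr 1 != 0.
Proof.
rewrite /galTrace (eq_bigr (fun=> 1)) => [|s _]; last exact: rmorph1.
by rewrite sumr_const -(rmorph_nat scal) fmorph_eq0 tame.
Qed.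

Lemma Tr_lincomb w a x : base_coefs a -> Tr (x * lincomb w a) = \sum_i a i * Tr (x * w i).
Proof.
move=> aB; rewrite /lincomb mulr_sumr raddf_sum; apply: eq_bigr => i _ /=.
by rewrite mulrCA TrZ ?aB.
Qed.

(** Otherwise the trace of x x^-1 = 1 would vanish, while it is #|G|, nonzero by tameness. *)
Lemma Tr_nondeg w x : basis w -> (forall i, Tr (x * w i) = 0) -> x = 0.
Proof.
move=> [sw _] H; apply/eqP; apply: contraT => x0; have [a aB aE] := sw x^-1.
have T0 : Tr (x * lincomb w a) = 0.
  by rewrite Tr_lincomb // big1 // => i _; rewrite H mulr0.
by move: T0 Tr1; rewrite -aE mulfV // => ->; rewrite eqxx.
Qed.

Lemma dual_exists w : basis w -> exists w', forall i j, Tr (w i * w' j) = (i == j)%:R.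
Proof.
move=> Bw; have /choice[k Hk] : forall a : L, exists k :
  {fraction {poly F}}, a \in 1%VS -> a = k%:A.
  move=> a; have [/vlineP[k ->]|] := boolP (a \in 1%VS); first by exists k.
  by exists 0.
pose T := \matrix_(i < n, j < n) k (Tr (w i * w j)).
have TE i j : Tr (w i * w j) = (T i j)%:A by rewrite mxE -Hk // Tr_base.
have TU : T \in unitmx.
  rewrite -row_free_unit -kermx_eq0; apply: contraT => /rowV0Pn[v /sub_kermxP vT].
  case/eqP; apply/rowP => i; rewrite mxE.
  have aB : base_coefs (fun i => (v 0 i)%:A : L) by move=> j; rewrite rpredZ // mem1v.
  have : lincomb w (fun i => (v 0 i)%:A) = 0.
    apply: (Tr_nondeg Bw) => j; rewrite mulrC Tr_lincomb //.
    transitivity ((\sum_i v 0 i * T i j)%:A : L).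
      rewrite scaler_suml; apply: eq_bigr => l _.
      by rewrite [w j * _]mulrC TE -scalerAl mul1r scalerA.
    have := congr1 (fun A : 'rV_ _ => A 0 j) vT; rewrite !mxE => ->.
    by rewrite scale0r.
  have [_ iw] := Bw; move/(iw _ aB)/(_ i)/eqP.
  by rewrite scaler_eq0 oner_eq0 orbF => /eqP.
exists (fun j => lincomb w (fun l => (invmx T l j)%:A)) => i j.
rewrite Tr_lincomb => [|l]; last by rewrite rpredZ // mem1v.
transitivity (((T *m invmx T) i j)%:A : L).
  rewrite mxE scaler_suml; apply: eq_bigr => l _.
  by rewrite TE -scalerAl mul1r scalerA mulrC.
by rewrite mulmxV // mxE; case: (i == j); rewrite ?scale1r ?scale0r.
Qed.

Section DualBasis.
Variables (w w' : 'I_n -> L) (m : 'I_n -> nat) (Rw : reduced w m).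
Hypothesis dw : forall i j, Tr (w i * w' j) = (i == j)%:R.

Let Bw : basis w. Proof. by case: Rw => [[]]. Qed.

Lemma dual_lincomb_Tr (b : 'I_n -> L) (i : 'I_n) : base_coefs b ->
  Tr (lincomb w' b * w i) = b i.
Proof.
move=> bB; rewrite mulrC Tr_lincomb // (bigD1 i) //= dw eqxx mulr1 big1 ?addr0 // => j ji.
by rewrite dw eq_sym (negbTE ji) mulr0.
Qed.

Lemma base_coefs_Tr y : base_coefs (fun j => Tr (y * w j)).
Proof. by move=> j; apply: Tr_base. Qed.

Lemma dual_expand y : y = lincomb w' (fun j => Tr (y * w j)).
Proof.
apply/eqP; rewrite -subr_eq0; apply/eqP/(Tr_nondeg Bw) => i.
by rewrite mulrBl raddfB /= dual_lincomb_Tr ?subrr //; apply: base_coefs_Tr.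
Qed.

Hypothesis primeG : prime #|G|.

(** Ramified finite places are zeros of a common denominator c of the dual basis. Elsewhere w' is
    integral, and 1 / t, for t a uniformizer at a ramified P, has coordinates Tr(w_j / t) integral
    at P because -1 >= 1 - e_P; then 1 / t would be integral. *)
Lemma different_fin : finite_set [set P : place L | (ram_index P)%:Z - 1 != 0].
Proof.
have [c c0 Vc] := common_denominator w'.
have [Pi iPi] := exists_inf_place L.
have [s sE] : exists s : seq (place L), forall P, pord P (polyL c) != 0 -> P \in s.
  have /finite_seqP[s sE] := finite_support_polyL galL c0; exists s => P Pc.
  by have : [set` s]%classic P by rewrite -sE.
apply: (@finite_supp_seq _ _ _ (s ++ conj_orbit Pi)) => P e1; rewrite mem_cat.
have {}e1 : (1 < ram_index P)%N by move: e1; have := ram_gt0 P; case: (ram_index P) => [|[]].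
have [fP|iP] := boolP (fin_place P); last by rewrite (inf_conj galL iPi iP) orbT.
rewrite sE //; apply/eqP => Pc.
have gP (r : gal_of {:L}) := conj_place_fix galL primeG r e1.
have [t t0 Pt] := uniformizer P.
have w'P j : val_ge P 0 (w' j).
  have := Vc j P fP; rewrite -[X in val_ge P X (_ * _)](add0r 0) -{2}Pc val_ge_mulE //.
  by rewrite polyL_eq0.
have : val_ge P 0 t^-1.
  rewrite (dual_expand t^-1); apply: val_ge_sum => j _; rewrite -(addr0 0).
  apply: val_geM => //; apply: val_ge_Tr => // r; rewrite -val_ge_conj_place gP.
  apply: (@val_ge_le _ _ _ (-1 + 0)); first by lia.
  apply: val_geM; first by rewrite val_geE ?invr_eq0 // pordV // Pt.
  by have [[_ /(_ j)[Vw _]] _] := Rw; apply: Vw.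
by rewrite val_geE ?invr_eq0 // pordV // Pt.
Qed.
Definition different : divisor L := Divisor different_fin.

Lemma val_ge_TrX P y k : ~~ fin_place P -> (forall s :
  gal_of {:L}, val_ge P (1 - (ram_index P)%:Z - k * inf_mult P) (s y)) ->
  degX_le (Tr y) k.
Proof.
move=> iP H; have XB : polyL 'X ^ (- k) \in (1%VS : {vspace L}) by apply: rpred1z;
  apply: polyL_base.
have X0 : polyL 'X ^ (- k) != 0 by rewrite expfz_neq0 // polyLX0.
have vX : pord P (polyL 'X ^ (- k)) = k * inf_mult P by rewrite (degXE iP XB X0)
  degX_expz opprK.
rewrite (degX_le_val_ge _ iP) ?Tr_base //.
have : val_ge P 0 (Tr (polyL 'X ^ (- k) * y)).
  apply: val_ge_Tr => // s; rewrite rmorphM /= gal_base //.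
  by have := H s; rewrite -(val_ge_mulE P _ _ X0) vX subrK.
by rewrite TrZ // -{1}(addNr (k * inf_mult P)) -{2}vX val_ge_mulE // mulNr.
Qed.

(** Trace duality as a statement on coordinates: the Tr(y w_j) are the coordinates of y on w'. One
    direction is [val_ge_Tr] applied to y w_j; the other is local, through [not_dual]. *)
Lemma RR_different (M : nat) y : RR_space (div_add different (div_scale M (div_infty
  galL))) y <->
  forall j, (exists c : {poly F}, Tr (y * w j) = polyL c) /\ degX_le (Tr (y * w j)) (M%:Z
    + (m j)%:Z).
Proof.
have [[_ Hw] _] := Rw.
rewrite -[RR_space _ y]/(forall P, val_ge P (- ((ram_index P)%:Z - 1 + M%:Z * inf_mult P)) y).
split=> [H j|H P].
- have [Vj Nj] := Hw j; split.
    apply: base_poly; first exact: Tr_base.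
    move=> P fP; apply: val_ge_Tr => // s.
    rewrite rmorphM /= -(addr0 (1 - _)); apply: val_geM; rewrite -val_ge_conj_place.
      have := H (conj_place s P); rewrite ram_conj_place fin_inf_mult ?fin_conj_place //
        mulr0 addr0.
      by rewrite opprB.
    by apply: Vj; rewrite fin_conj_place.
  have [P iP] := exists_inf_place L; apply: (val_ge_TrX iP) => s.
  have iPs : ~~ fin_place (conj_place s P) by rewrite fin_conj_place.
  have E : inf_mult (conj_place s P) = inf_mult P by rewrite /inf_mult pord_conj_place
    gal_base ?polyL_base.
  rewrite mulrDl opprD addrA rmorphM /=; apply: val_geM; rewrite -val_ge_conj_place.
    by have := H (conj_place s P); rewrite ram_conj_place E opprD opprB.
  by have := Nj (conj_place s P) iPs; rewrite E mulNr.
- have [fP|iP] := boolP (fin_place P).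
    rewrite fin_inf_mult // mulr0 addr0.
    apply: contraT; have [->|y0] := eqVneq y 0; first by rewrite val_ge0.
    rewrite val_geE // -ltNge => Py.
    (* Too large a pole of y at P is detected by some b integral at the conjugates of P. Multiplied
       by a polynomial c that is a unit at P, it becomes an F[X]-combination of w, whose product
       with y has integral trace. *)
    have [|b [Pb]] := not_dual galL tame y0 (P := P); first by lia.
    have [c [c0 Pc Vb]] := globalize galL fP Pb.
    have [a aB bE] := Bw.1 (polyL c * b).
    rewrite bE in Vb.
    have /choice[f Hf] := reduced_aff_int galL Rw aB Vb.
    have E : polyL c * Tr (y * b) = \sum_i a i * Tr (y * w i).
      by rewrite -TrZ ?polyL_base // mulrCA bE Tr_lincomb.
    have : val_ge P 0 (polyL c * Tr (y * b)).
      rewrite E; apply: val_ge_sum => i _; have [[d Hd] _] := H i.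
      by rewrite Hf Hd -rmorphM fin_polyL.
    by rewrite -[X in val_ge P X (_ * _)](add0r 0) -{2}Pc val_ge_mulE ?polyL_eq0 // => ->.
  apply: contraT; have [->|y0] := eqVneq y 0; first by rewrite val_ge0.
  (* The factor X^(-M) absorbs the poles allowed by M (X)oo. All places at infinity being conjugate
     to P, the detecting b satisfies [inf_le 0], so its i-th coefficient has degree at most -m_i. *)
  rewrite val_geE // -ltNge => Py; pose t : L := polyL 'X ^ (- M%:Z).
  have t0 : t != 0 by rewrite expfz_neq0 // polyLX0.
  have tB : t \in 1%VS by apply: rpred1z; apply: polyL_base.
  have vt : pord P t = M%:Z * inf_mult P by rewrite (degXE iP tB t0) degX_expz opprK.
  have [||b [Pb]] := @not_dual _ _ galL tame P (t * y).
  - by rewrite mulf_neq0.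
  - by rewrite pordM // vt; lia.
  have Nb : inf_le 0 b.
    move=> Q iQ; rewrite oppr0 mul0r; have /conj_orbitP[s ->] := inf_conj galL iP iQ.
    exact: Pb.
  have [a aB bE] := Bw.1 b; rewrite bE in Nb *.
  have Ha := reduced_inf_le galL Rw aB Nb.
  suff -> : val_ge P 0 (Tr (t * y * lincomb w a)) by [].
  rewrite -mulrA TrZ // Tr_lincomb // mulr_sumr; apply: val_ge_sum => i _.
  have [_ di] := H i; rewrite (degX_le_val_ge _ iP) ?Tr_base // in di.
  have := Ha i; rewrite (degX_le_val_ge _ iP) ?aB // sub0r opprK => ai.
  have -> : 0 = M%:Z * inf_mult P + ((m i)%:Z * inf_mult P + - (M%:Z + (m i)%:Z) *
    inf_mult P) by ring.
  apply: val_geM; first by rewrite -vt val_ge_pord.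
  exact: val_geM.
Qed.

Lemma different_dim (M : nat) :
  is_qdim (RR_space (div_add different (div_scale M (div_infty galL)))) [set 0] (\sum_i
    (M.+1 + m i))%N.
Proof.
have polyLB (c : 'I_n -> {poly F}) : base_coefs (fun i => polyL (c i)) by move=> i;
  apply: polyL_base.
apply: (is_qdim_graded (w := w')) => [c c0 i|y].
  apply/eqP; rewrite -(polyL_eq0 L) -(dual_lincomb_Tr (b := fun i => polyL (c i))) //.
  by rewrite c0 mul0r raddf0.
rewrite RR_different; split=> [Hy|[c [sc ->]] j].
  have /choice[c Hc] : forall j, exists c : {poly F}, Tr (y * w j) = polyL c.
    by move=> j; case: (Hy j).
  exists c; split; last by rewrite {1}(dual_expand y); apply: eq_bigr => i _; rewrite Hc.
  by move=> i; have [_] := Hy i; rewrite Hc -PoszD degX_le_polyL.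
rewrite dual_lincomb_Tr //; split; first by exists (c j).
by rewrite -PoszD degX_le_polyL sc.
Qed.

End DualBasis.
End Dual.

(** * Ramified places *)

Section Counting.
Local Open Scope nat_scope.

(** The map f generates a group of permutations of order dividing p, so the orbits other than fixed
    points have sizes divisible by p. *)
Lemma card_fix_iter (p : nat) (X : finType) (f : X -> X) : prime p ->
  (forall x, iter p f x = x) -> #|X| = #|[set x | f x == x]| %[mod p].
Proof.
move=> pp fp; have finj : injective f.
  move=> x y fxy; rewrite -(fp x) -(fp y); case: p pp {fp} => // p _.
  by rewrite !iterSr fxy.
pose s := perm finj.
have sp : (p.-group <[s]>)%g.
  rewrite /pgroup; apply: pnat_dvd (pnat_id pp).
  rewrite -[#|_|]/(#[s]%g) order_dvdn; apply/eqP/permP => x.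
  by rewrite permX perm1 (eq_iter (permE finj)) fp.
have sT : [acts <[s]>, on [set: X] | 'P]%g.
  by apply/fintype.subsetP => a _; apply/astabsP => x; rewrite !inE.
rewrite -cardsT (pgroup_fix_mod sp sT); congr (#|pred_of_set _| %% _).
rewrite finset.setTI afix_cycle; apply/setP => x; rewrite inE; apply/afix1P/eqP => /=.
  by rewrite /aperm permE.
by rewrite /aperm permE.
Qed.

Lemma mult_order_dvdn (p q d : nat) : prime p -> ~~ (p %| q) -> q ^ d = 1 %[mod p] ->
  mult_order p q %| d.
Proof.
move=> pp pq qd; have p1 := prime_gt1 pp.
rewrite /mult_order order_dvdn; apply/eqP/val_inj.
have qU : (q%:R : 'Z_p)%R \is a GRing.unit by rewrite unitZpE // prime_coprime.
have E (u : {unit 'Z_p}) k : val (u ^+ k)%g = (val u ^+ k)%R.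
  by elim: k => // k IH; rewrite expgS exprS /= IH.
rewrite E insubdK //= -natrX.
by rewrite -(Zp_nat_mod p1) qd (Zp_nat_mod p1).
Qed.
End Counting.

Section RamifiedDegree.
Variables (F : finFieldType) (L : splittingFieldType {fraction {poly F}}).
Local Notation scal := (@Defs.cst F L).
Local Notation G := ('Gal({:L} / 1))%g.
Local Notation Tr := (galTrace 1 {:L}).
Hypothesis galL : galois 1 {:L}.
Hypothesis tame : forall n, (n %| #|G|)%N -> n%:R != 0 :> F.
Hypothesis primeG : prime #|G|.

(* Multiplication by t identifies the residue field with P / P^2. *)
Lemma ramified_degree (P : place L) : (1 < ram_index P)%N ->
  (#|F| ^ place_deg P = 1 %[mod #|G|])%N.
Proof.
move=> e1; have gP (s : gal_of {:L}) := conj_place_fix galL primeG s e1.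
have [b [Pb sb ib]] := place_degP P; set d := place_deg P in b Pb sb ib *.
have [t t0 Pt] := uniformizer P.
have vs k (s : gal_of {:L}) x : val_ge P k (s x) = val_ge P k x by rewrite
  -val_ge_conj_place gP.
pose X := {ffun 'I_d -> F}.
pose tau (c : X) := t * Fcomb b c.
have tau1 c : val_ge P 1 (tau c).
  by rewrite -(addr0 1); apply: val_geM; [rewrite val_geE // Pt|apply: Fspace_comb
    (Fspace_val_ring P) Pb].
have tau_inj c : val_ge P 2 (tau c) -> c = 0.
  rewrite -[2]/(1 + 1) -{2}Pt val_ge_mulE // => /val_idealE/ib H.
  by apply/ffunP => i; rewrite ffunE H.
have tauB c c' : tau (c - c') = tau c - tau c'.
  rewrite /tau -mulrBr -FcombB; congr (_ * _); apply: eq_bigr => i _.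
  by rewrite !ffunE.
have tau_uniq c c' : val_ge P 2 (tau c - tau c') -> c = c'.
  by rewrite -tauB => /tau_inj/eqP; rewrite subr_eq0 => /eqP.
have tau_surj x : val_ge P 1 x -> exists c, val_ge P 2 (x - tau c).
  move=> Px; have [c Hc] : exists c : 'I_d -> F, val_ideal P (t^-1 * x - Fcomb b c).
    apply: sb; rewrite -[val_ring _ _]/(is_true (val_ge P 0 (t^-1 * x))).
    by rewrite -(subrr 1) addrC; apply: val_geM => //;
      rewrite val_geE ?invr_eq0 // pordV // Pt.
  exists [ffun i => c i]; have -> : x - tau [ffun i => c i] = t * (t^-1 * x - Fcomb b c).
    rewrite mulrBr mulVKf // /tau; congr (_ - _ * _).
    by apply: eq_bigr => i _; rewrite ffunE.
  by rewrite -[2]/(1 + 1) -{2}Pt val_ge_mulE //; apply/val_idealE.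
have /cyclicP[s sG] := prime_cyclic primeG.
(* Here f is the action of the generator s on P / P^2, transported to F^d through [tau]. *)
have /choice[f Hf] : forall c, exists c', val_ge P 2 (s (tau c) - tau c').
  by move=> c; apply: tau_surj; rewrite vs.
have Hk k c : val_ge P 2 ((s ^+ k)%g (tau c) - tau (iter k f c)).
  elim: k => [|k IH]; first by rewrite expg0 gal_id subrr val_ge0.
  rewrite expgSr galM ?memvf // iterS.
  have := val_geD (Hf (iter k f c)) (etrans (vs 2 s _) IH).
  by rewrite rmorphB /= addrC subrKA.
have fG x : iter #|G| f x = x.
  apply/esym/tau_uniq; have := Hk #|G| x.
  by rewrite sG -[#|_|]/(#[s]%g) expg_order gal_id.
have := card_fix_iter primeG fG; rewrite card_ffun card_ord => ->.
suff fix0 (c : X) : (f c == c) = (c == 0).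
  have -> // : #|[set x | f x == x]| = 1%N.
  by apply/eqP/cards1P; exists (0 : X); apply/setP => c; rewrite !inE fix0.
apply/eqP/eqP => [fc|->]; last first.
  apply/esym/tau_uniq; have := Hf 0; have -> : tau 0 = 0.
    by rewrite -(subrr (0 : X)) tauB subrr.
  by rewrite rmorph0.
apply: tau_inj; have iterc k : iter k f c = c by elim: k => //= k ->.
(* A fixed class is congruent modulo P^2 to all its conjugates, so its trace is #|G| times
   itself. *)
have H : val_ge P 2 (Tr (tau c) - tau c *+ #|G|).
  rewrite -sumr_const -sumrB; apply: val_ge_sum => r; rewrite sG => /cycleP[k ->].
  by have := Hk k c; rewrite iterc.
(* The valuation of a nonzero trace is a multiple of e_P > 1 and at least 1, hence at least 2. *)
have T2 : val_ge P 2 (Tr (tau c)).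
  have [->|T0] := eqVneq (Tr (tau c)) 0; first exact: val_ge0.
  have : val_ge P 1 (Tr (tau c)) by apply: val_ge_sum => r _; rewrite vs.
  have /dvdzP[k] := ram_dvd P (Tr_base galL (tau c)) T0.
  rewrite !val_geE // => ->; move: (ram_index P) e1 => e e1 ke.
  have : 0 < k by have := lt_le_trans ltr01 ke; rewrite pmulr_lgt0 // ltz_nat ltnW.
  rewrite gtz0_ge1 => k1; apply: le_trans (_ : e%:Z <= _); first by rewrite lez_nat.
  by rewrite ler_peMl.
have gF := tame (dvdnn _).
have sc0 : scal (#|G|)%:R != 0 by rewrite fmorph_eq0.
have E : tau c *+ #|G| = scal (#|G|)%:R * tau c by rewrite rmorph_nat mulr_natl.
by have := val_geB T2 H; rewrite subKr E -[X in val_ge P X _]addr0 -(pord_cst P gF)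
  val_ge_mulE.
Qed.

End RamifiedDegree.

(** * The Riemann-Hurwitz formula *)

Section RiemannHurwitz.
Variables (F : fieldType) (L : splittingFieldType {fraction {poly F}}).
Local Notation G := ('Gal({:L} / 1))%g.
Hypothesis galL : galois 1 {:L}.
Hypothesis tame : forall n, (n %| #|G|)%N -> n%:R != 0 :> F.
Hypothesis primeG : prime #|G|.

Lemma Riemann_Hurwitz (g : nat) : has_genus L g -> exists2 D : divisor L,
  forall P, D P = (ram_index P)%:Z - 1 & div_deg D = 2 * g%:Z - 2 + 2 * #|G|%:Z.
Proof.
move=> Hg; have [w [m Rw]] := reduced_exists galL.
have [w' dw] := dual_exists galL tame Rw.1.1.
pose D := different galL tame Rw dw primeG; exists D => //.
have dimG : \dim {:L} = #|G|.
  by have := galois_dim galL; rewrite dimv1 divn1.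
pose D0 := div_scale 0 (div_infty galL).
have [M1 H1] := RR_asym galL Hg D0; have [M2 H2] := RR_asym galL Hg D.
have D0M M : div_add D0 (div_scale M%:Z (div_infty galL)) = div_scale M%:Z (div_infty galL).
  by apply: div_eq => P /=; rewrite mul0r add0r.
pose M0 := (M1 + M2 + \sum_i m i)%N.
have E (M : nat) : (M0 <= M)%N ->
    2 * (M%:Z * div_deg (div_infty galL)) + div_deg D + 2 - 2 * g%:Z = 2 * #|G|%:Z *
      (M%:Z + 1).
  move=> M0M; have mM i : (m i <= M)%N.
    by apply: leq_trans M0M; rewrite /M0 (bigD1 i) //=; lia.
  have := H1 M; rewrite D0M => /(_ ltac:(lia)).
  rewrite (is_qdim_uniq (Fspace_zero L) (RR_dimP galL _) (reduced_dim galL Rw mM)).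
  have := H2 M ltac:(lia).
  rewrite (is_qdim_uniq (Fspace_zero L) (RR_dimP galL _) (different_dim galL tame Rw dw
    primeG M)).
  have : (\sum_i (M.+1 - m i) + \sum_i (M.+1 + m i) = 2 * #|G| * M.+1)%N.
    rewrite -big_split /= (eq_bigr (fun=> (2 * M.+1)%N)).
      by rewrite sum_nat_const card_ord dimG mulnCA mulnA.
    by move=> i _; have := mM i; lia.
  rewrite div_deg_scale mul0r; lia.
(* The identity is affine in M. Comparing two consecutive values gives deg (X)oo = #|G|, and the
   constant term then gives deg Diff. *)
have := E M0 (leqnn _); have := E M0.+1 (leqnSn _).
move: (div_deg D) (div_deg (div_infty galL)) => d e; nia.
Qed.

End RiemannHurwitz.

Section Ramification.
Variables (F : finFieldType) (L : splittingFieldType {fraction {poly F}}).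
Local Notation G := ('Gal({:L} / 1))%g.
Hypothesis galL : galois 1 {:L}.
Hypothesis primeG : prime #|G|.
Hypothesis tameG : ~~ (#|G| %| #|F|)%N.

(** A divisor of the prime #|G| is 1 or #|G|; were #|G| zero in F it would be the characteristic,
    which divides #|F|. *)
Lemma tame_natr_neq0 n : (n %| #|G|)%N -> n%:R != 0 :> F.
Proof.
case/primeP: (primeG) => _ H /H /orP[/eqP ->|/eqP ->]; first exact: oner_neq0.
apply: contra tameG => G0; have GF : #|G| \in [pchar F] by rewrite inE /= primeG.
rewrite (dvdn_pcharf GF); apply/eqP.
by rewrite -cardsT -FinRing.zmodXgE expg_cardG // inE.
Qed.

Lemma dvd_deg_different (D : divisor L) : (forall P, D P = (ram_index P)%:Z - 1) ->
  (((#|G| - 1) * mult_order #|G| #|F|)%N%:Z %| div_deg D)%Z.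
Proof.
move=> DE; have [s us sD] := supp D.
rewrite (div_degE us sD); elim/big_ind: _ => [|a b Ha Hb|P _]; first exact: dvdz0.
  exact: rpredD.
rewrite DE; have [e1|e1] := leqP (ram_index P) 1.
  have -> : ram_index P = 1%N by apply/eqP; rewrite eqn_leq e1 ram_gt0.
  by rewrite subrr mul0r dvdz0.
rewrite (ram_prime galL primeG e1) PoszM -subzn ?prime_gt0 //.
rewrite dvdz_mul // dvdzE /=; apply: mult_order_dvdn => //.
exact: (ramified_degree galL tame_natr_neq0 primeG e1).
Qed.

Lemma dvd_genus (g : nat) : has_genus L g ->
  ((#|G| - 1) * mult_order #|G| #|F| %| 2 * g + 2 * #|G| - 2)%N.
Proof.
move=> Hg; have [D DE degD] := Riemann_Hurwitz galL tame_natr_neq0 primeG Hg.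
have := dvd_deg_different DE; have -> : div_deg D = (2 * g + 2 * #|G| - 2)%N%:Z.
  by rewrite degD; move: #|G| (prime_gt1 primeG) => e e1; lia.
by rewrite dvdzE.
Qed.

End Ramification.

End CyclicCover.

Theorem proposition3p2 (F : finFieldType) (q ell g : nat) (hq : #|F| = q)
    (hell : prime ell) (hndvd : ~~ (ell %| q)) (hnq : 1 < mult_order ell q)
    (hg : 2 * g + 2 * ell - 2 != 0 %[mod (ell - 1) * mult_order ell q])
    (L : splittingFieldType {fraction {poly F}}) :
  ~ in_H ell g L.
Proof.
move=> [galL iso _ Hg].
have cardG : #|'Gal({:L} / 1)%g| = ell.
  by rewrite (card_isog iso) card_Zp // prime_gt0.
have primeG : prime #|'Gal({:L} / 1)%g| by rewrite cardG.
rewrite -hq in hndvd hg *; rewrite -cardG in hndvd hg *.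
by case/negP: hg; rewrite mod0n -/(_ %| _) CyclicCover.dvd_genus.
Qed.
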